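(* Let $\nu>0$ and consider the VR-AdaGDA algorithm (see context), under the assumptions listed in the context, with either $\mathcal{X}\subset\mathbb{R}^{d_1}$ nonempty, compact and convex, or $\mathcal{X}=\mathbb{R}^{d_1}$. Suppose $B_t=b_tI_{d_2}$ with $\hat b\ge b_t\ge b>0$ for all $t\ge1$, and let the mini-batch size $q$ be of order $\kappa^\nu$ with $\frac{27\mu bq}{32}\le\frac{b}{6L_f}$, i.e. $q\le\frac{16}{81L_f\mu}$. Then there is a choice of the remaining parameters satisfying: $k>0$, $\eta_t=\frac{k}{(m+t)^{1/3}}$, $\alpha_{t+1}=c_1\eta_t^2$, $\beta_{t+1}=c_2\eta_t^2$, $c_1\ge\frac{2}{3k^3}+\frac{9\mu^2}{4}$, $c_2\ge\frac{2}{3k^3}+\frac{75L_f^2}{2}$, $m\ge\max(k^3,(c_1k)^3,(c_2k)^3)$, $0<\lambda\le\min\big(\frac{27\mu bq}{32},\frac{b}{6L_f}\big)$, $0<\gamma\le\min\big(\frac{\rho\lambda\mu\sqrt q}{L_f\sqrt{32\lambda^2+150q\kappa^2\hat b^2}},\frac{m^{1/3}\rho}{2Lk}\big)$, such that VR-AdaGDA finds an $\epsilon$-stationary point with gradient complexity $$4q\cdot T=\tilde O\big(\kappa^{4.5-\frac{\nu}{2}}\epsilon^{-3}\big).$$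
   Context: Problem: $\min_{x\in\mathcal{X}}\max_{y\in\mathcal{Y}}f(x,y)$, where $f(x,y)=\mathbb{E}_{\xi\sim\mathcal{D}}[f(x,y;\xi)]$, $f:\mathbb{R}^{d_1}\times\mathbb{R}^{d_2}\to\mathbb{R}$, and $\mathcal{Y}\subseteq\mathbb{R}^{d_2}$ is nonempty, compact and convex. $\|\cdot\|$ is the Euclidean norm for vectors and the spectral norm for matrices. $\nabla_x f,\nabla_y f$ denote partial gradients. For a mini-batch $\mathcal{B}=\{\xi_i\}_{i=1}^q$ write $\nabla f(x,y;\mathcal{B})=\frac1q\sum_{i=1}^q\nabla f(x,y;\xi_i)$. Assumptions. (i) For all $x\in\mathcal{X},y\in\mathcal{Y}$: $\mathbb{E}[\nabla_xf(x,y;\xi)]=\nabla_xf(x,y)$, $\mathbb{E}\|\nabla_xf(x,y)-\nabla_xf(x,y;\xi)\|^2\le\sigma^2$, and the same two properties hold for $\nabla_y$. (ii) $f(x,\cdot)$ is $\mu$-strongly concave on $\mathcal{Y}$ for every $x\in\mathcal{X}$ ($\mu>0$): $f(x,y_1)\le f(x,y_2)+\langle\nabla_yf(x,y_2),y_1-y_2\rangle-\frac\mu2\|y_1-y_2\|^2$ for all $y_1,y_2\in\mathcal{Y}$. Put $y^*(x)=\arg\max_{y\in\mathcal{Y}}f(x,y)$ and $F(x)=\max_{y\in\mathcal{Y}}f(x,y)=f(x,y^*(x))$. (iii) $F^*=\inf_{x\in\mathcal{X}}F(x)>-\infty$. (iv) The matrices $A_t\in\mathbb{R}^{d_1\times d_1}$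 are symmetric with $\lambda_{\min}(A_t)\ge\rho>0$ for all $t\ge1$. (v) Each component $f(\cdot,\cdot;\xi)$ has $L_f$-Lipschitz gradient: for all $\xi$, $x,x_1,x_2\in\mathcal{X}$, $y,y_1,y_2\in\mathcal{Y}$, $\|\nabla_xf(x_1,y;\xi)-\nabla_xf(x_2,y;\xi)\|\le L_f\|x_1-x_2\|$, $\|\nabla_xf(x,y_1;\xi)-\nabla_xf(x,y_2;\xi)\|\le L_f\|y_1-y_2\|$, $\|\nabla_yf(x_1,y;\xi)-\nabla_yf(x_2,y;\xi)\|\le L_f\|x_1-x_2\|$, $\|\nabla_yf(x,y_1;\xi)-\nabla_yf(x,y_2;\xi)\|\le L_f\|y_1-y_2\|$. Notation: $\kappa=L_f/\mu$, $L=L_f(1+\kappa)$. VR-AdaGDA algorithm: parameters $\gamma,\lambda,\eta_t,\alpha_t,\beta_t$ and batch size $q\ge1$. Start from $x_1\in\mathcal{X},y_1\in\mathcal{Y}$; draw i.i.d. $\mathcal{B}_1=\{\xi^1_i\}_{i=1}^q$ from $\mathcal{D}$; set $v_1=\nabla_xf(x_1,y_1;\mathcal{B}_1)$, $w_1=\nabla_yf(x_1,y_1;\mathcal{B}_1)$. For $t=1,2,\dots$: choose adaptive matrices $A_t\in\mathbb{R}^{d_1\times d_1}$, $B_t\in\mathbb{R}^{d_2\times d_2}$ (based on information available before $\mathcal{B}_{t+1}$ is drawn); $\tilde x_{t+1}=\arg\min_{x\in\mathcal{X}}\{\langle v_t,x\rangle+\frac1{2\gamma}(x-x_t)^TA_t(x-x_t)\}$,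 $x_{t+1}=x_t+\eta_t(\tilde x_{t+1}-x_t)$; $\tilde y_{t+1}=\arg\max_{y\in\mathcal{Y}}\{\langle w_t,y\rangle-\frac1{2\lambda}(y-y_t)^TB_t(y-y_t)\}$, $y_{t+1}=y_t+\eta_t(\tilde y_{t+1}-y_t)$; draw a fresh i.i.d. mini-batch $\mathcal{B}_{t+1}=\{\xi^{t+1}_i\}_{i=1}^q$ from $\mathcal{D}$ (independent of the past) and set $v_{t+1}=\nabla_xf(x_{t+1},y_{t+1};\mathcal{B}_{t+1})+(1-\alpha_{t+1})\big(v_t-\nabla_xf(x_t,y_t;\mathcal{B}_{t+1})\big)$, $w_{t+1}=\nabla_yf(x_{t+1},y_{t+1};\mathcal{B}_{t+1})+(1-\beta_{t+1})\big(w_t-\nabla_yf(x_t,y_t;\mathcal{B}_{t+1})\big)$. The output after $T$ iterations is $x_\zeta$ with $\zeta$ uniform on $\{1,\dots,T\}$. Each iteration uses $4q$ stochastic partial gradients, so the gradient complexity (number of stochastic gradient evaluations) of $T$ iterations is $4qT$. $\epsilon$-stationarity: for compact $\mathcal{X}$ it means $\mathbb{E}\|\mathcal{G}_{\mathcal{X}}(x_\zeta,\nabla F(x_\zeta),\gamma)\|\le\epsilon$, where $\mathcal{G}_{\mathcal{X}}(x_t,\nabla F(x_t),\gamma)=\frac1\gamma(x_t-x^*_{t+1})$ and $x^*_{t+1}=\arg\min_{x\in\mathcal{X}}\{\langle\nabla F(x_t),x\rangle+\frac1{2\gamma}(x-x_t)^TA_t(x-x_t)\}$; for $\mathcal{X}=\mathbb{R}^{d_1}$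 it means $\mathbb{E}\|\nabla F(x_\zeta)\|\le\epsilon$. Asymptotic convention: $\tilde O(\cdot)$ hides logarithmic factors and constants that may depend on $L_f,\sigma,\rho,k,b,\hat b,F(x_1)-F^*,\|y_1-y^*(x_1)\|$ and $\nu$ and, when $\mathcal{X}=\mathbb{R}^{d_1}$, on an upper bound (assumed finite and independent of $T$) for $\frac1T\sum_{t=1}^T\mathbb{E}\|A_t\|^2$; the quantities $k,b,\hat b$ are treated as $O(1)$. ''$q$ of order $\kappa^\nu$'' means $q$ lies between constant multiples of $\kappa^\nu$. *)

(* Defs.v *)
From HB Require Import structures.
From mathcomp Require Import all_boot all_order all_algebra.
From mathcomp Require Import all_classical all_reals all_analysis.

Set Implicit Arguments.
Unset Strict Implicit.
Unset Printing Implicit Defensive.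

Import Order.TTheory GRing.Theory Num.Theory.
Import numFieldNormedType.Exports.

Local Open Scope classical_set_scope.
Local Open Scope ring_scope.

(* The library norm on 'rV[R]_n is the sup norm: it only serves for the topology
   (compactness, differentiability); the Euclidean norm is [enorm]. *)

Section Euclidean.
Context {R : realType}.

Definition dotv n (u v : 'rV[R]_n) : R := (u *m v^T) 0 0.

Definition enorm n (u : 'rV[R]_n) : R := Num.sqrt (dotv u u).

Definition quadf n (A : 'M[R]_n) (u : 'rV[R]_n) : R := (u *m A *m u^T) 0 0.

Definition specnorm n (A : 'M[R]_n) : R :=
  sup [set enorm (u *m A) | u in [set u : 'rV[R]_n | enorm u <= 1]].

(* A symmetric A has only real eigenvalues, so the last clause is
   lambda_min(A) >= rho. *)
Definition sym_lambda_min_ge n (rho : R) (A : 'M[R]_n) : Prop :=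
  A^T = A /\ forall a : R, eigenvalue A a -> rho <= a.

Definition is_argmin (T : Type) (S : set T) (g : T -> R) (z : T) : Prop :=
  S z /\ forall z', S z' -> g z <= g z'.

Definition is_argmax (T : Type) (S : set T) (g : T -> R) (z : T) : Prop :=
  S z /\ forall z', S z' -> g z' <= g z.

Definition gradient n (g : 'rV[R]_n -> R) (x : 'rV[R]_n) : 'rV[R]_n :=
  \row_i 'd g x (delta_mx 0 i).

(* First-order expansion of g at x along S:
   g z = g x + <u, z - x> + o(|z - x|) as z -> x in S. *)
Definition is_gradient_on n (S : set 'rV[R]_n) (g : 'rV[R]_n -> R)
    (x u : 'rV[R]_n) : Prop :=
  forall e : R, 0 < e -> \forall z \near within S (nbhs x),
    `|g z - g x - dotv u (z - x)| <= e * enorm (z - x).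

(* The gradient of a function whose regularity is only controlled on S.  If
   S = setT this is the usual gradient.  If S is convex, u is determined up to
   the orthogonal complement of the span of S - S. *)
Definition gradient_on n (S : set 'rV[R]_n) (g : 'rV[R]_n -> R)
    (x : 'rV[R]_n) : 'rV[R]_n :=
  xget 0 [set u | is_gradient_on S g x u].

End Euclidean.

Section Minimax.
Context {R : realType} {d1 d2 : nat} {dXi : measure_display}
  {Xi : measurableType dXi}.
Variables (D : probability Xi R) (f : 'rV[R]_d1 -> 'rV[R]_d2 -> Xi -> R).
Variables (X : set 'rV[R]_d1) (Y : set 'rV[R]_d2).

Definition fmean (x : 'rV[R]_d1) (y : 'rV[R]_d2) : R :=
  fine (\int[D]_z (f x y z)%:E)%E.

Definition gradx (h : 'rV[R]_d1 -> 'rV[R]_d2 -> R) x y : 'rV[R]_d1 :=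
  gradient (h ^~ y) x.

Definition grady (h : 'rV[R]_d1 -> 'rV[R]_d2 -> R) x y : 'rV[R]_d2 :=
  gradient (h x) y.

Definition sgradx (z : Xi) := gradx (fun x y => f x y z).

Definition sgrady (z : Xi) := grady (fun x y => f x y z).

Definition ystar (x : 'rV[R]_d1) : 'rV[R]_d2 :=
  xget 0 [set y | is_argmax Y (fmean x) y].

Definition Fmax (x : 'rV[R]_d1) : R := sup [set fmean x y | y in Y].

(* Danskin's formula makes F differentiable along X; F need not be
   differentiable in the ambient space at boundary points of X, since nothing
   is assumed on f outside X. *)
Definition gradF : 'rV[R]_d1 -> 'rV[R]_d1 := gradient_on X Fmax.

Definition Fstar : R := inf [set Fmax x | x in X].

Record minimax_assumptions (Lf mu sigma : R) : Prop := {
  ma_integrable : forall x y, D.-integrable setT (fun z => (f x y z)%:E);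
  ma_diffx : forall x y, X x -> Y y -> differentiable (fmean ^~ y) x;
  ma_diffy : forall x y, X x -> Y y -> differentiable (fmean x) y;
  ma_sdiffx : forall x y z, X x -> Y y ->
    differentiable (fun x' => f x' y z) x;
  ma_sdiffy : forall x y z, X x -> Y y ->
    differentiable (fun y' => f x y' z) y;
  ma_unbiasedx : forall x y, X x -> Y y -> forall i,
    D.-integrable setT (fun z => (sgradx z x y 0 i)%:E) /\
    (\int[D]_z (sgradx z x y 0 i)%:E = (gradx fmean x y 0 i)%:E)%E;
  ma_unbiasedy : forall x y, X x -> Y y -> forall i,
    D.-integrable setT (fun z => (sgrady z x y 0 i)%:E) /\
    (\int[D]_z (sgrady z x y 0 i)%:E = (grady fmean x y 0 i)%:E)%E;
  ma_variancex : forall x y, X x -> Y y ->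
    (\int[D]_z (enorm (gradx fmean x y - sgradx z x y) ^+ 2)%:E
      <= (sigma ^+ 2)%:E)%E;
  ma_variancey : forall x y, X x -> Y y ->
    (\int[D]_z (enorm (grady fmean x y - sgrady z x y) ^+ 2)%:E
      <= (sigma ^+ 2)%:E)%E;
  ma_strongly_concave : forall x y1 y2, X x -> Y y1 -> Y y2 ->
    fmean x y1 <= fmean x y2 + dotv (grady fmean x y2) (y1 - y2)
                  - mu / 2 * enorm (y1 - y2) ^+ 2;
  ma_F_bounded_below : has_lbound [set Fmax x | x in X];
  ma_lipxx : forall z x1 x2 y, X x1 -> X x2 -> Y y ->
    enorm (sgradx z x1 y - sgradx z x2 y) <= Lf * enorm (x1 - x2);
  ma_lipxy : forall z x y1 y2, X x -> Y y1 -> Y y2 ->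
    enorm (sgradx z x y1 - sgradx z x y2) <= Lf * enorm (y1 - y2);
  ma_lipyx : forall z x1 x2 y, X x1 -> X x2 -> Y y ->
    enorm (sgrady z x1 y - sgrady z x2 y) <= Lf * enorm (x1 - x2);
  ma_lipyy : forall z x y1 y2, X x -> Y y1 -> Y y2 ->
    enorm (sgrady z x y1 - sgrady z x y2) <= Lf * enorm (y1 - y2)
}.

Definition prox_argmin (gam : R) (A : 'M[R]_d1) (xt g : 'rV[R]_d1) :
    set 'rV[R]_d1 :=
  [set x | is_argmin X
             (fun x' => dotv g x' + (2 * gam)^-1 * quadf A (x' - xt)) x].

Definition prox_argmax (lam : R) (B : 'M[R]_d2) (yt g : 'rV[R]_d2) :
    set 'rV[R]_d2 :=
  [set y | is_argmax Y
             (fun y' => dotv g y' - (2 * lam)^-1 * quadf B (y' - yt)) y].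

Definition gradient_mapping (gam : R) (A : 'M[R]_d1) (xt g : 'rV[R]_d1) :
    'rV[R]_d1 :=
  gam^-1 *: (xt - xget 0 (prox_argmin gam A xt g)).

End Minimax.

Section Algorithm.
Context {R : realType} {d1 d2 : nat} {dXi dOm : measure_display}
  {Xi : measurableType dXi} {Om : measurableType dOm}.

Definition measurable_wrt (d : measure_display) (T : measurableType d)
    (G : set (set Om)) (Z : Om -> T) : Prop :=
  forall S, measurable S -> G (Z @^-1` S).

Definition mx_measurable_wrt m n (G : set (set Om)) (Z : Om -> 'M[R]_(m, n)) :
    Prop :=
  forall i j, measurable_wrt G (fun o => Z o i j).

Definition filtration (Fil : nat -> set (set Om)) : Prop :=
  [/\ forall t, sigma_algebra setT (Fil t),
      forall t, Fil t `<=` measurable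
    & forall t, Fil t `<=` Fil t.+1].

Variables (P : probability Om R) (D : probability Xi R).
Variables (f : 'rV[R]_d1 -> 'rV[R]_d2 -> Xi -> R).
Variables (X : set 'rV[R]_d1) (Y : set 'rV[R]_d2).

Definition batch_gradx q (batch : 'I_q -> Xi) (x : 'rV[R]_d1) (y : 'rV[R]_d2) :
    'rV[R]_d1 :=
  q%:R^-1 *: \sum_(i < q) sgradx f (batch i) x y.

Definition batch_grady q (batch : 'I_q -> Xi) (x : 'rV[R]_d1) (y : 'rV[R]_d2) :
    'rV[R]_d2 :=
  q%:R^-1 *: \sum_(i < q) sgrady f (batch i) x y.

(* The product rule says at once that the samples of the mini-batch number
   t + 1 have law D, are mutually independent, and are independent of the past
   Fil t. *)
Definition fresh_batches q (Fil : nat -> set (set Om))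
    (xi : nat -> 'I_q -> Om -> Xi) : Prop :=
  (forall t i, (0 < t)%N -> measurable_wrt (Fil t) (xi t i)) /\
  (forall t E (S : 'I_q -> set Xi), Fil t E -> (forall i, measurable (S i)) ->
    (P (E `&` \bigcap_(i in [set: 'I_q]) (xi t.+1 i @^-1` S i))
       = P E * \prod_(i < q) D (S i))%E).

(* An execution on the probability space P.  The iteration counter starts at
   t = 1 (values at t = 0 are unused); Fil t is the information available
   before the mini-batch number t + 1 is drawn.  vr_xt t and vr_yt t are the
   points written \tilde x_t and \tilde y_t. *)
Record vr_adagda (q : nat) (gam lam : R) (eta alpha beta : nat -> R)
    (x1 : 'rV[R]_d1) (y1 : 'rV[R]_d2) := {
  vr_fil : nat -> set (set Om);
  vr_xi : nat -> 'I_q -> Om -> Xi;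
  vr_x : nat -> Om -> 'rV[R]_d1;
  vr_y : nat -> Om -> 'rV[R]_d2;
  vr_v : nat -> Om -> 'rV[R]_d1;
  vr_w : nat -> Om -> 'rV[R]_d2;
  vr_A : nat -> Om -> 'M[R]_d1;
  vr_B : nat -> Om -> 'M[R]_d2;
  vr_xt : nat -> Om -> 'rV[R]_d1;
  vr_yt : nat -> Om -> 'rV[R]_d2;
  vr_filtration : filtration vr_fil;
  vr_batches : fresh_batches vr_fil vr_xi;
  vr_adapted : forall t, (0 < t)%N ->
    [/\ mx_measurable_wrt (vr_fil t) (vr_x t),
        mx_measurable_wrt (vr_fil t) (vr_y t),
        mx_measurable_wrt (vr_fil t) (vr_v t)
      & mx_measurable_wrt (vr_fil t) (vr_w t)] /\
    [/\ mx_measurable_wrt (vr_fil t) (vr_A t),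
        mx_measurable_wrt (vr_fil t) (vr_B t),
        mx_measurable_wrt (vr_fil t) (vr_xt t.+1)
      & mx_measurable_wrt (vr_fil t) (vr_yt t.+1)];
  vr_x1 : forall o, vr_x 1 o = x1;
  vr_y1 : forall o, vr_y 1 o = y1;
  vr_v1 : forall o, vr_v 1 o = batch_gradx (vr_xi 1 ^~ o) x1 y1;
  vr_w1 : forall o, vr_w 1 o = batch_grady (vr_xi 1 ^~ o) x1 y1;
  vr_xtS : forall t o, (0 < t)%N ->
    prox_argmin X gam (vr_A t o) (vr_x t o) (vr_v t o) (vr_xt t.+1 o);
  vr_xS : forall t o, (0 < t)%N ->
    vr_x t.+1 o = vr_x t o + eta t *: (vr_xt t.+1 o - vr_x t o);
  vr_ytS : forall t o, (0 < t)%N ->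
    prox_argmax Y lam (vr_B t o) (vr_y t o) (vr_w t o) (vr_yt t.+1 o);
  vr_yS : forall t o, (0 < t)%N ->
    vr_y t.+1 o = vr_y t o + eta t *: (vr_yt t.+1 o - vr_y t o);
  vr_vS : forall t o, (0 < t)%N ->
    vr_v t.+1 o =
      batch_gradx (vr_xi t.+1 ^~ o) (vr_x t.+1 o) (vr_y t.+1 o)
      + (1 - alpha t.+1) *:
        (vr_v t o - batch_gradx (vr_xi t.+1 ^~ o) (vr_x t o) (vr_y t o));
  vr_wS : forall t o, (0 < t)%N ->
    vr_w t.+1 o =
      batch_grady (vr_xi t.+1 ^~ o) (vr_x t.+1 o) (vr_y t.+1 o)
      + (1 - beta t.+1) *:
        (vr_w t o - batch_grady (vr_xi t.+1 ^~ o) (vr_x t o) (vr_y t o))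
}.

(* zeta is uniform on {1, ..., T} and independent of the first T iterations. *)
Definition uniform_index (Fil : nat -> set (set Om)) (T : nat)
    (zeta : Om -> nat) : Prop :=
  [/\ forall o, (1 <= zeta o <= T)%N,
      forall t, measurable (zeta @^-1` [set t])
    & forall t E, (1 <= t <= T)%N -> Fil T E ->
        (P (E `&` zeta @^-1` [set t]) = P E * (T%:R^-1)%:E)%E].

Section Stationarity.
Variables (q : nat) (gam lam : R) (eta alpha beta : nat -> R).
Variables (x1 : 'rV[R]_d1) (y1 : 'rV[R]_d2).
Variable run : vr_adagda q gam lam eta alpha beta x1 y1.

Definition stationary_mapping (zeta : Om -> nat) (eps : R) : Prop :=
  (\int[P]_o (enorm (gradient_mapping X gam (vr_A run (zeta o) o)
                       (vr_x run (zeta o) o)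
                       (gradF D f X Y (vr_x run (zeta o) o))))%:E
     <= eps%:E)%E.

Definition stationary_gradient (zeta : Om -> nat) (eps : R) : Prop :=
  (\int[P]_o (enorm (gradF D f X Y (vr_x run (zeta o) o)))%:E <= eps%:E)%E.

Definition mean_sq_A_le (Abar : R) : Prop :=
  forall T : nat, (0 < T)%N ->
    ((T%:R^-1)%:E *
       \sum_(1 <= t < T.+1) \int[P]_o (specnorm (vr_A run t o) ^+ 2)%:E
     <= Abar%:E)%E.

End Stationarity.
End Algorithm.

(* Main.v *)
From HB Require Import structures.
From mathcomp Require Import all_boot all_order all_algebra.
From mathcomp Require Import all_classical all_reals all_analysis.
From mathcomp Require Import measurable_realfun.
From mathcomp Require Import ring lra zify.
Require Import Defs.

(** Every step is controlled by the potential
      [rho / gam * F x + w * |y - y^*(x)|^2],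
    whose decrease dominates the squared moves and the squared tracking error
    [|y - y^*(x)|^2], and is spoilt only by the errors of the estimators [v] and
    [w] of the partial gradients.  The ingredients are deterministic: Danskin's
    formula makes [F] smooth with constant [Lf (1 + kappa)] ([danskin]), so that
    the proximal step in [x] decreases [F] ([descent_step]); strong concavity makes
    the proximal step in [y] a contraction towards [y^*(x)] ([ascent_step]); and
    [y^*] is [kappa]-Lipschitz ([ystar_lip]), so that its drift is paid by the
    move in [x] if [gam] is small ([tracking_step], [potential_step]).

    The estimators obey a stochastic recursion.  Given the past, the samples of a
    mini-batch are independent, so that their centred contributions are orthogonal
    to the past and to each other ([fresh_orthogonal], [batch_second_moment]).  The
    momentum correction makes each contribution of the size of the last move, up to
    a fraction [alpha] of the noise ([oracle_error_step]).  With [alpha] of order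
    [eta^2], the sum of the mean squared errors divided by the step size decreases
    up to a small multiple of the squared moves and a summand of order
    [sigma^2 eta^3 / q] ([momentum_drift]).  Since [eta_t^3 = 1 / (m + t)], summing
    both inequalities leaves a logarithm ([momentum_sum]): with [gam] of order
    [q mu^3], the time average of the expected gap
      [rho^2 / (8 gam^2) |dx|^2 + 2 Lf^2 |y - y^*(x)|^2 + |v - grad_x f|^2]
    is of order [kappa^3 / (q T^(2/3))] up to a logarithm
    ([stationarity_gap_sum]).

    The squared norm of the gradient mapping is at most a multiple of this gap.
    Without constraint, [|v|] is at most the spectral norm of [A_t] times
    [|dx| / gam], and the mean square of the spectral norms is bounded by
    hypothesis.  As the output time is independent of the run, a time average is an
    expected value at the output ([uniform_index_integral]).  Reaching [eps] takes
    [T] of order [(kappa^3 / (q eps^2))^(3/2)] up to logarithms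
    ([iteration_count]), hence [q T] of order [kappa^(9/2) q^(-1/2) eps^(-3)], and
    [q] is of order [kappa^nu] ([iteration_budget]).

    Measurability needs care in two places.  The partial gradients are measurable
    in the sample and Lipschitz in the point, hence jointly measurable along the
    iterates ([measurable_caratheodory]).  The gradient mapping at the output is
    only compared with a measurable majorant, which is enough because the integral
    of a nonnegative function is monotone without measurability
    ([le_integral_pointwise]). *)


Set Implicit Arguments.
Unset Strict Implicit.
Unset Printing Implicit Defensive.

Import Order.TTheory GRing.Theory Num.Theory.
Import numFieldNormedType.Exports.

Local Open Scope classical_set_scope.
Local Open Scope ring_scope.

(** * Euclidean vectors *)

Section EuclideanSpace.
Context {R : realType} {n : nat}.
Implicit Types (u v w : 'rV[R]_n) (A : 'M[R]_n).

Lemma dotvE u v : dotv u v = \sum_i u 0 i * v 0 i.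
Proof. by rewrite /dotv mxE; apply: eq_bigr => i _; rewrite mxE. Qed.

Lemma dotvC u v : dotv u v = dotv v u.
Proof. by rewrite !dotvE; apply: eq_bigr => i _; rewrite mulrC. Qed.

Lemma dotvDl u v w : dotv (u + v) w = dotv u w + dotv v w.
Proof. by rewrite /dotv mulmxDl mxE. Qed.

Lemma dotvZl a u v : dotv (a *: u) v = a * dotv u v.
Proof. by rewrite /dotv -scalemxAl mxE. Qed.

Lemma dotvNl u v : dotv (- u) v = - dotv u v.
Proof. by rewrite -scaleN1r dotvZl mulN1r. Qed.

Lemma dotvBl u v w : dotv (u - v) w = dotv u w - dotv v w.
Proof. by rewrite dotvDl dotvNl. Qed.

Lemma dotvDr u v w : dotv u (v + w) = dotv u v + dotv u w.
Proof. by rewrite dotvC dotvDl !(dotvC u). Qed.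

Lemma dotvZr a u v : dotv u (a *: v) = a * dotv u v.
Proof. by rewrite dotvC dotvZl dotvC. Qed.

Lemma dotvNr u v : dotv u (- v) = - dotv u v.
Proof. by rewrite dotvC dotvNl dotvC. Qed.

Lemma dotvBr u v w : dotv u (v - w) = dotv u v - dotv u w.
Proof. by rewrite dotvDr dotvNr. Qed.

Lemma dot0v u : dotv 0 u = 0.
Proof. by rewrite -(scale0r 0) dotvZl mul0r. Qed.

Lemma dotv_sumr (I : finType) u (F : I -> 'rV[R]_n) :
  dotv u (\sum_i F i) = \sum_i dotv u (F i).
Proof. by elim/big_rec2: _ => [|i x y _ <-]; rewrite ?dotvDr // dotvC dot0v. Qed.

Lemma dotv_ge0 u : 0 <= dotv u u.
Proof. by rewrite dotvE sumr_ge0 // => i _; rewrite -expr2 sqr_ge0. Qed.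

Lemma enorm_ge0 u : 0 <= enorm u.
Proof. exact: sqrtr_ge0. Qed.

Lemma sqr_enorm u : enorm u ^+ 2 = dotv u u.
Proof. by rewrite sqr_sqrtr // dotv_ge0. Qed.

Lemma sqr_enormE u : enorm u ^+ 2 = \sum_i u 0 i ^+ 2.
Proof. by rewrite sqr_enorm dotvE; apply: eq_bigr => i _; rewrite expr2. Qed.

Lemma enorm_eq0 u : enorm u = 0 -> u = 0.
Proof.
move=> u0; have : enorm u ^+ 2 == 0 by rewrite u0 expr0n.
rewrite sqr_enormE psumr_eq0 => [/allP ui0|i _]; last exact: sqr_ge0.
apply/rowP => i; rewrite mxE; apply/eqP; rewrite -sqrf_eq0.
exact: implyP (ui0 i (mem_index_enum _)) _.
Qed.

Lemma enorm0 : enorm (0 : 'rV[R]_n) = 0.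
Proof. by rewrite /enorm dot0v sqrtr0. Qed.

Lemma enormN u : enorm (- u) = enorm u.
Proof. by rewrite /enorm dotvNl dotvNr opprK. Qed.

Lemma enormC u v : enorm (u - v) = enorm (v - u).
Proof. by rewrite -opprB enormN. Qed.

Lemma enormZ a u : enorm (a *: u) = `|a| * enorm u.
Proof.
by rewrite /enorm dotvZl dotvZr mulrA -expr2 sqrtrM ?sqr_ge0 // sqrtr_sqr.
Qed.

Lemma sqr_enormD u v :
  enorm (u + v) ^+ 2 = enorm u ^+ 2 + 2 * dotv u v + enorm v ^+ 2.
Proof. by rewrite !sqr_enorm dotvDl !dotvDr (dotvC v u); ring. Qed.

Lemma sqr_enormB u v :
  enorm (u - v) ^+ 2 = enorm u ^+ 2 - 2 * dotv u v + enorm v ^+ 2.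
Proof. by rewrite sqr_enormD dotvNr enormN mulrN. Qed.

(** From [|a u - b v|^2 >= 0] with [a = |v|] and [b = |u|]. *)
Lemma dotv_le u v : dotv u v <= enorm u * enorm v.
Proof.
have [u0|u0] := eqVneq (enorm u) 0.
  by rewrite (enorm_eq0 u0) dot0v enorm0 mul0r.
have [v0|v0] := eqVneq (enorm v) 0.
  by rewrite (enorm_eq0 v0) dotvC dot0v enorm0 mulr0.
have ab : 0 < enorm u * enorm v.
  by rewrite mulr_gt0 // lt_def ?u0 ?v0 enorm_ge0.
have := sqr_ge0 (enorm (enorm v *: u - enorm u *: v)).
rewrite sqr_enormB dotvZl dotvZr !enormZ !ger0_norm ?enorm_ge0 // => H.
rewrite -(ler_pM2l ab); lra.
Qed.

Lemma norm_dotv_le u v : `|dotv u v| <= enorm u * enorm v.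
Proof.
by rewrite ler_norml dotv_le andbT lerNl -dotvNl (le_trans (dotv_le _ _)) ?enormN.
Qed.

Lemma enormD u v : enorm (u + v) <= enorm u + enorm v.
Proof.
rewrite -(ler_pXn2r (n := 2)) // ?nnegrE ?addr_ge0 ?enorm_ge0 //.
by rewrite sqr_enormD; have := dotv_le u v; lra.
Qed.

Lemma enormB_trans w u v : enorm (u - v) <= enorm (u - w) + enorm (w - v).
Proof. by rewrite (le_trans _ (enormD _ _)) // subrKA. Qed.

Lemma sqr_enormD_le u v :
  enorm (u + v) ^+ 2 <= 2 * enorm u ^+ 2 + 2 * enorm v ^+ 2.
Proof.
by have := sqr_ge0 (enorm (u - v)); rewrite sqr_enormD sqr_enormB; lra.
Qed.

(** Young's inequality, from [|s u - v|^2 >= 0]. *)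
Lemma dotv_young s u v : 0 < s ->
  dotv u v <= s / 2 * enorm u ^+ 2 + (2 * s)^-1 * enorm v ^+ 2.
Proof.
move=> s0; have := sqr_ge0 (enorm (s *: u - v)).
rewrite sqr_enormB dotvZl enormZ (ger0_norm (ltW s0)) => H.
rewrite -(ler_pM2l s0).
have -> : s * (s / 2 * enorm u ^+ 2 + (2 * s)^-1 * enorm v ^+ 2) =
   s ^+ 2 * enorm u ^+ 2 / 2 + enorm v ^+ 2 / 2 by field; rewrite gt_eqF.
lra.
Qed.

Lemma enorm_sqrD_young r u v : 0 < r ->
  enorm (u + v) ^+ 2 <= (1 + r) * enorm u ^+ 2 + (1 + r^-1) * enorm v ^+ 2.
Proof.
move=> r0; have := dotv_young u v r0; rewrite sqr_enormD invfM; lra.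
Qed.

Lemma quadfE A u : quadf A u = dotv (u *m A) u.
Proof. by []. Qed.

Lemma quadfD A u v : A^T = A ->
  quadf A (u + v) = quadf A u + 2 * dotv (u *m A) v + quadf A v.
Proof.
move=> As; rewrite !quadfE mulmxDl dotvDl !dotvDr.
suff -> : dotv (v *m A) u = dotv (u *m A) v by ring.
by rewrite dotvC /dotv trmx_mul As mulmxA.
Qed.

Lemma quadfZ A s u : quadf A (s *: u) = s ^+ 2 * quadf A u.
Proof. by rewrite !quadfE -scalemxAl dotvZl dotvZr; ring. Qed.

Lemma quadf_scalar b u : quadf b%:M u = b * enorm u ^+ 2.
Proof. by rewrite quadfE mul_mx_scalar dotvZl sqr_enorm. Qed.

(** The topology of row vectors is given by the sup norm, to which the Euclidean
    norm has to be compared. *)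
Lemma mx_norm_le_enorm u : `|u| <= enorm u.
Proof.
rewrite [leLHS]/Num.Def.normr /= mx_normrE; apply: bigmax_le; first exact: enorm_ge0.
move=> [i j] _ /=; rewrite ord1 -(ler_pXn2r (n := 2)) // ?nnegrE ?enorm_ge0 //.
rewrite real_normK ?num_real // sqr_enormE (bigD1 j) //= lerDl.
by apply: sumr_ge0 => k _; exact: sqr_ge0.
Qed.

Lemma coord_le_norm u i : `|u 0 i| <= `|u|.
Proof.
rewrite [leRHS]/Num.Def.normr /= mx_normrE.
exact: (@le_bigmax _ _ _ 0 (fun p : 'I_1 * 'I_n => `|u p.1 p.2|) (0, i)).
Qed.

(** The factor [n + 1], larger than the optimal [sqrt n], is positive also for
    [n = 0]. *)
Lemma enorm_le_mx_norm u : enorm u <= n.+1%:R * `|u|.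
Proof.
rewrite -(ler_pXn2r (n := 2)) // ?nnegrE ?enorm_ge0 ?mulr_ge0 //.
rewrite sqr_enormE exprMn.
have -> : \sum_i u 0 i ^+ 2 = \sum_i `|u 0 i| ^+ 2.
  by apply: eq_bigr => i _; rewrite real_normK ?num_real.
apply: (@le_trans _ _ (\sum_(i < n) `|u| ^+ 2)).
  by apply: ler_sum => i _; rewrite ler_pXn2r ?nnegrE // coord_le_norm.
rewrite sumr_const card_ord -[leLHS]mulr_natl; apply: ler_wpM2r.
  exact: sqr_ge0.
by rewrite -natrX ler_nat; nia.
Qed.

Lemma enorm_coord_le u i : `|u 0 i| <= enorm u.
Proof. exact: le_trans (coord_le_norm u i) (mx_norm_le_enorm u). Qed.

End EuclideanSpace.

(** * Proximal problems *)

Section ConvexAnalysis.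
Context {R : realType}.

Lemma convex_segment n (S : set 'rV[R]_n) x y s :
  convex_set S -> S x -> S y -> 0 <= s <= 1 -> S (x + s *: (y - x)).
Proof.
move=> Sc Sx Sy s01.
have s01' : Itv.spec (@Itv.num_sem R) (Itv.Real `[0%Z, 1%Z]) s.
  by apply/andP; split; rewrite ?num_real //= in_itv /=.
have := Sc y x (Itv.mk s01'); rewrite !inE => /(_ Sy Sx).
rewrite /conv /= /isConvexSpace.conv /=.
suff -> : x + s *: (y - x) = s *: y + (1 - s) *: x by [].
by rewrite scalerBr scalerBl scale1r addrCA addrC.
Qed.

(** Dividing by [s] and letting [s] tend to [0]. *)
Lemma slope_ge0 (a c : R) :
  (forall s, 0 < s <= 1 -> 0 <= s * a + s ^+ 2 * c) -> 0 <= a.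
Proof.
move=> H; rewrite leNgt; apply/negP => a0.
(* small enough for the quadratic term to be at most half of the linear one *)
pose s := (- a) / (2 * (`|c| - a)).
have c0 := normr_ge0 c.
have d0 : 0 < 2 * (`|c| - a) by lra.
have s0 : 0 < s by rewrite divr_gt0 //; lra.
have s1 : s <= 1 by rewrite ler_pdivrMr //; lra.
have := H s; rewrite s0 s1 => /(_ isT).
have -> : s * a + s ^+ 2 * c = s * (a + s * c) by ring.
rewrite pmulr_rge0 // => {}H.
have sc : s * c <= s * `|c| by rewrite ler_pM2l // ler_norm.
have : s * (2 * (`|c| - a)) = - a by rewrite /s; field; rewrite gt_eqF //; lra.
have sa : 0 < s * (- a) by rewrite mulr_gt0 // oppr_gt0.
move=> E; have : s * `|c| - s * a = - a / 2 by lra.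
nra.
Qed.

(** First variation of the quadratic model along the segment from [z] to [z']. *)
Lemma argmin_quadf_optimality n (S : set 'rV[R]_n) (A : 'M[R]_n)
    (x g z z' : 'rV[R]_n) (c : R) : convex_set S -> A^T = A ->
  is_argmin S (fun u => dotv g u + c * quadf A (u - x)) z -> S z' ->
  0 <= dotv (g + (2 * c) *: ((z - x) *m A)) (z' - z).
Proof.
move=> Sc As [Sz zmin] Sz'.
apply: (@slope_ge0 _ (c * quadf A (z' - z))) => s /andP[s0 s1].
have Szs : S (z + s *: (z' - z)) by apply: convex_segment; rewrite ?(ltW s0).
have := zmin _ Szs.
rewrite (addrAC z) (quadfD (z - x)) // quadfZ !dotvZr dotvDr dotvZr.
rewrite dotvDl dotvZl; lra.
Qed.

Lemma sum_continuous (T : topologicalType) (I : finType) (F : I -> T -> R)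
    (g : T -> R) : (forall u, g u = \sum_i F i u) ->
  (forall i, continuous (F i)) -> continuous g.
Proof.
move=> /funext -> Fc; elim: (index_enum I) => [|i r IH] u; rewrite /continuous_at.
  under eq_fun do rewrite big_nil; rewrite big_nil; exact: cvg_cst.
under eq_fun do rewrite big_cons; rewrite big_cons; apply: cvgD; first exact: Fc.
exact: IH.
Qed.

Lemma mulmx_coord n (u : 'rV[R]_n) (A : 'M[R]_n) i :
  (u *m A) 0 i = \sum_j u 0 j * A j i.
Proof. by rewrite mxE. Qed.

Lemma continuous_dotvl n (g : 'rV[R]_n) : continuous (fun u => dotv g u).
Proof.
apply: (sum_continuous (dotvE g)) => i u.
by apply: continuousM; [exact: cst_continuous|exact: coord_continuous].
Qed.

Lemma continuous_quadf n (A : 'M[R]_n) (x : 'rV[R]_n) :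
  continuous (fun u : 'rV[R]_n => quadf A (u - x)).
Proof.
apply: (sum_continuous (fun u : 'rV[R]_n => dotvE ((u - x) *m A) (u - x))) => i.
have sub_cont j : continuous (fun u : 'rV[R]_n => (u - x) 0 j).
  have -> : (fun u : 'rV[R]_n => (u - x) 0 j) = (fun u => u 0 j - x 0 j).
    by apply/funext => v; rewrite !mxE.
  by move=> v; apply: continuousB; [exact: coord_continuous|exact: cst_continuous].
move=> u; apply: continuousM; last exact: sub_cont.
move: u; apply: (sum_continuous (fun u : 'rV[R]_n => mulmx_coord (u - x) A i)) => j u.
by apply: continuousM; [exact: sub_cont|exact: cst_continuous].
Qed.

Lemma argmin_quadf_exists n (S : set 'rV[R]_n) (A : 'M[R]_n)
    (x g : 'rV[R]_n) (c : R) : S !=set0 -> compact S ->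
  exists z, is_argmin S (fun u => dotv g u + c * quadf A (u - x)) z.
Proof.
move=> S0 Scomp.
have [|z zS zmin] := @EVT_min_rV R n
    (fun u => dotv g u + c * quadf A (u - x)) S S0 Scomp.
  apply: continuous_subspaceT => u.
  apply: continuousD; first exact: continuous_dotvl.
  by apply: continuousM; [exact: cst_continuous|exact: continuous_quadf].
by exists z; split; [exact: set_mem|move=> z' Sz'; apply: zmin; exact: mem_set].
Qed.

(** The minimum [m] of the quadratic form on the unit sphere is an eigenvalue:
    [A - m I] is positive semidefinite and its form vanishes at the minimizer
    [u], hence so does the first variation [h |-> u (A - m I) h^T]. *)
Lemma quadf_ge_lambda_min n (rho : R) (A : 'M[R]_n) (u : 'rV[R]_n) :
  sym_lambda_min_ge rho A -> rho * enorm u ^+ 2 <= quadf A u.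
Proof.
move=> [As Aev].
have [->|u0] := eqVneq u 0.
  by rewrite enorm0 quadfE mul0mx dot0v expr0n mulr0.
have normalize (v : 'rV[R]_n) : v != 0 -> enorm ((enorm v)^-1 *: v) = 1.
  move=> v0; have e0 : enorm v != 0 by apply: contraNneq v0 => /enorm_eq0 ->.
  by rewrite enormZ ger0_norm ?invr_ge0 ?enorm_ge0 // mulVf.
pose S := [set v : 'rV[R]_n | enorm v = 1].
have S0 : S !=set0 by exists ((enorm u)^-1 *: u); exact: normalize.
have Scomp : compact S.
  apply: bounded_closed_compact.
    exists 1; split; first exact: num_real.
    move=> M M1 v Sv; apply: (le_trans (mx_norm_le_enorm v)).
    by rewrite Sv ltW.
  have -> : S = (fun v => quadf 1%:M (v - 0)) @^-1` [set 1].
    apply/seteqP; split => v; rewrite /S /= subr0 quadf_scalar mul1r.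
      by move=> ->; rewrite expr1n.
    move=> v1; apply/eqP.
    by rewrite -(eqrXn2 (isT : (0 < 2)%N)) ?enorm_ge0 // v1 expr1n.
  by apply: closed_comp => [v _|]; [exact: continuous_quadf|exact: closed_eq].
have [w wS wmin] := @EVT_min_rV R n (fun v => quadf A (v - 0)) S S0 Scomp
   (continuous_subspaceT (@continuous_quadf n A 0)).
pose m := quadf A w.
have w1 : enorm w = 1 by exact: set_mem wS.
have mP v : m * enorm v ^+ 2 <= quadf A v.
  have [->|v0] := eqVneq v 0.
    by rewrite enorm0 quadfE mul0mx dot0v expr0n mulr0.
  have e0 : 0 < enorm v.
    rewrite lt_def enorm_ge0 andbT; apply: contraNneq v0 => ve.
    by rewrite (enorm_eq0 ve).
  have := wmin _ (mem_set (normalize v v0)).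
  rewrite !subr0 quadfZ -/m exprVn mulrC => H.
  by rewrite -ler_pdivlMr ?exprn_gt0.
have wA : w *m A = m *: w.
  apply/eqP; rewrite -subr_eq0; apply/eqP/enorm_eq0/eqP.
  rewrite -sqrf_eq0 eq_le sqr_ge0 andbT.
  pose h := - (w *m A - m *: w).
  suff : 0 <= 2 * dotv (w *m A - m *: w) h.
    by rewrite /h dotvNr -sqr_enorm; lra.
  apply: (@slope_ge0 _ (quadf A h - m * enorm h ^+ 2)) => s _.
  have := mP (w + s *: h).
  rewrite quadfD // quadfZ sqr_enormD w1 -/m !dotvZr enormZ exprMn.
  by rewrite real_normK ?num_real // dotvBl dotvZl; lra.
have : rho <= m.
  apply: Aev; apply/eigenvalueP; exists w => //.
  by apply/eqP => w0; move: w1; rewrite w0 enorm0; lra.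
by move=> rm; apply: le_trans (mP u); rewrite ler_wpM2r ?sqr_ge0.
Qed.

End ConvexAnalysis.

(** * Expectations *)

(** Monotonicity of the integral of nonnegative functions, without any
    measurability: the integral is a supremum over the simple functions below
    the integrand. *)
Lemma le_integral_pointwise d (T : measurableType d) (R : realType)
    (mu : {measure set T -> \bar R}) (f g : T -> \bar R) :
  (forall x, 0 <= f x)%E -> (forall x, f x <= g x)%E ->
  (\int[mu]_x f x <= \int[mu]_x g x)%E.
Proof.
move=> f0 fg; have g0 x : (0 <= g x)%E := le_trans (f0 x) (fg x).
rewrite !ge0_integralTE //; apply/ge_ereal_sup => _ [h /= hf <-].
apply: ereal_sup_ubound; exists h => //= x; exact: le_trans (fg x).
Qed.

Section Expectation.
Context {R : realType} {d : measure_display} {T : measurableType d}.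
Variable P : probability T R.
Implicit Types (g h : T -> R).

Definition summable_fun g := P.-integrable setT (fun x => (g x)%:E).

Definition expect g : R := \int[P]_x g x.

Lemma summable_measurable g : summable_fun g -> measurable_fun setT g.
Proof. by move/measurable_int/measurable_EFinP. Qed.

Lemma summable_cst (c : R) : summable_fun (fun=> c).
Proof. exact: finite_measure_integrable_cst. Qed.

Lemma summableD g h :
  summable_fun g -> summable_fun h -> summable_fun (fun x => g x + h x).
Proof.
move=> gi hi; apply: (eq_integrable _ (fun x => (g x)%:E + (h x)%:E)%E) => //.
exact: integrableD.
Qed.

Lemma summableZ (c : R) g : summable_fun g -> summable_fun (fun x => c * g x).
Proof.
move=> gi; apply: (eq_integrable _ (fun x => c%:E * (g x)%:E)%E) => //.
exact: integrableZl.
Qed.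

Lemma summableB g h :
  summable_fun g -> summable_fun h -> summable_fun (fun x => g x - h x).
Proof.
move=> gi hi; under [X in summable_fun X]eq_fun do rewrite -mulN1r.
exact/summableD/summableZ.
Qed.

Lemma summable_sum (I : Type) (r : seq I) (Q : pred I) (F : I -> T -> R) :
  (forall i, Q i -> summable_fun (F i)) ->
  summable_fun (fun x => \sum_(i <- r | Q i) F i x).
Proof.
move=> Fi; apply: (eq_integrable _ (fun x => \sum_(i <- r | Q i) (F i x)%:E)%E) => //.
  by move=> x _; rewrite sumEFin.
exact: integrable_sum.
Qed.

Lemma summable_le h g : measurable_fun setT g -> summable_fun h ->
  (forall x, `|g x| <= h x) -> summable_fun g.
Proof.
move=> mg hi gh; apply: (le_integrable _ _ _ hi) => //; first exact/measurable_EFinP.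
by move=> x _ /=; rewrite lee_fin (le_trans (gh x)) // ler_norm.
Qed.

Lemma summable_ge0 g (c : R) : measurable_fun setT g -> (forall x, 0 <= g x) ->
  (\int[P]_x (g x)%:E <= c%:E)%E -> summable_fun g.
Proof.
move=> mg g0 gc; apply/integrableP; split; first exact/measurable_EFinP.
apply: (@le_lt_trans _ _ c%:E); last exact: ltry.
apply: le_trans gc.
apply: le_integral_pointwise => x; first exact: abse_ge0.
by rewrite /= ger0_norm.
Qed.

Lemma summable_prod g h : measurable_fun setT g -> measurable_fun setT h ->
  summable_fun (fun x => g x ^+ 2) -> summable_fun (fun x => h x ^+ 2) ->
  summable_fun (fun x => g x * h x).
Proof.
move=> mg mh gi hi; apply: (summable_le (h := fun x => g x ^+ 2 + h x ^+ 2)).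
- exact: measurable_funM.
- exact: summableD.
- move=> x; rewrite normrM -(real_normK (num_real (g x))).
  rewrite -(real_normK (num_real (h x))).
  have := sqr_ge0 (`|g x| - `|h x|); nra.
Qed.

Lemma expectE g : summable_fun g -> (\int[P]_x (g x)%:E = (expect g)%:E)%E.
Proof. by move=> gi; rewrite fineK //; exact: integrable_fin_num. Qed.

Lemma expect_cst (c : R) : expect (fun=> c) = c.
Proof.
by rewrite /expect Rintegral_cst //= probability_setT mulr1.
Qed.

Lemma expectD g h : summable_fun g -> summable_fun h ->
  expect (fun x => g x + h x) = expect g + expect h.
Proof. by move=> gi hi; rewrite /expect RintegralD. Qed.

Lemma expectZ (c : R) g : summable_fun g ->
  expect (fun x => c * g x) = c * expect g.
Proof. by move=> gi; rewrite /expect RintegralZl. Qed.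

Lemma expectB g h : summable_fun g -> summable_fun h ->
  expect (fun x => g x - h x) = expect g - expect h.
Proof. by move=> gi hi; rewrite /expect RintegralB. Qed.

Lemma eq_expect g h : g =1 h -> expect g = expect h.
Proof. by move=> gh; apply: eq_Rintegral => x _. Qed.

Lemma expect_sum (I : Type) (r : seq I) (F : I -> T -> R) :
  (forall i, summable_fun (F i)) ->
  expect (fun x => \sum_(i <- r) F i x) = \sum_(i <- r) expect (F i).
Proof.
move=> Fi; elim: r => [|i r IH].
  rewrite big_nil -[RHS](expect_cst 0).
  by apply: eq_expect => x; rewrite big_nil.
rewrite big_cons -IH -expectD //; last exact: summable_sum.
by apply: eq_expect => x; rewrite big_cons.
Qed.

Lemma expect_le g h : summable_fun g -> summable_fun h ->
  (forall x, g x <= h x) -> expect g <= expect h.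
Proof. by move=> gi hi gh; apply: le_Rintegral. Qed.

Lemma expect_ge0 g : (forall x, 0 <= g x) -> 0 <= expect g.
Proof. by move=> g0; apply: Rintegral_ge0. Qed.

Lemma eq_summable g h : g =1 h -> summable_fun g -> summable_fun h.
Proof. by move=> /funext ->. Qed.

(** Testing against [a - b] itself turns the norm of a difference of means into
    the mean of an inner product. *)
Lemma enorm_expect_le n (s s' : T -> 'rV[R]_n) (a b : 'rV[R]_n) (K : R) :
  (forall i, summable_fun (fun x => s x 0 i) /\
             (\int[P]_x (s x 0 i)%:E = (a 0 i)%:E)%E) ->
  (forall i, summable_fun (fun x => s' x 0 i) /\
             (\int[P]_x (s' x 0 i)%:E = (b 0 i)%:E)%E) ->
  (forall x, enorm (s x - s' x) <= K) -> enorm (a - b) <= K.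
Proof.
move=> sa sb sK; set u := a - b.
have [u0|u0] := eqVneq (enorm u) 0.
  rewrite u0 -(expect_cst 0) -(expect_cst K); apply: expect_le.
  - exact: summable_cst.
  - exact: summable_cst.
  - by move=> x; apply: le_trans (enorm_ge0 _) (sK x).
have up : 0 < enorm u by rewrite lt_def u0 enorm_ge0.
have ai i : a 0 i = expect (fun x => s x 0 i) by rewrite /expect /Rintegral (sa i).2.
have bi i : b 0 i = expect (fun x => s' x 0 i) by rewrite /expect /Rintegral (sb i).2.
have Si i : summable_fun (fun x => u 0 i * (s x 0 i - s' x 0 i)).
  by apply: summableZ; apply: summableB; [exact: (sa i).1|exact: (sb i).1].
rewrite -(ler_pM2l up) -expr2 sqr_enorm dotvE.
have -> : \sum_i u 0 i * u 0 i =
    expect (fun x => \sum_i u 0 i * (s x 0 i - s' x 0 i)).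
  rewrite expect_sum //; apply: eq_bigr => i _.
  rewrite expectZ; last by apply: summableB; [exact: (sa i).1|exact: (sb i).1].
  rewrite expectB ?ai ?bi; [|exact: (sa i).1|exact: (sb i).1].
  by rewrite -ai -bi /u !mxE.
rewrite -(expect_cst (enorm u * K)); apply: expect_le.
- exact: summable_sum.
- exact: summable_cst.
- move=> x; have -> : \sum_i u 0 i * (s x 0 i - s' x 0 i) = dotv u (s x - s' x).
    by rewrite dotvE; apply: eq_bigr => i _; rewrite !mxE.
  by rewrite (le_trans (dotv_le _ _)) // ler_wpM2l // ltW.
Qed.

End Expectation.

(** * Measurability of compositions with random vectors *)

Section CellApproximation.
Context {R : realType} {d1 d2 : measure_display}.
Context {T1 : measurableType d1} {T2 : measurableType d2}.

(** Freezing the first argument at a representative of its cell gives functions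
    that are measurable, being countable gluings of sections, and that converge
    uniformly when the partitions are refined. *)
Lemma measurable_fun_cells (C : countType) (c : nat -> T1 -> C)
    (psi : T1 * T2 -> R) (K : R) :
  (forall N k, measurable (c N @^-1` [set k])) ->
  (forall w, measurable_fun setT (fun z => psi (w, z))) ->
  (forall N w w' z, c N w = c N w' ->
     `|psi (w, z) - psi (w', z)| <= K * N.+1%:R^-1) ->
  measurable_fun setT psi.
Proof.
move=> mc mpsi cpsi.
pose r N w := xget w [set w' | c N w' = c N w].
have rP N w : c N (r N w) = c N w.
  by rewrite /r; case: xgetP => // /(_ w).
have r_eq N w w' : c N w = c N w' -> r N w = r N w'.
  move=> cw; rewrite /r cw /xget; case: pselect => // -[].
  by exists w'; apply/asboolP.
apply: (@measurable_fun_cvg _ _ _ _ (fun N p => psi (r N p.1, p.2))).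
  move=> N _ B mB; rewrite setTI.
  have -> : (fun p : T1 * T2 => psi (r N p.1, p.2)) @^-1` B =
      \bigcup_k [set p | c N p.1 = k /\ B (psi (r N p.1, p.2))].
    apply/seteqP; split => [p Bp|p [k _ []]//].
    by exists (c N p.1).
  apply: countable_bigcupT_measurable => [|k]; first exact: countableP.
  have [[w wk]|nk] := pselect (exists w, c N w = k); last first.
    rewrite (_ : mkset _ = set0); first exact: measurable0.
    by apply/seteqP; split => // p [pk _]; apply: nk; exists p.1.
  have -> : [set p | c N p.1 = k /\ B (psi (r N p.1, p.2))] =
      (c N @^-1` [set k]) `*` ((fun z => psi (r N w, z)) @^-1` B).
    apply/seteqP; split => p /= [pk Bp]; split => //=.
      by rewrite (r_eq N w p.1) // pk.
    by rewrite (r_eq N p.1 w) // pk.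
  by apply: measurableX => //; rewrite -[X in measurable X]setTI; exact: mpsi.
move=> p _; apply/cvgrPdist_le => e e0.
have K0 : 0 <= `|K| by [].
near=> N.
rewrite distrC; case: p => w z; apply: (le_trans (cpsi N _ _ _ (rP N w))).
rewrite ler_pdivrMr // (le_trans (ler_norm K)) //.
rewrite -ler_pdivrMl // (@le_trans _ _ N%:R) ?ler_nat // mulrC.
near: N; exact: nbhs_infty_ger.
Unshelve. all: by end_near. Qed.

End CellApproximation.

Section RandomVectors.
Context {R : realType} {d1 : measure_display} {T1 : measurableType d1}.

Definition measurable_vec n (Z : T1 -> 'rV[R]_n) :=
  forall i, measurable_fun setT (fun w => Z w 0 i).

Definition grid_cell n (Z : T1 -> 'rV[R]_n) (N : nat) (w : T1) : 'rV[int]_n :=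
  map_mx (fun t => Num.floor (t * N.+1%:R)) (Z w).

Lemma measurable_grid_cell n (Z : T1 -> 'rV[R]_n) N k : measurable_vec Z ->
  measurable (grid_cell Z N @^-1` [set k]).
Proof.
move=> mZ; have -> : grid_cell Z N @^-1` [set k] = \bigcap_(i in [set: 'I_n])
    ((fun w => Z w 0 i * N.+1%:R) @^-1` `[(k 0 i)%:~R, (k 0 i + 1)%:~R[).
  apply/seteqP; split => [w /= wk i _|w /= wk].
    by rewrite /= in_itv /= -floor_eq -wk mxE.
  apply/rowP => i; rewrite mxE; apply/eqP.
  by rewrite floor_eq; have := wk i I; rewrite /= in_itv.
apply: fin_bigcap_measurable => // i _.
rewrite -[X in measurable X]setTI.
have : measurable_fun setT (fun w => Z w 0 i * N.+1%:R).
  by apply: measurable_funM => //; exact: mZ.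
by apply => //; exact: measurable_itv.
Qed.

Lemma grid_cell_close n (Z : T1 -> 'rV[R]_n) N w w' :
  grid_cell Z N w = grid_cell Z N w' ->
  enorm (Z w - Z w') <= n.+1%:R * N.+1%:R^-1.
Proof.
move=> ww; apply: (le_trans (enorm_le_mx_norm _)); rewrite ler_wpM2l //.
rewrite [leLHS]/Num.Def.normr /= mx_normrE; apply: bigmax_le => // -[i j] _ /=.
rewrite ord1 !mxE -[leRHS]mul1r ler_pdivlMr //.
rewrite -[X in _ * X]ger0_norm // -normrM ler_norml mulrBl.
have := congr1 (fun M : 'rV[int]_n => M 0 j) ww; rewrite !mxE => fl.
have := floor_itv (Z w 0 j * N.+1%:R); have := floor_itv (Z w' 0 j * N.+1%:R).
rewrite fl !intrD => /andP[a1 a2] /andP[a3 a4]; lra.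
Qed.

Section Caratheodory.
Context {d2 : measure_display} {T2 : measurableType d2} {n1 n2 : nat}.
Variables (Z1 : T1 -> 'rV[R]_n1) (Z2 : T1 -> 'rV[R]_n2).
Variables (S1 : set 'rV[R]_n1) (S2 : set 'rV[R]_n2) (K : R).
Hypotheses (mZ1 : measurable_vec Z1) (mZ2 : measurable_vec Z2).
Hypotheses (Z1S : forall w, S1 (Z1 w)) (Z2S : forall w, S2 (Z2 w)).

(** The cells are the level sets of the coordinates of [Z1] and [Z2] rounded down
    to multiples of [1 / (N + 1)].  Each cell is represented by a value of [Z1] and
    [Z2], which is why a Lipschitz bound on [S1] and [S2] suffices. *)
Lemma measurable_caratheodory (phi : T2 -> 'rV[R]_n1 -> 'rV[R]_n2 -> R) :
  (forall a b, S1 a -> S2 b -> measurable_fun setT (fun z => phi z a b)) ->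
  (forall z a a' b b', S1 a -> S1 a' -> S2 b -> S2 b' ->
     `|phi z a b - phi z a' b'| <= K * (enorm (a - a') + enorm (b - b'))) ->
  measurable_fun setT (fun p : T1 * T2 => phi p.2 (Z1 p.1) (Z2 p.1)).
Proof.
move=> mphi Lphi.
apply: (@measurable_fun_cells _ _ _ _ _ _
  (fun N w => (grid_cell Z1 N w, grid_cell Z2 N w)) _
  (`|K| * (n1.+1%:R + n2.+1%:R))).
- move=> N [k1 k2].
  have -> : (fun w => (grid_cell Z1 N w, grid_cell Z2 N w)) @^-1` [set (k1, k2)] =
      grid_cell Z1 N @^-1` [set k1] `&` grid_cell Z2 N @^-1` [set k2].
    by apply/seteqP; split => w /= [-> ->].
  by apply: measurableI; exact: measurable_grid_cell.
- by move=> w; exact: (mphi _ _ (Z1S w) (Z2S w)).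
- move=> N w w' z [/grid_cell_close c1 /grid_cell_close c2].
  apply: (le_trans (Lphi _ _ _ _ _ _ _ _ _)) => //.
  apply: (@le_trans _ _ (`|K| * (enorm (Z1 w - Z1 w') + enorm (Z2 w - Z2 w')))).
    by rewrite ler_wpM2r ?ler_norm // addr_ge0 ?enorm_ge0.
  by rewrite -mulrA ler_wpM2l // mulrDl lerD.
Qed.

End Caratheodory.

Lemma measurable_lipschitz n1 n2 (Z1 : T1 -> 'rV[R]_n1) (Z2 : T1 -> 'rV[R]_n2)
    (S1 : set 'rV[R]_n1) (S2 : set 'rV[R]_n2) (K : R)
    (phi : 'rV[R]_n1 -> 'rV[R]_n2 -> R) :
  measurable_vec Z1 -> measurable_vec Z2 ->
  (forall w, S1 (Z1 w)) -> (forall w, S2 (Z2 w)) ->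
  (forall a a' b b', S1 a -> S1 a' -> S2 b -> S2 b' ->
     `|phi a b - phi a' b'| <= K * (enorm (a - a') + enorm (b - b'))) ->
  measurable_fun setT (fun w => phi (Z1 w) (Z2 w)).
Proof.
move=> mZ1 mZ2 Z1S Z2S Lphi.
have m2 := @measurable_caratheodory _ T1 _ _ _ _ S1 S2 K mZ1 mZ2 Z1S Z2S
  (fun=> phi) (fun _ _ _ _ => measurable_cst _) (fun=> Lphi).
apply: (measurableT_comp m2 (_ : measurable_fun setT (fun w : T1 => (w, w)))).
exact: measurable_fun_pair.
Qed.

Lemma measurable_enorm2 n (Z : T1 -> 'rV[R]_n) :
  measurable_vec Z -> measurable_fun setT (fun w => enorm (Z w) ^+ 2).
Proof.
move=> mZ; under eq_fun do rewrite sqr_enormE.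
by apply: measurable_sum => i; apply: measurable_funX; exact: mZ.
Qed.

Lemma measurable_vecD n (Z Z' : T1 -> 'rV[R]_n) :
  measurable_vec Z -> measurable_vec Z' -> measurable_vec (fun w => Z w + Z' w).
Proof.
move=> mZ mZ' i; under eq_fun do rewrite mxE.
by apply: measurable_funD; [exact: mZ|exact: mZ'].
Qed.

Lemma measurable_vecZ n (c : R) (Z : T1 -> 'rV[R]_n) :
  measurable_vec Z -> measurable_vec (fun w => c *: Z w).
Proof.
move=> mZ i; under eq_fun do rewrite mxE.
by apply: measurable_funM => //; exact: mZ.
Qed.

Lemma measurable_vecB n (Z Z' : T1 -> 'rV[R]_n) :
  measurable_vec Z -> measurable_vec Z' -> measurable_vec (fun w => Z w - Z' w).
Proof.
move=> mZ mZ'; apply: measurable_vecD => //.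
by under eq_fun do rewrite -scaleN1r; exact: measurable_vecZ.
Qed.

End RandomVectors.

(** * Independence from a sigma-algebra *)

Definition mfun_of d d' (T : measurableType d) (T' : measurableType d')
    (f : T -> T') (mf : measurable_fun setT f) : {mfun T >-> T'} :=
  HB.pack f (isMeasurableFun.Build _ _ _ _ f mf).

Section Independence.
Context {R : realType} {dOm dXi : measure_display}.
Context {Om : measurableType dOm} {Xi : measurableType dXi}.
Variables (P : probability Om R) (D : probability Xi R).

Definition fresh_sample (G : set (set Om)) (xi : Om -> Xi) :=
  measurable_fun setT xi /\
  forall E S, G E -> measurable S -> P (E `&` xi @^-1` S) = (P E * D S)%E.

Section SubSigmaAlgebra.
Variable G : set (set Om).
Hypotheses (sG : sigma_algebra setT G) (Gm : G `<=` measurable).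

Local Notation OmG := (g_sigma_algebraType G).

(** The identity, with the coarser sigma-algebra on its codomain: a random
    variable measurable for [G] is a measurable function on [OmG]. *)
Definition forget (o : Om) : OmG := o.

Lemma measurable_forget : measurable_fun setT forget.
Proof.
move=> _ B; rewrite setTI /= => mB; apply: Gm.
by rewrite -(sigma_algebra_id sG).
Qed.

Lemma measurable_sub d (T : measurableType d) (Z : OmG -> T) :
  measurable_fun setT Z -> measurable_fun setT (Z : Om -> T).
Proof. by move=> mZ; exact: measurableT_comp mZ measurable_forget. Qed.

Lemma measurable_wrt_sub d (T : measurableType d) (Z : Om -> T) :
  measurable_wrt G Z -> measurable_fun setT (Z : OmG -> T).
Proof.
by move=> mZ _ B mB; rewrite setTI; apply: sub_sigma_algebra; exact: mZ.
Qed.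

Lemma measurable_subP d (T : measurableType d) (Z : OmG -> T) B :
  measurable_fun setT Z -> measurable B -> G (Z @^-1` B).
Proof.
move=> mZ mB; rewrite -(sigma_algebra_id sG).
by have := mZ measurableT B mB; rewrite setTI.
Qed.

Let PG : probability OmG R := distribution P (mfun_of measurable_forget).

Section OneSample.
Variable xi : Om -> Xi.
Hypothesis fx : fresh_sample G xi.

Lemma measurable_graph :
  measurable_fun setT (fun o => (forget o, xi o) : OmG * Xi).
Proof. by apply: measurable_fun_pair; [exact: measurable_forget|exact: fx.1]. Qed.

Let law : probability (OmG * Xi)%type R := distribution P (mfun_of measurable_graph).

(** Independence says that the joint law of the past and of the sample is a
    product; the two measures agree on rectangles. *)
Lemma law_graph (A : set (OmG * Xi)) : measurable A -> (PG \x D)%E A = law A.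
Proof.
apply: product_measure_unique => E S mE mS.
rewrite /law /PG /distribution /pushforward /=.
by rewrite -(fx.2 E S) // -(sigma_algebra_id sG).
Qed.

(** Averaging over a fresh sample can be done first, the past being frozen. *)
Lemma integral_fresh (h : OmG * Xi -> R) :
  measurable_fun setT h -> (forall p, 0 <= h p) ->
  (\int[P]_o (h (o, xi o))%:E = \int[P]_o \int[D]_z (h (o, z))%:E)%E.
Proof.
move=> mh h0; have mE : measurable_fun setT (EFin \o h) by exact/measurable_EFinP.
have h0E p : (0 <= (EFin \o h) p)%E by rewrite lee_fin.
have := @ge0_integral_distribution _ _ _ _ _ P (mfun_of measurable_graph) _ mE h0E.
rewrite -(eq_measure_integral law (fun A mA _ => law_graph mA)).
rewrite fubini_tonelli1 // => <-.
rewrite ge0_integral_distribution //.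
  exact: measurable_fun_fubini_tonelli_F.
by move=> o; apply: integral_ge0.
Qed.

Lemma expect_fresh0 (h : OmG * Xi -> R) :
  measurable_fun setT h -> summable_fun P (fun o => h (o, xi o)) ->
  (forall o, \int[D]_z (h (o, z))%:E = 0)%E ->
  expect P (fun o => h (o, xi o)) = 0.
Proof.
move=> mh hi h0; have mE : measurable_fun setT (EFin \o h) by exact/measurable_EFinP.
have hprod : (PG \x D)%E.-integrable setT (EFin \o h).
  apply/integrableP; split => //.
  rewrite (eq_measure_integral law (fun A mA _ => law_graph mA)).
  rewrite ge0_integral_distribution //; last exact: measurableT_comp.
  by case/integrableP : hi.
have := @integral_distribution _ _ _ _ _ P (mfun_of measurable_graph) _ mE hi.
rewrite -(eq_measure_integral law (fun A mA _ => law_graph mA)).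
rewrite -integral12_prod_meas1 // /fubini_F /=.
under eq_integral do rewrite h0.
by rewrite integral0 /expect /Rintegral => <-.
Qed.

(** Sigma-algebra of the events determined by [G] and [xi]. *)
Definition enlarged : set (set Om) :=
  [set (fun o => (forget o, xi o)) @^-1` A | A in @measurable _ (OmG * Xi)%type].

Lemma enlarged_sigma_algebra : sigma_algebra setT enlarged.
Proof.
split.
- by exists set0; rewrite ?preimage_set0.
- by move=> _ [A mA <-]; exists (~` A); [exact: measurableC|rewrite preimage_setC setTD].
- move=> F FA; pose A n := xget set0 [set B | measurable B /\
    (fun o => (forget o, xi o)) @^-1` B = F n].
  have AP n : measurable (A n) /\ (fun o => (forget o, xi o)) @^-1` A n = F n.
    by have [B mB BF] := FA n; rewrite /A; case: xgetP => [//|/(_ B)[]].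
  exists (\bigcup_n A n); first by apply: bigcupT_measurable => n; exact: (AP n).1.
  by rewrite preimage_bigcup; apply: eq_bigcupr => n _; exact: (AP n).2.
Qed.

Lemma enlarged_measurable : enlarged `<=` measurable.
Proof.
move=> _ [A mA <-]; rewrite -[X in measurable X]setTI; exact: measurable_graph.
Qed.

Lemma sub_enlarged : G `<=` enlarged.
Proof.
move=> E GE; exists (E `*` setT); last by apply/seteqP; split => o //= [].
by apply: measurableX => //; exact: sub_sigma_algebra.
Qed.

Lemma measurable_enlarged d (T : measurableType d) (h : OmG * Xi -> T) :
  measurable_fun setT h -> measurable_fun setT
    ((fun o => h (forget o, xi o)) : g_sigma_algebraType enlarged -> T).
Proof.
move=> mh _ B mB; rewrite setTI; apply: sub_sigma_algebra.
by exists (h @^-1` B) => //; rewrite -[X in measurable X]setTI; exact: mh.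
Qed.

End OneSample.

(** Two samples that are jointly fresh: the second one is fresh for the
    sigma-algebra enlarged by the first one. *)
Lemma fresh_enlarged (xi xi' : Om -> Xi) : fresh_sample G xi ->
  measurable_fun setT xi' ->
  (forall E S S', G E -> measurable S -> measurable S' ->
     P (E `&` xi @^-1` S `&` xi' @^-1` S') = (P E * D S * D S')%E) ->
  fresh_sample (enlarged xi) xi'.
Proof.
move=> fx mx' ind; split => // _ S' [A mA <-] mS'.
have mxS : measurable (xi' @^-1` S').
  by rewrite -[X in measurable X]setTI; exact: mx'.
have c0 : 0 <= fine (D S') by rewrite fine_ge0.
pose m1 : {measure set (OmG * Xi) -> \bar R} :=
  pushforward (mrestr P mxS) (mfun_of (measurable_graph fx)).
pose m2 : {measure set (OmG * Xi) -> \bar R} :=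
  mscale (NngNum c0) (distribution P (mfun_of (measurable_graph fx))).
have mg : measurable_fun setT (mfun_of (measurable_graph fx)).
  exact: measurable_graph.
suff : m1 mg A = m2 A.
  move=> m12; transitivity (m1 mg A) => //; rewrite m12.
  transitivity ((fine (D S'))%:E * P ((fun o => (forget o, xi o)) @^-1` A))%E => //.
  by rewrite fineK ?fin_num_measure // muleC.
apply: (@measure_unique _ _ _ [set A `*` B | A in measurable & B in measurable]
   (fun=> setT)) => //.
- exact: measurable_prod_measurableType.
- move=> _ _ [E1 mE1 [S1 mS1 <-]] [E2 mE2 [S2 mS2 <-]].
  exists (E1 `&` E2); first exact: measurableI.
  by exists (S1 `&` S2); [exact: measurableI|rewrite setXI].
- by move=> _; exists setT => //; exists setT => //; rewrite setXTT.
- by rewrite bigcup_const.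
- move=> _ [E mE [S mS <-]].
  have GE : G E by rewrite -(sigma_algebra_id sG).
  transitivity (P (E `&` xi @^-1` S `&` xi' @^-1` S')); first by [].
  transitivity ((fine (D S'))%:E * P (E `&` xi @^-1` S))%E => //.
  by rewrite fineK ?fin_num_measure // muleC fx.2 // ind.
- move=> _; rewrite /m1 /mrestr /pushforward /=.
  apply: (@le_lt_trans _ _ 1%E); last exact: ltry.
  by apply: probability_le1; rewrite setTI.
Qed.

End SubSigmaAlgebra.
End Independence.

(** * Variance of a mini-batch *)

Section FreshBatch.
Context {R : realType} {dOm dXi : measure_display}.
Context {Om : measurableType dOm} {Xi : measurableType dXi}.
Variables (P : probability Om R) (D : probability Xi R).

Lemma measurable_coord_sqr d (T : measurableType d) n (Z : T -> 'rV[R]_n) a :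
  measurable_vec Z -> measurable_fun setT (fun o => Z o 0 a ^+ 2).
Proof. by move=> mZ; apply: measurable_funX; exact: mZ. Qed.

Lemma summable_coord n (Z : Om -> 'rV[R]_n) a : measurable_vec Z ->
  summable_fun P (fun o => enorm (Z o) ^+ 2) ->
  summable_fun P (fun o => Z o 0 a ^+ 2).
Proof.
move=> mZ Zi; apply: (summable_le _ Zi); first exact: measurable_coord_sqr.
move=> o; rewrite ger0_norm ?sqr_ge0 // -real_normK ?num_real //.
by rewrite ler_pXn2r ?nnegrE ?enorm_ge0 // enorm_coord_le.
Qed.

Lemma summable_dotv n (Z Z' : Om -> 'rV[R]_n) :
  measurable_vec Z -> measurable_vec Z' ->
  summable_fun P (fun o => enorm (Z o) ^+ 2) ->
  summable_fun P (fun o => enorm (Z' o) ^+ 2) ->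
  summable_fun P (fun o => dotv (Z o) (Z' o)).
Proof.
move=> mZ mZ' Zi Zi'; apply: (eq_summable (g := fun o => \sum_a Z o 0 a * Z' o 0 a)).
  by move=> o; rewrite dotvE.
apply: summable_sum => a _.
by apply: summable_prod; [exact: mZ|exact: mZ'|exact: summable_coord|exact: summable_coord].
Qed.

Section Orthogonality.
Variable G : set (set Om).
Hypotheses (sG : sigma_algebra setT G) (Gm : G `<=` measurable).
Local Notation OmG := (g_sigma_algebraType G).

Lemma measurable_vec_sub n (Z : OmG -> 'rV[R]_n) :
  measurable_vec Z -> measurable_vec (Z : Om -> 'rV[R]_n).
Proof. by move=> mZ a; apply: (measurable_sub sG Gm); exact: mZ. Qed.

(** Averaging over the sample first annihilates the inner product. *)
Lemma fresh_orthogonal (xi : Om -> Xi) n (V : OmG -> 'rV[R]_n)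
    (h : OmG -> Xi -> 'rV[R]_n) : fresh_sample P D G xi ->
  measurable_vec V -> measurable_vec (fun p : OmG * Xi => h p.1 p.2) ->
  (forall o a, summable_fun D (fun z => h o z 0 a) /\
               (\int[D]_z (h o z 0 a)%:E = 0)%E) ->
  summable_fun P (fun o => enorm (V o) ^+ 2) ->
  summable_fun P (fun o => enorm (h o (xi o)) ^+ 2) ->
  expect P (fun o => dotv (V o) (h o (xi o))) = 0.
Proof.
move=> fx mV mh h0 Vi hi.
have mhx : measurable_vec (fun o : Om => h o (xi o)).
  by move=> a; apply: (measurableT_comp (mh a) (measurable_graph sG Gm fx)).
have Vhi a : summable_fun P (fun o => V o 0 a * h o (xi o) 0 a).
  apply: summable_prod; [exact: measurable_vec_sub|exact: mhx| |].
    exact: summable_coord (measurable_vec_sub mV) Vi.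
  exact: summable_coord mhx hi.
rewrite (eq_expect P (h := fun o => \sum_a V o 0 a * h o (xi o) 0 a)); last first.
  by move=> o; rewrite dotvE.
rewrite expect_sum // big1 // => a _.
apply: (@expect_fresh0 _ _ _ _ _ P D G sG Gm xi fx
  (fun p => V p.1 0 a * h p.1 p.2 0 a)) => //.
  by apply: measurable_funM; [exact: measurableT_comp (mV a) measurable_fst|exact: mh].
move=> o /=; under eq_integral do rewrite EFinM.
rewrite integralZl //; last exact: (h0 o a).1.
by rewrite (h0 o a).2 mule0.
Qed.

End Orthogonality.

Variables (q : nat) (xi : 'I_q -> Om -> Xi) (G : set (set Om)).
Hypotheses (sG : sigma_algebra setT G) (Gm : G `<=` measurable).
Hypothesis mxi : forall i, measurable_fun setT (xi i).
Hypothesis batch_rule : forall E (S : 'I_q -> set Xi), G E ->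
  (forall i, measurable (S i)) ->
  (P (E `&` \bigcap_(i in [set: 'I_q]) (xi i @^-1` S i))
     = P E * \prod_(i < q) D (S i))%E.
Local Notation OmG := (g_sigma_algebraType G).

Lemma batch_fresh i : fresh_sample P D G (xi i).
Proof.
split => // E S GE mS; pose S' j := if j == i then S else setT.
have -> : E `&` xi i @^-1` S =
    E `&` \bigcap_(j in [set: 'I_q]) (xi j @^-1` S' j).
  apply/seteqP; split => o [Eo So]; split => //.
    by move=> j _; rewrite /S' /=; case: eqP => // ->.
  by have := So i I; rewrite /S' /= eqxx.
rewrite batch_rule //; last by move=> j; rewrite /S'; case: ifP.
rewrite (bigD1 i) //= /S' eqxx big1 ?mule1 // => j /negbTE ->.
exact: probability_setT.
Qed.

(** Makes the noise of sample [i] part of the past of sample [j]. *)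
Lemma batch_fresh_enlarged i j : i != j ->
  fresh_sample P D (enlarged G (xi i)) (xi j).
Proof.
move=> ij; apply: fresh_enlarged => //; first exact: batch_fresh.
move=> E S T GE mS mT.
pose S' k := if k == i then S else if k == j then T else setT.
have -> : E `&` xi i @^-1` S `&` xi j @^-1` T =
    E `&` \bigcap_(k in [set: 'I_q]) (xi k @^-1` S' k).
  apply/seteqP; split => o.
    move=> [[Eo So] To]; split => // k _; rewrite /S' /=.
    by case: eqP => [->//|_]; case: eqP => // ->.
  move=> [Eo So]; split; last first.
    by have := So j I; rewrite /S' /= eq_sym (negbTE ij) eqxx.
  by split => //; have := So i I; rewrite /S' /= eqxx.
rewrite batch_rule //; last by move=> k; rewrite /S'; case: ifP => // _; case: ifP.
rewrite (bigD1 i) //= (bigD1 j) /=; last by rewrite eq_sym.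
rewrite /S' eqxx eq_sym (negbTE ij) eqxx big1 ?mule1 ?muleA //.
by move=> k /andP[/negbTE -> /negbTE ->]; exact: probability_setT.
Qed.

Variables (n : nat) (W : OmG -> 'rV[R]_n) (h : OmG -> Xi -> 'rV[R]_n) (H : Om -> R).
Hypothesis mW : measurable_vec W.
Hypothesis mh : measurable_vec (fun p : OmG * Xi => h p.1 p.2).
Hypothesis h0 : forall o a, summable_fun D (fun z => h o z 0 a) /\
                            (\int[D]_z (h o z 0 a)%:E = 0)%E.
Hypothesis hH : forall o, (\int[D]_z (enorm (h o z) ^+ 2)%:E <= (H o)%:E)%E.
Hypothesis Hi : summable_fun P H.
Hypothesis Wi : summable_fun P (fun o => enorm (W o) ^+ 2).

Let g i (o : Om) := h o (xi i o).

Lemma batch_measurable i : measurable_vec (g i).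
Proof.
by move=> a; apply: (measurableT_comp (mh a) (measurable_graph sG Gm (batch_fresh i))).
Qed.

Let int_sqr i : (\int[P]_o (enorm (g i o) ^+ 2)%:E <= (expect P H)%:E)%E.
Proof.
rewrite -expectE //.
have := @integral_fresh _ _ _ _ _ P D G sG Gm (xi i) (batch_fresh i)
  (fun p => enorm (h p.1 p.2) ^+ 2).
move=> /(_ (measurable_enorm2 mh) (fun=> sqr_ge0 _)) /= ->.
apply: le_integral_pointwise; last exact: hH.
by move=> o; apply: integral_ge0 => z _; rewrite lee_fin sqr_ge0.
Qed.

Lemma batch_summable i : summable_fun P (fun o => enorm (g i o) ^+ 2).
Proof.
apply: summable_ge0 (int_sqr i) => [|o]; last exact: sqr_ge0.
exact/measurable_enorm2/batch_measurable.
Qed.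

Lemma batch_uncorrelated i j : i != j ->
  expect P (fun o => dotv (g i o) (g j o)) = 0.
Proof.
move=> ij.
apply: (@fresh_orthogonal (enlarged G (xi i)) _ _ (xi j) n (g i) h) => //.
- exact: enlarged_sigma_algebra.
- exact: (enlarged_measurable sG Gm (batch_fresh i)).
- exact: batch_fresh_enlarged.
- by move=> a; exact: (measurable_enlarged (mh a)).
- move=> a.
  apply: (@measurableT_comp _ _ _ _ _ _ (fun p : OmG * Xi => h p.1 p.2 0 a) _
    (fun p : g_sigma_algebraType (enlarged G (xi i)) * Xi => (p.1 : OmG, p.2))).
    exact: mh.
  apply: measurable_fun_pair; last exact: measurable_snd.
  apply: (@measurableT_comp _ _ _ _ _ _
    (idfun : g_sigma_algebraType (enlarged G (xi i)) -> OmG) _ fst);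
    last exact: measurable_fst.
  move=> _ B mB; rewrite setTI.
  apply: sub_sigma_algebra; apply: sub_enlarged.
  by rewrite -(sigma_algebra_id sG).
- exact: batch_summable.
- exact: batch_summable.
Qed.

(** The samples of a mini-batch are conditionally centred and pairwise
    uncorrelated, so that the variance of their mean is divided by [q]. *)
Lemma batch_second_moment : (0 < q)%N ->
  let Z o := W o + q%:R^-1 *: \sum_(i < q) g i o in
  summable_fun P (fun o => enorm (Z o) ^+ 2) /\
  expect P (fun o => enorm (Z o) ^+ 2) <=
    expect P (fun o => enorm (W o) ^+ 2) + q%:R^-1 * expect P H.
Proof.
move=> q0; pose c : R := q%:R^-1; have c0 : 0 <= c by rewrite invr_ge0.
pose A o := 2 * c * \sum_(i < q) dotv (W o) (g i o).
pose B o := c ^+ 2 * \sum_(i < q) \sum_(j < q) dotv (g i o) (g j o).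
have ZE o : enorm (W o + c *: \sum_(i < q) g i o) ^+ 2 = enorm (W o) ^+ 2 + (A o + B o).
  rewrite sqr_enormD dotvZr enormZ exprMn (ger0_norm c0) /A /B addrA -mulrA.
  rewrite dotv_sumr (sqr_enorm (\sum_i _)) dotv_sumr; congr (_ + _ + c ^+ 2 * _).
  by apply: eq_bigr => i _; rewrite dotvC dotv_sumr.
have mWO : measurable_vec (W : Om -> 'rV[R]_n) by exact: measurable_vec_sub.
have Wgi i : summable_fun P (fun o => dotv (W o) (g i o)).
  by apply: summable_dotv => //; [exact: batch_measurable|exact: batch_summable].
have ggi i j : summable_fun P (fun o => dotv (g i o) (g j o)).
  by apply: summable_dotv;
    [exact: batch_measurable|exact: batch_measurable|exact: batch_summable|
     exact: batch_summable].
have ggs i : summable_fun P (fun o => \sum_(j < q) dotv (g i o) (g j o)).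
  exact: summable_sum.
have Ai : summable_fun P A by apply: summableZ; exact: summable_sum.
have Bi : summable_fun P B by apply: summableZ; exact: summable_sum.
have ABi := summableD Ai Bi.
split; first by apply: eq_summable (summableD Wi ABi) => o; rewrite -ZE.
rewrite (eq_expect P ZE) expectD // lerD2l expectD // expectZ; last exact: summable_sum.
rewrite expectZ; last exact: summable_sum.
rewrite expect_sum // big1 ?mulr0 ?add0r; last first.
  move=> i _; apply: (fresh_orthogonal sG Gm (batch_fresh i)) => //.
  exact: batch_summable.
rewrite expect_sum //.
apply: (@le_trans _ _ (c ^+ 2 * \sum_(i < q) expect P H)).
  rewrite ler_wpM2l ?sqr_ge0 //; apply: ler_sum => i _.
  rewrite expect_sum // (bigD1 i) //= big1 ?addr0; last first.
    by move=> j ji; apply: batch_uncorrelated; rewrite eq_sym.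
  rewrite (eq_expect P (h := fun o => enorm (g i o) ^+ 2)); last first.
    by move=> o; rewrite sqr_enorm.
  by rewrite -lee_fin -expectE //; exact: batch_summable.
rewrite sumr_const card_ord -[expect P H *+ q]mulr_natl mulrA expr2 -(mulrA c).
by rewrite mulVf ?mulr1 // pnatr_eq0 -lt0n.
Qed.

End FreshBatch.

(** * Gradients on convex sets *)

Section Gradient.
Context {R : realType} {n : nat}.

Lemma dotv_gradient (g : 'rV[R]_n -> R) x u :
  differentiable g x -> dotv (gradient g x) u = 'd g x u.
Proof.
move=> dg; rewrite dotvE {2}(row_sum_delta u) linear_sum /=.
by apply: eq_bigr => i _; rewrite mxE linearZ /= mulrC.
Qed.

(** The mean value theorem on the segment from [x] to [x'].  It gives the constant
    [K] instead of the optimal [K / 2], and avoids an integral. *)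
Lemma smooth_taylor (S : set 'rV[R]_n) (g : 'rV[R]_n -> R) (K : R) x x' :
  convex_set S -> (forall z, S z -> differentiable g z) ->
  (forall z z', S z -> S z' ->
     enorm (gradient g z - gradient g z') <= K * enorm (z - z')) ->
  S x -> S x' -> 0 <= K ->
  `|g x' - g x - dotv (gradient g x) (x' - x)| <= K * enorm (x' - x) ^+ 2.
Proof.
move=> Sc dg Lg Sx Sx' K0; set u : 'rV[R]_n := x' - x.
pose p (s : R) : 'rV[R]_n := x + s *: u.
have Sp (s : R) : 0 <= s <= 1 -> S (p s) by move=> s01; exact: convex_segment.
have dp (s : R) : is_diff s p (fun t => t *: u).
  have -> : p = cst x + ( *:%R ^~ u) by apply/funext => t; rewrite /p !fctE.
  apply: is_diff_eq (is_diffD (is_diff_cst x s) (is_diff_scalel s u)) _.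
  by apply/funext => t; rewrite !fctE add0r.
have dgp (s : R) : 0 <= s <= 1 -> is_derive s 1 (g \o p) (dotv (gradient g (p s)) u).
  move=> s01; have dgs := dg _ (Sp s s01).
  have dps : differentiable p s by [].
  apply: DeriveDef; first exact/diff_derivable/differentiable_comp.
  rewrite deriveE; last exact: differentiable_comp.
  by rewrite diff_comp // diff_val /= scale1r dotv_gradient.
have [s /=||s] := @MVT_segment R (g \o p)
    (fun s => dotv (gradient g (p s)) u) 0 1 ler01.
- by move=> /andP[/= s0 s1]; apply: dgp; rewrite !ltW.
- apply: derivable_within_continuous => s; rewrite in_itv /= => s01.
  by have [ds _] := dgp s s01.
rewrite in_itv /= => s01; rewrite subr0 mulr1 /p /= scale1r scale0r addr0 subrKC.
move=> ->; rewrite -dotvBl; apply: (le_trans (norm_dotv_le _ _)).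
rewrite expr2 mulrA ler_wpM2r ?enorm_ge0 //.
apply: (le_trans (Lg _ _ (Sp s s01) Sx)); rewrite ler_wpM2l //.
rewrite addrC addKr enormZ ler_piMl ?enorm_ge0 // ger0_norm; by case/andP: s01.
Qed.

Lemma is_gradient_on_taylor (S : set 'rV[R]_n) (g : 'rV[R]_n -> R) (K : R) x u :
  0 <= K -> (forall z, S z -> `|g z - g x - dotv u (z - x)| <= K * enorm (z - x) ^+ 2) ->
  is_gradient_on S g x u.
Proof.
move=> K0 H e e0.
have K1 : 0 < (K + 1) * n.+1%:R by rewrite mulr_gt0 // ltr_wpDl.
apply/nbhs_ballP; exists (e / ((K + 1) * n.+1%:R)); first exact: divr_gt0.
move=> z; rewrite -ball_normE /= => /ltW zx Sz.
apply: (le_trans (H z Sz)); rewrite expr2 mulrA ler_wpM2r ?enorm_ge0 //.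
apply: (@le_trans _ _ ((K + 1) * enorm (z - x))).
  by rewrite ler_wpM2r ?enorm_ge0 // lerDl.
rewrite ler_pdivlMr // in zx; apply: le_trans zx.
have := enorm_le_mx_norm (x - z); rewrite enormC => zz.
have K11 : 0 <= K + 1 by rewrite addr_ge0.
by apply: (le_trans (ler_wpM2l K11 zz)); rewrite mulrA mulrC.
Qed.

(** Two first-order expansions along a convex set agree in all directions that
    point into the set. *)
Lemma is_gradient_on_unique (S : set 'rV[R]_n) (g : 'rV[R]_n -> R) x u u' z :
  convex_set S -> S x -> is_gradient_on S g x u -> is_gradient_on S g x u' ->
  S z -> dotv (u - u') (z - x) = 0.
Proof.
move=> Sc Sx gu gu' Sz; apply/eqP; rewrite -normr_le0; apply/ler_addgt0Pl => e e0.
rewrite addr0; set v := z - x.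
pose c := e / (2 * (enorm v + 1)).
have v1 : 0 < enorm v + 1 by rewrite ltr_wpDl ?enorm_ge0.
have c0 : 0 < c by rewrite divr_gt0 // mulr_gt0.
have /nbhs_ballP[r1 /= r10 br1] : nbhs x [set w | S w ->
  `|g w - g x - dotv u (w - x)| <= c * enorm (w - x)] := gu c c0.
have /nbhs_ballP[r2 /= r20 br2] : nbhs x [set w | S w ->
  `|g w - g x - dotv u' (w - x)| <= c * enorm (w - x)] := gu' c c0.
pose r := Num.min r1 r2; have r0 : 0 < r by rewrite lt_min r10.
pose s := Num.min 1 (r / (2 * (`|v| + 1))).
have vn : 0 < 2 * (`|v| + 1) by rewrite mulr_gt0 // ltr_wpDl.
have s0 : 0 < s by rewrite lt_min ltr01 divr_gt0.
have s01 : 0 <= s <= 1 by rewrite (ltW s0) ge_min lexx.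
have Szs : S (x + s *: v) by exact: convex_segment.
have bz : ball x r (x + s *: v).
  rewrite -ball_normE /= opprD addNKr normrN normrZ (gtr0_norm s0).
  have sr : s <= r / (2 * (`|v| + 1)) by rewrite ge_min lexx orbT.
  rewrite ler_pdivlMr // in sr; have := normr_ge0 v; nra.
have := br1 _ (le_ball (_ : r <= r1) bz); rewrite ge_min lexx => /(_ isT Szs) a1.
have := br2 _ (le_ball (_ : r <= r2) bz); rewrite ge_min lexx orbT => /(_ isT Szs) a2.
move: a1 a2; rewrite (addrC x) addrK !dotvZr enormZ (gtr0_norm s0) => a1 a2.
have : s * `|dotv (u - u') v| <= s * (2 * c * enorm v).
  rewrite -{1}(gtr0_norm s0) -normrM dotvBl.
  set a := _ - s * dotv u v in a1; set b := _ - s * dotv u' v in a2.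
  have -> : s * (dotv u v - dotv u' v) = b - a by rewrite /a /b; ring.
  apply: (le_trans (ler_normB _ _)); lra.
rewrite ler_pM2l // => H; apply: (le_trans H).
have -> : 2 * c * enorm v = e * (enorm v / (enorm v + 1)).
  by rewrite /c; field; rewrite gt_eqF.
by rewrite ler_piMr ?(ltW e0) // ler_pdivrMr // mul1r lerDl.
Qed.

End Gradient.

(** * One step of gradient descent ascent *)

(** What the deterministic analysis uses of the objective [h], of its partial
    gradients [gx] and [gy], of the maximizer [ys] and of the maximum [F]. *)
Record minimax_regular {R : realType} {d1 d2 : nat} (X : set 'rV[R]_d1)
    (Y : set 'rV[R]_d2) (Lf mu : R) (h : 'rV[R]_d1 -> 'rV[R]_d2 -> R)
    (gx : 'rV[R]_d1 -> 'rV[R]_d2 -> 'rV[R]_d1)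
    (gy : 'rV[R]_d1 -> 'rV[R]_d2 -> 'rV[R]_d2)
    (ys : 'rV[R]_d1 -> 'rV[R]_d2) (F : 'rV[R]_d1 -> R) : Prop := {
  mr_Xc : convex_set X;
  mr_Yc : convex_set Y;
  mr_lipxx : forall x x' y, X x -> X x' -> Y y ->
    enorm (gx x y - gx x' y) <= Lf * enorm (x - x');
  mr_lipxy : forall x y y', X x -> Y y -> Y y' ->
    enorm (gx x y - gx x y') <= Lf * enorm (y - y');
  mr_lipyx : forall x x' y, X x -> X x' -> Y y ->
    enorm (gy x y - gy x' y) <= Lf * enorm (x - x');
  mr_lipyy : forall x y y', X x -> Y y -> Y y' ->
    enorm (gy x y - gy x y') <= Lf * enorm (y - y');
  mr_taylorx : forall x x' y, X x -> X x' -> Y y ->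
    `|h x' y - h x y - dotv (gx x y) (x' - x)| <= Lf * enorm (x' - x) ^+ 2;
  mr_concave : forall x y1 y2, X x -> Y y1 -> Y y2 ->
    h x y1 <= h x y2 + dotv (gy x y2) (y1 - y2) - mu / 2 * enorm (y1 - y2) ^+ 2;
  mr_argmax : forall x, X x -> is_argmax Y (h x) (ys x);
  mr_max : forall x, X x -> F x = h x (ys x)
}.

Section MinimaxGeometry.
Context {R : realType} {d1 d2 : nat}.
Variables (X : set 'rV[R]_d1) (Y : set 'rV[R]_d2) (Lf mu : R).
Variables (h : 'rV[R]_d1 -> 'rV[R]_d2 -> R).
Variables (gx : 'rV[R]_d1 -> 'rV[R]_d2 -> 'rV[R]_d1).
Variables (gy : 'rV[R]_d1 -> 'rV[R]_d2 -> 'rV[R]_d2).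
Variables (ys : 'rV[R]_d1 -> 'rV[R]_d2) (F : 'rV[R]_d1 -> R).
Hypotheses (Lf_gt0 : 0 < Lf) (mu_gt0 : 0 < mu).
Hypothesis mr : minimax_regular X Y Lf mu h gx gy ys F.
Local Notation kappa := (Lf / mu).

Lemma ystar_in x : X x -> Y (ys x).
Proof. by move/(mr_argmax mr) => []. Qed.

(** Strong concavity compares [y^*] with the points of a segment that leaves it;
    the gradient at these points is then carried to [y^*] by continuity. *)
Lemma ystar_optimality x y : X x -> Y y -> dotv (gy x (ys x)) (y - ys x) <= 0.
Proof.
move=> Xx Yy; have [Yys ysmax] := mr_argmax mr Xx.
rewrite -oppr_ge0; apply: (@slope_ge0 _ _ (Lf * enorm (y - ys x) ^+ 2)) => s.
set u := y - ys x => /andP[s0 s1].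
have s01 : 0 <= s <= 1 by rewrite (ltW s0).
have Yz := convex_segment (mr_Yc mr) Yys Yy s01; set z := ys x + _ in Yz.
have a1 := ysmax _ Yz; have a2 := mr_concave mr Xx Yys Yz.
have e : ys x - z = (- s) *: u by rewrite /z opprD addNKr scaleNr.
rewrite e dotvZr enormZ normrN in a2.
have a3 : dotv (gy x (ys x) - gy x z) u <= Lf * (s * enorm u ^+ 2).
  apply: (le_trans (dotv_le _ _)).
  rewrite expr2 !mulrA ler_wpM2r ?enorm_ge0 //.
  apply: (le_trans (mr_lipyy mr Xx Yys Yz)).
  by rewrite -mulrA ler_wpM2l ?(ltW Lf_gt0) // enormC /z addrC addKr enormZ (gtr0_norm s0).
rewrite dotvBl in a3.
have a4 : 0 <= mu / 2 * (`|s| * enorm u) ^+ 2.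
  by rewrite mulr_ge0 ?sqr_ge0 // divr_ge0 // ltW.
have a5 : s * dotv (gy x z) u <= 0. lra.
rewrite pmulr_rle0 // in a5.
have := sqr_ge0 (enorm u); nra.
Qed.

(** The maximizers at [x] and [x'] are tested against each other: strong
    concavity bounds the distance of the maximizers by the variation of the
    partial gradient in [y]. *)
Lemma ystar_lip x x' : X x -> X x' ->
  enorm (ys x - ys x') <= kappa * enorm (x - x').
Proof.
move=> Xx Xx'; set a := ys x; set b := ys x'.
have Ya : Y a by exact: ystar_in.
have Yb : Y b by exact: ystar_in.
have c1 := mr_concave mr Xx Ya Yb.
have c2 := mr_concave mr Xx Yb Ya.
have o1 := ystar_optimality Xx Yb; have o2 := ystar_optimality Xx' Ya.
rewrite -/a -/b in o1 o2.
have c3 : dotv (gy x b - gy x' b) (a - b) <= Lf * enorm (x - x') * enorm (a - b).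
  apply: (le_trans (dotv_le _ _)); rewrite ler_wpM2r ?enorm_ge0 //.
  exact: (mr_lipyx mr).
rewrite dotvBl in c3; rewrite (enormC b) in c2.
have [ab0|ab0] := eqVneq (enorm (a - b)) 0.
  by rewrite ab0 mulr_ge0 ?enorm_ge0 // divr_ge0 // ltW.
have abp : 0 < enorm (a - b) by rewrite lt_def ab0 enorm_ge0.
rewrite mulrAC ler_pdivlMr // -(ler_pM2r abp); lra.
Qed.

Let L := Lf * (1 + kappa).

Let kappa_ge0 : 0 <= kappa. Proof. by rewrite divr_ge0 // ltW. Qed.

Lemma smooth_coef_gt0 : 0 < L.
Proof. by rewrite mulr_gt0 // ltr_wpDr. Qed.

(** Danskin's formula, with a quadratic remainder. *)
Lemma danskin x x' : X x -> X x' ->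
  `|F x' - F x - dotv (gx x (ys x)) (x' - x)| <= L * enorm (x' - x) ^+ 2.
Proof.
move=> Xx Xx'; rewrite !(mr_max mr) //; set b := ys x'; set a := ys x.
have Ya : Y a by exact: ystar_in.
have Yb : Y b by exact: ystar_in.
have [_ amax] := mr_argmax mr Xx; have [_ bmax] := mr_argmax mr Xx'.
have := mr_taylorx mr Xx Xx' Ya; have := mr_taylorx mr Xx Xx' Yb.
rewrite !ler_norml => /andP[_ t1] /andP[t2 _].
have a1 := amax _ Yb; have b1 := bmax _ Ya; rewrite -/a -/b in a1 b1.
have c1 : dotv (gx x b - gx x a) (x' - x) <= Lf * kappa * enorm (x' - x) ^+ 2.
  apply: (le_trans (dotv_le _ _)).
  rewrite expr2 mulrA ler_wpM2r ?enorm_ge0 // -mulrA.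
  apply: (le_trans (mr_lipxy mr Xx Yb Ya)); rewrite ler_wpM2l ?(ltW Lf_gt0) //.
  exact: ystar_lip.
rewrite dotvBl in c1.
have k0 : 0 <= Lf * kappa * enorm (x' - x) ^+ 2.
  by rewrite mulr_ge0 ?sqr_ge0 // mulr_ge0 // ltW.
rewrite /L; apply/andP; split; lra.
Qed.

(** The two sources of the error on the gradient of [F]: the tracking error of
    [y^*] and the estimation error of [v]. *)
Lemma gradx_error x y v : X x -> Y y ->
  enorm (gx x (ys x) - v) <= Lf * enorm (y - ys x) + enorm (v - gx x y).
Proof.
move=> Xx Yy; apply: (le_trans (enormB_trans (gx x y) _ _)).
rewrite (enormC _ v) lerD2r (enormC y).
by apply: (mr_lipxy mr) => //; exact: ystar_in.
Qed.

Lemma gradx_error_sqr x y v : X x -> Y y ->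
  enorm (gx x (ys x) - v) ^+ 2 <=
  2 * (Lf ^+ 2 * enorm (y - ys x) ^+ 2 + enorm (v - gx x y) ^+ 2).
Proof.
move=> Xx Yy; have H := gradx_error v Xx Yy.
set a := enorm (y - ys x) in H *; set b := enorm (v - gx x y) in H *.
have := sqr_ge0 (Lf * a - b).
have : enorm (gx x (ys x) - v) ^+ 2 <= (Lf * a + b) ^+ 2.
  by rewrite ler_pXn2r // nnegrE ?enorm_ge0 // (le_trans _ H) // enorm_ge0.
by nra.
Qed.

Section ProximalX.
Variables (rho gam : R) (A : 'M[R]_d1) (x xt v : 'rV[R]_d1) (y : 'rV[R]_d2).
Hypotheses (rho_gt0 : 0 < rho) (gam_gt0 : 0 < gam).
Hypothesis As : sym_lambda_min_ge rho A.
Hypotheses (Xx : X x) (Yy : Y y).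
Hypothesis xtP : prox_argmin X gam A x v xt.

(** The variational inequality of the proximal point [xt], tested at [x]. *)
Lemma prox_step_dotv : dotv v (xt - x) <= - (rho / gam * enorm (xt - x) ^+ 2).
Proof.
have := argmin_quadf_optimality (mr_Xc mr) As.1 xtP Xx.
have -> : 2 * (2 * gam)^-1 = gam^-1 by field; rewrite gt_eqF.
rewrite -(opprB xt x) dotvNr dotvDl dotvZl -quadfE => H.
have q1 := quadf_ge_lambda_min (xt - x) As.
have : gam^-1 * (rho * enorm (xt - x) ^+ 2) <= gam^-1 * quadf A (xt - x).
  by rewrite ler_wpM2l // invr_ge0 ltW.
lra.
Qed.

(** Danskin's expansion of [F], where the gradient of [F] is replaced by [v]; the
    error of this replacement and the quadratic remainder are absorbed by half of
    the decrease. *)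
Lemma descent_step (eta : R) : 0 <= eta <= 1 -> 4 * gam * L <= rho ->
  F (x + eta *: (xt - x)) <= F x - eta * (rho / (2 * gam)) * enorm (xt - x) ^+ 2
    + eta * (2 * gam / rho) *
      (Lf ^+ 2 * enorm (y - ys x) ^+ 2 + enorm (v - gx x y) ^+ 2).
Proof.
move=> eta01 gL; have /andP[eta0 eta1] := eta01.
have Xp : X (x + eta *: (xt - x)) by apply: (convex_segment (mr_Xc mr)) => //; exact: xtP.1.
have := danskin Xx Xp; rewrite ler_norml (addrC x) addrK => /andP[_ dk].
have s0 : 0 < 2 * gam / rho by rewrite divr_gt0 // mulr_gt0.
have yg := dotv_young (gx x (ys x) - v) (xt - x) s0.
rewrite dotvBl in yg; have pv := prox_step_dotv.
have ge := gradx_error_sqr v Xx Yy.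
rewrite dotvZr enormZ exprMn real_normK ?num_real // in dk.
set E := Lf ^+ 2 * _ + _ in ge *; set N := enorm (xt - x) ^+ 2 in dk yg pv *.
have N0 : 0 <= N by exact: sqr_ge0.
have L1 : L * (eta ^+ 2 * N) <= eta * (rho / (4 * gam) * N).
  have -> : L * (eta ^+ 2 * N) = eta * (eta * L * N) by ring.
  rewrite ler_wpM2l // ler_wpM2r //.
  rewrite ler_pdivlMr ?mulr_gt0 //; apply: le_trans gL.
  rewrite mulrC ler_wpM2l ?(ltW (mulr_gt0 _ gam_gt0)) //.
  by rewrite ler_piMl // ltW // smooth_coef_gt0.
have Y1 : (2 * (2 * gam / rho))^-1 = rho / (4 * gam).
  by field; rewrite !gt_eqF.
rewrite Y1 in yg.
have G1 : 2 * gam / rho / 2 * enorm (gx x (ys x) - v) ^+ 2 <= 2 * gam / rho * E.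
  have -> : 2 * gam / rho * E = 2 * gam / rho / 2 * (2 * E) by field; rewrite gt_eqF.
  by rewrite ler_wpM2l // divr_ge0 // ltW.
have D1 : eta * dotv (gx x (ys x)) (xt - x) <=
   eta * (2 * gam / rho * E + rho / (4 * gam) * N - rho / gam * N).
  by rewrite ler_wpM2l //; lra.
have R1 : rho / gam * N = 4 * (rho / (4 * gam) * N) by field; rewrite gt_eqF.
have R2 : rho / (2 * gam) * N = 2 * (rho / (4 * gam) * N) by field; rewrite gt_eqF.
rewrite -(mulrA eta (rho / _)) R2 -(mulrA eta (2 * gam / rho)) in D1 *.
rewrite R1 in D1.
lra.
Qed.

End ProximalX.

Section ProximalY.
Variables (lam b : R) (x : 'rV[R]_d1) (y yt w : 'rV[R]_d2).
Hypotheses (lam_gt0 : 0 < lam) (b_gt0 : 0 < b).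
Hypotheses (Xx : X x) (Yy : Y y).
Hypothesis ytP : prox_argmax Y lam b%:M y w yt.
Let tau := lam / b.

Let tau_gt0 : 0 < tau. Proof. exact: divr_gt0. Qed.

Lemma prox_stepy_dotv z : Y z ->
  tau * dotv w (z - yt) <= dotv (yt - y) (z - yt).
Proof.
move=> Yz; have ytmin : is_argmin Y
    (fun y' => dotv (- w) y' + (2 * lam)^-1 * quadf b%:M (y' - y)) yt.
  split; first exact: ytP.1.
  by move=> z' Yz'; have := ytP.2 z' Yz'; rewrite !dotvNl; lra.
have := argmin_quadf_optimality (mr_Yc mr) (tr_scalar_mx _ _) ytmin Yz.
have -> : 2 * (2 * lam)^-1 = lam^-1 by field; rewrite gt_eqF.
rewrite mul_mx_scalar dotvDl dotvNl !dotvZl => H.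
have : 0 <= tau * (- dotv w (z - yt) + lam^-1 * (b * dotv (yt - y) (z - yt))).
  by rewrite mulr_ge0 // ltW.
rewrite mulrDr.
have -> : tau * (lam^-1 * (b * dotv (yt - y) (z - yt))) = dotv (yt - y) (z - yt).
  by rewrite /tau; field; rewrite !gt_eqF.
lra.
Qed.

(** Strong concavity at [y] towards [y^*(x)] gives the contraction.  The move
    [yt - y] contributes [- |yt - y|^2] through the proximal inequality, which pays
    for the curvature, for the error on [w] and for [eta^2 |yt - y|^2]. *)
Lemma ascent_step (eta : R) : 0 <= eta <= 1 -> 6 * Lf * tau <= 1 ->
  enorm (y + eta *: (yt - y) - ys x) ^+ 2 <=
    (1 - eta * tau * mu / 2) * enorm (y - ys x) ^+ 2
    - eta / 6 * enorm (yt - y) ^+ 2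
    + 2 * eta * tau * (mu^-1 + tau) * enorm (w - gy x y) ^+ 2.
Proof.
move=> /andP[eta0 eta1] Lt.
have Yys := ystar_in Xx; have [_ ysmax] := mr_argmax mr Xx.
have Yyt : Y yt := ytP.1.
have c1 := mr_concave mr Xx Yys Yy.
have c2 := mr_concave mr Xx Yy Yyt.
have m1 := ysmax _ Yyt.
have p1 := prox_stepy_dotv Yys.
set s := ys x in c1 c2 m1 p1 Yys *.
have l1 : dotv (gy x y - gy x yt) (yt - y) <= Lf * enorm (yt - y) ^+ 2.
  apply: (le_trans (dotv_le _ _)); rewrite expr2 mulrA ler_wpM2r ?enorm_ge0 //.
  by rewrite (enormC yt); exact: (mr_lipyy mr).
set u := w - gy x y.
have y1 := dotv_young (- u) (s - y) (ltac:(by rewrite divr_gt0) : 0 < 2 / mu).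
have y2 := dotv_young u (yt - y) (ltac:(by rewrite mulr_gt0) : 0 < 2 * tau).
have -> : y + eta *: (yt - y) - s = (y - s) + eta *: (yt - y) by rewrite addrAC.
rewrite sqr_enormD dotvZr enormZ exprMn real_normK ?num_real //.
rewrite enormN (enormC s) in y1; rewrite (enormC s) in c1; rewrite (enormC y yt) in c2.
have ii : (2 * (2 / mu))^-1 = mu / 4 by field; rewrite gt_eqF.
have ii2 : (2 * (2 * tau))^-1 = tau^-1 / 4 by field; rewrite gt_eqF.
have i3 : 2 / mu / 2 = mu^-1 by field; rewrite gt_eqF.
have i4 : 2 * tau / 2 = tau by field.
rewrite ii i3 in y1; rewrite ii2 i4 in y2.
set d := enorm (y - s) ^+ 2 in c1 y1 *; set N := enorm (yt - y) ^+ 2 in c2 l1 y2 *.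
set U := enorm u ^+ 2 in y1 y2 *.
have d0 : 0 <= d by exact: sqr_ge0.
have N0 : 0 <= N by exact: sqr_ge0.
have U0 : 0 <= U by exact: sqr_ge0.
(* everything in terms of the inner products with [s - y] and [yt - y] *)
have e1 : s - yt = (s - y) - (yt - y) by rewrite opprB subrKA.
rewrite e1 (dotvBr w (s - y)) (dotvBr (yt - y) (s - y)) in p1.
rewrite -(sqr_enorm (yt - y)) -/N in p1.
rewrite dotvNl /u (dotvBl w) in y1; rewrite /u (dotvBl w) in y2; rewrite dotvBl in l1.
have e2 : y - yt = - (yt - y) by rewrite opprB.
rewrite e2 dotvNr in c2.
have e3 : dotv (y - s) (yt - y) = - dotv (yt - y) (s - y).
  by rewrite dotvC -(opprB s) dotvNr.
rewrite e3.
set P1 := dotv (yt - y) (s - y) in p1 *.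
set w1 := dotv w (s - y) in p1 y1; set w2 := dotv w (yt - y) in p1 y2.
set g1 := dotv (gy x y) (s - y) in c1 y1.
set g2 := dotv (gy x y) (yt - y) in l1 y2.
set g3 := dotv (gy x yt) (yt - y) in c2 l1.
have S1 : 0 <= w1 - w2 + (mu^-1 + tau) * U + (tau^-1 / 4 + Lf) * N - mu / 4 * d.
  have muN : 0 <= mu / 2 * N by rewrite mulr_ge0 // divr_ge0 // ltW.
  lra.
have S2 : 0 <= P1 - N + tau * (mu^-1 + tau) * U + (1 / 4 + 6^-1) * N - tau * mu / 4 * d.
  have : 0 <= tau * (w1 - w2 + (mu^-1 + tau) * U + (tau^-1 / 4 + Lf) * N - mu / 4 * d).
    by rewrite mulr_ge0 // ltW.
  have -> : tau * (w1 - w2 + (mu^-1 + tau) * U + (tau^-1 / 4 + Lf) * N - mu / 4 * d) =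
    tau * (w1 - w2) + tau * (mu^-1 + tau) * U + (1 / 4 + Lf * tau) * N
    - tau * mu / 4 * d by field; rewrite !gt_eqF.
  have : Lf * tau * N <= 6^-1 * N by rewrite ler_wpM2r //; lra.
  lra.
have S3 : 0 <= 2 * eta * (P1 - N + tau * (mu^-1 + tau) * U + (1 / 4 + 6^-1) * N
    - tau * mu / 4 * d) by rewrite mulr_ge0 // mulr_ge0.
have S4 : eta ^+ 2 * N <= eta * N.
  by rewrite ler_wpM2r // expr2 -[leRHS]mulr1 ler_wpM2l.
have : 0 <= eta * N by rewrite mulr_ge0.
lra.
Qed.

End ProximalY.

Section Potential.
Variables (rho gam lam b bhat Kc : R).
Hypotheses (rho_gt0 : 0 < rho) (gam_gt0 : 0 < gam) (lam_gt0 : 0 < lam).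
Hypotheses (b_gt0 : 0 < b) (b_le_bhat : b <= bhat).
Let tau0 := lam / bhat.
Let tau1 := lam / b.
Hypothesis gam_smooth : 4 * gam * L <= rho.
Hypothesis tau_smooth : 6 * Lf * tau1 <= 1.
Hypothesis tau_mu : 1 + mu * tau1 <= Kc.

Let bhat_gt0 : 0 < bhat. Proof. exact: lt_le_trans b_le_bhat. Qed.
Let tau0_gt0 : 0 < tau0. Proof. exact: divr_gt0. Qed.

Definition tracking_weight := 16 * Lf ^+ 2 / (tau0 * mu).

(** The ascent step contracts the distance to [y^*(x)], and moving from
    [y^*(x)] to [y^*(x+)] costs at most [kappa] times the move in [x].  The
    split parameter [r] of Young's inequality spends half of the contraction. *)
Lemma tracking_step (bt eta : R) (x xt : 'rV[R]_d1) (y yt w : 'rV[R]_d2) :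
  b <= bt <= bhat -> 0 < eta <= 1 -> X x -> X xt -> Y y ->
  prox_argmax Y lam bt%:M y w yt ->
  enorm (y + eta *: (yt - y) - ys (x + eta *: (xt - x))) ^+ 2 <=
    enorm (y - ys x) ^+ 2 - eta * (tau0 * mu / 4) * enorm (y - ys x) ^+ 2
    - eta / 6 * enorm (yt - y) ^+ 2
    + eta * (2 * Kc ^+ 2 * (tau1 / mu)) * enorm (w - gy x y) ^+ 2
    + eta * (4 * Kc * kappa ^+ 2 / (tau0 * mu)) * enorm (xt - x) ^+ 2.
Proof.
move=> /andP[bb bbh] /andP[eta0 eta1] Xx Xxt Yy ytP.
have eta01 : 0 <= eta <= 1 by rewrite (ltW eta0).
have bt0 : 0 < bt by exact: lt_le_trans bb.
pose tau := lam / bt.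
have tau_gt0 : 0 < tau by exact: divr_gt0.
have t0 : tau0 <= tau by rewrite ler_wpM2l ?(ltW lam_gt0) // lef_pV2.
have t1 : tau <= tau1 by rewrite ler_wpM2l ?(ltW lam_gt0) // lef_pV2.
have Lt : 6 * Lf * tau <= 1.
  by apply: le_trans tau_smooth; rewrite ler_wpM2l // mulr_ge0 // ltW.
have as_ := ascent_step lam_gt0 bt0 Xx Yy ytP eta01 Lt.
rewrite -/tau in as_.
have Xp : X (x + eta *: (xt - x)) by exact: convex_segment (mr_Xc mr) _ _ _.
set yp : 'rV[R]_d2 := y + eta *: (yt - y) in as_ *.
set xp : 'rV[R]_d1 := x + eta *: (xt - x) in Xp *.
pose r := eta * tau * mu / 4.
have r0 : 0 < r by rewrite /r divr_gt0 // !mulr_gt0 // invr_gt0.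
have -> : yp - ys xp = (yp - ys x) + (ys x - ys xp) by rewrite subrKA.
apply: (le_trans (enorm_sqrD_young _ _ r0)).
have M1 : enorm (ys x - ys xp) ^+ 2 <= kappa ^+ 2 * eta ^+ 2 * enorm (xt - x) ^+ 2.
  rewrite -!exprMn ler_pXn2r ?nnegrE ?enorm_ge0 //; last first.
    by rewrite mulr_ge0 ?enorm_ge0 // mulr_ge0 // ltW.
  apply: (le_trans (ystar_lip Xx Xp)); rewrite -[leRHS]mulrA ler_wpM2l //.
  by rewrite enormC /xp addrC addKr enormZ gtr0_norm.
set d := enorm (y - ys x) ^+ 2 in as_ *; set N := enorm (yt - y) ^+ 2 in as_ *.
set U := enorm (w - gy x y) ^+ 2 in as_ *; set M := enorm (xt - x) ^+ 2 in M1 *.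
have d0 : 0 <= d by exact: sqr_ge0.
have N0 : 0 <= N by exact: sqr_ge0.
have U0 : 0 <= U by exact: sqr_ge0.
have M0 : 0 <= M by exact: sqr_ge0.
have mut : mu * tau <= Kc - 1.
  have : mu * tau <= mu * tau1 by rewrite ler_wpM2l // ltW.
  by have := tau_mu; lra.
have mut0 : 0 < mu * tau by exact: mulr_gt0.
have Kc1 : 1 <= Kc by lra.
have rK : 1 + r <= Kc.
  have : eta * (mu * tau) <= 1 * (mu * tau) by rewrite ler_wpM2r // ltW.
  by rewrite /r; lra.
have A1 : (1 + r) * enorm (yp - ys x) ^+ 2 <=
    d - eta * (tau0 * mu / 4) * d - eta / 6 * N
    + eta * (2 * Kc ^+ 2 * (tau1 / mu)) * U.
  have r1 : 0 <= 1 + r by lra.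
  apply: (le_trans (ler_wpM2l r1 as_)).
  have e1 : (1 + r) * ((1 - eta * tau * mu / 2) * d) <= d - eta * (tau0 * mu / 4) * d.
    have -> : (1 + r) * ((1 - eta * tau * mu / 2) * d) = d - r * d - 2 * r ^+ 2 * d.
      by rewrite /r; field; rewrite ?gt_eqF.
    have h1 : eta * (tau0 * mu) <= eta * (tau * mu).
      by rewrite (ler_pM2l eta0) (ler_pM2r mu_gt0).
    have h2 := ler_wpM2r d0 h1.
    have : eta * (tau0 * mu / 4) * d <= r * d by rewrite /r; lra.
    have : 0 <= 2 * r ^+ 2 * d by rewrite mulr_ge0 // mulr_ge0 // sqr_ge0.
    lra.
  have e2 : (1 + r) * (eta / 6 * N) >= eta / 6 * N.
    have n0 : 0 <= eta / 6 * N by rewrite mulr_ge0 // divr_ge0 // ltW.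
    by have := mulr_ge0 (ltW r0) n0; lra.
  have e3 : (1 + r) * (2 * eta * tau * (mu^-1 + tau) * U) <=
      eta * (2 * Kc ^+ 2 * (tau1 / mu)) * U.
    rewrite mulrA ler_wpM2r //.
    have -> : (1 + r) * (2 * eta * tau * (mu^-1 + tau)) =
        eta * 2 * ((1 + r) * (tau * ((1 + mu * tau) / mu))).
      by field; rewrite gt_eqF.
    have -> : eta * (2 * Kc ^+ 2 * (tau1 / mu)) = eta * 2 * (Kc * (tau1 * (Kc / mu))).
      by ring.
    have cu0 : 0 <= (1 + mu * tau) / mu.
      by rewrite divr_ge0 ?(ltW mu_gt0) // addr_ge0 // ltW.
    have cuK : (1 + mu * tau) / mu <= Kc / mu.
      by rewrite ler_pdivrMr // divfK ?gt_eqF //; lra.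
    rewrite ler_wpM2l ?(mulr_ge0 (ltW eta0)) //.
    apply: ler_pM => //; first exact: mulr_ge0 (ltW tau_gt0) cu0.
    by apply: ler_pM => //; exact: ltW.
  lra.
have A2 : (1 + r^-1) * enorm (ys x - ys xp) ^+ 2 <=
    eta * (4 * Kc * kappa ^+ 2 / (tau0 * mu)) * M.
  have ri : 0 <= 1 + r^-1 by rewrite addr_ge0 // invr_ge0 ltW.
  apply: (le_trans (ler_wpM2l ri M1)).
  rewrite [leLHS]mulrA ler_wpM2r //.
  have -> : (1 + r^-1) * (kappa ^+ 2 * eta ^+ 2) =
     eta * kappa ^+ 2 * (eta + 4 / (tau * mu)).
    by rewrite /r; field; rewrite !gt_eqF.
  have -> : eta * (4 * Kc * kappa ^+ 2 / (tau0 * mu)) =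
     eta * kappa ^+ 2 * (4 * Kc / (tau0 * mu)) by ring.
  have ek0 : 0 <= eta * kappa ^+ 2 := mulr_ge0 (ltW eta0) (sqr_ge0 _).
  rewrite ler_wpM2l //.
  have tm0 : 0 < tau0 * mu by exact: mulr_gt0.
  have f1 : 4 / (tau * mu) <= 4 / (tau0 * mu).
    have tm1 : 0 < tau * mu by exact: mulr_gt0.
    by rewrite ler_wpM2l // lef_pV2 ?posrE // (ler_pM2r mu_gt0).
  have f2 : eta + 4 / (tau0 * mu) <= 4 * Kc / (tau0 * mu).
    rewrite -lerBrDr -mulrBl ler_pdivlMr //.
    have : eta * (tau0 * mu) <= 1 * (mu * tau).
      rewrite (mulrC tau0); apply: ler_pM; rewrite ?(ltW eta0) //.
        exact: ltW (mulr_gt0 mu_gt0 tau0_gt0).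
      by rewrite (ler_pM2l mu_gt0).
    lra.
  by apply: le_trans f2; rewrite lerD2l.
lra.
Qed.

Definition potential (x : 'rV[R]_d1) (y : 'rV[R]_d2) :=
  rho / gam * F x + tracking_weight * enorm (y - ys x) ^+ 2.

Hypothesis gam_small :
  256 * Kc * Lf ^+ 2 * kappa ^+ 2 * gam ^+ 2 <= rho ^+ 2 * tau0 ^+ 2 * mu ^+ 2.

(** The weight of the tracking error makes its contraction absorb the error term
    of the descent step, and [gam_small] makes the progress of the descent step
    absorb the drift of [y^*]. *)
Lemma potential_step (bt eta : R) (A : 'M[R]_d1) (x xt v : 'rV[R]_d1)
    (y yt w : 'rV[R]_d2) :
  b <= bt <= bhat -> 0 < eta <= 1 -> X x -> Y y -> sym_lambda_min_ge rho A ->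
  prox_argmin X gam A x v xt -> prox_argmax Y lam bt%:M y w yt ->
  potential (x + eta *: (xt - x)) (y + eta *: (yt - y)) +
    eta * (rho ^+ 2 / (4 * gam ^+ 2) * enorm (xt - x) ^+ 2
           + 2 * Lf ^+ 2 * enorm (y - ys x) ^+ 2
           + tracking_weight / 6 * enorm (yt - y) ^+ 2)
  <= potential x y +
    eta * (2 * enorm (v - gx x y) ^+ 2
           + 32 * Kc ^+ 2 * Lf ^+ 2 * (bhat / b) / mu ^+ 2 * enorm (w - gy x y) ^+ 2).
Proof.
move=> bb eta01 Xx Yy As xtP ytP; have /andP[eta0 eta1] := eta01.
have eta01' : 0 <= eta <= 1 by rewrite (ltW eta0).
have ds := descent_step rho_gt0 gam_gt0 As Xx Yy xtP eta01' gam_smooth.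
have ts := tracking_step bb eta01 Xx xtP.1 Yy ytP.
rewrite /potential.
set F1 := F _ in ds *; set d1' := enorm (_ - ys (_ + _)) ^+ 2 in ts *.
set d := enorm (y - ys x) ^+ 2 in ds ts *; set N := enorm (yt - y) ^+ 2 in ts *.
set U := enorm (w - gy x y) ^+ 2 in ts *; set M := enorm (xt - x) ^+ 2 in ds ts *.
set E := enorm (v - gx x y) ^+ 2 in ds *.
have M0 : 0 <= M by exact: sqr_ge0.
have tw0 : 0 < tracking_weight.
  by apply: divr_gt0; [rewrite mulr_gt0 // exprn_gt0|exact: mulr_gt0].
have rg0 : 0 < rho / gam by exact: divr_gt0.
have B1 := ler_wpM2l (ltW rg0) ds.
have B2 := ler_wpM2l (ltW tw0) ts.
have g1 : rho / gam * (F x - eta * (rho / (2 * gam)) * M +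
    eta * (2 * gam / rho) * (Lf ^+ 2 * d + E)) =
    rho / gam * F x - eta * (rho ^+ 2 / (2 * gam ^+ 2)) * M
    + eta * 2 * (Lf ^+ 2 * d + E) by field; rewrite !gt_eqF.
have g2 : tracking_weight * (d - eta * (tau0 * mu / 4) * d - eta / 6 * N
    + eta * (2 * Kc ^+ 2 * (tau1 / mu)) * U
    + eta * (4 * Kc * kappa ^+ 2 / (tau0 * mu)) * M) =
    tracking_weight * d - eta * (4 * Lf ^+ 2) * d
    - eta * (tracking_weight / 6) * N
    + eta * (32 * Kc ^+ 2 * Lf ^+ 2 * (bhat / b) / mu ^+ 2) * U
    + eta * (64 * Kc * Lf ^+ 2 * kappa ^+ 2 / (tau0 * mu) ^+ 2) * M.
  rewrite /tracking_weight /tau0 /tau1; field.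
  by rewrite !gt_eqF.
rewrite g1 in B1; rewrite g2 in B2.
have g3 : 64 * Kc * Lf ^+ 2 * kappa ^+ 2 / (tau0 * mu) ^+ 2 <= rho ^+ 2 / (4 * gam ^+ 2).
  have tm2 : 0 < (tau0 * mu) ^+ 2 := exprn_gt0 2 (mulr_gt0 tau0_gt0 mu_gt0).
  have gm2 : 0 < 4 * gam ^+ 2 := mulr_gt0 (ltr0n _ 4) (exprn_gt0 2 gam_gt0).
  rewrite (ler_pdivrMr _ _ tm2) [leRHS]mulrAC (ler_pdivlMr _ _ gm2) exprMn.
  by have := gam_small; lra.
have g4 : eta * (64 * Kc * Lf ^+ 2 * kappa ^+ 2 / (tau0 * mu) ^+ 2) * M <=
    eta * (rho ^+ 2 / (4 * gam ^+ 2)) * M.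
  by rewrite ler_wpM2r // ler_wpM2l // ltW.
have g5 : rho ^+ 2 / (2 * gam ^+ 2) = 2 * (rho ^+ 2 / (4 * gam ^+ 2)).
  by field; rewrite gt_eqF.
rewrite g5 in B1.
lra.
Qed.

End Potential.

End MinimaxGeometry.

(** * Regularity of the averaged objective *)

Section ProximalMap.
Context {R : realType} {n : nat}.
Implicit Types (u v x z : 'rV[R]_n) (A : 'M[R]_n).

(** Two variational inequalities tested against each other: the strong
    monotonicity of [z |-> z A] controls the distance of the solutions. *)
Lemma prox_vi_close (rho c : R) A x u1 u2 z1 z2 : 0 < c -> 0 < rho ->
  sym_lambda_min_ge rho A ->
  0 <= dotv (u1 + c *: ((z1 - x) *m A)) (z2 - z1) ->
  0 <= dotv (u2 + c *: ((z2 - x) *m A)) (z1 - z2) ->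
  c * rho * enorm (z1 - z2) <= enorm (u1 - u2).
Proof.
move=> c0 rho0 As vi1 vi2; have q := quadf_ge_lambda_min (z1 - z2) As.
have qE : quadf A (z1 - z2) =
    dotv ((z1 - x) *m A) (z1 - z2) - dotv ((z2 - x) *m A) (z1 - z2).
  by rewrite quadfE -dotvBl -mulmxBl opprB subrKA.
rewrite -(opprB z1 z2) dotvNr in vi1.
rewrite !dotvDl !dotvZl in vi1 vi2.
have cs := dotv_le (u2 - u1) (z1 - z2); rewrite dotvBl (enormC u2) in cs.
have [e0|e0] := eqVneq (enorm (z1 - z2)) 0.
  by rewrite e0 mulr0 enorm_ge0.
have ep : 0 < enorm (z1 - z2) by rewrite lt_def e0 enorm_ge0.
rewrite -(ler_pM2r ep).
have := ler_wpM2l (ltW c0) q; rewrite qE; lra.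
Qed.

Lemma enorm_mulmx_le_specnorm A u : enorm (u *m A) <= specnorm A * enorm u.
Proof.
have ub : has_ubound [set enorm (u *m A) | u in [set u : 'rV[R]_n | enorm u <= 1]].
  (* the Frobenius norm *)
  exists (Num.sqrt (\sum_j enorm (row j A^T) ^+ 2)) => _ [w /= w1 <-].
  rewrite -[leLHS]ger0_norm ?enorm_ge0 // -sqrtr_sqr ler_wsqrtr // sqr_enormE.
  apply: ler_sum => j _; rewrite -real_normK ?num_real //.
  rewrite ler_pXn2r ?nnegrE ?enorm_ge0 //.
  have -> : (w *m A) 0 j = dotv w (row j A^T).
    by rewrite mulmx_coord dotvE; apply: eq_bigr => i _; rewrite !mxE.
  by apply: (le_trans (norm_dotv_le _ _)); rewrite ler_piMl ?enorm_ge0.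
have [->|u0] := eqVneq u 0; first by rewrite mul0mx !enorm0 mulr0.
have eu : 0 < enorm u.
  rewrite lt_def enorm_ge0 andbT; apply: contraNneq u0 => e0.
  by rewrite (enorm_eq0 e0).
rewrite -ler_pdivrMr //.
have -> : enorm (u *m A) / enorm u = enorm (((enorm u)^-1 *: u) *m A).
  by rewrite -scalemxAl enormZ ger0_norm ?invr_ge0 ?enorm_ge0 // mulrC.
apply: ub_le_sup => //; exists ((enorm u)^-1 *: u) => //=.
by rewrite enormZ ger0_norm ?invr_ge0 ?enorm_ge0 // mulVf // gt_eqF.
Qed.

End ProximalMap.

Section Minimax.
Context {R : realType} {d1 d2 : nat} {dXi : measure_display}.
Context {Xi : measurableType dXi}.
Variables (D : probability Xi R) (f : 'rV[R]_d1 -> 'rV[R]_d2 -> Xi -> R).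
Variables (X : set 'rV[R]_d1) (Y : set 'rV[R]_d2) (Lf mu sigma : R).
Hypotheses (Lf_gt0 : 0 < Lf) (mu_gt0 : 0 < mu).
Hypothesis ma : minimax_assumptions D f X Y Lf mu sigma.
Hypotheses (Xc : convex_set X) (Yc : convex_set Y).
Hypotheses (Y0 : Y !=set0) (Yk : compact Y).

Local Notation h := (fmean D f).
Local Notation gx := (gradx h).
Local Notation gy := (grady h).
Local Notation ys := (ystar D f Y).
Local Notation F := (Fmax D f Y).
Local Notation kappa := (Lf / mu).

(** The Lipschitz bounds of the components pass to the averaged gradients. *)
Lemma gradx_lipx x x' y : X x -> X x' -> Y y ->
  enorm (gx x y - gx x' y) <= Lf * enorm (x - x').
Proof.
move=> Xx Xx' Yy.
apply: (enorm_expect_le (ma_unbiasedx ma Xx Yy) (ma_unbiasedx ma Xx' Yy)) => z.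
exact: (ma_lipxx ma).
Qed.

Lemma gradx_lipy x y y' : X x -> Y y -> Y y' ->
  enorm (gx x y - gx x y') <= Lf * enorm (y - y').
Proof.
move=> Xx Yy Yy'.
apply: (enorm_expect_le (ma_unbiasedx ma Xx Yy) (ma_unbiasedx ma Xx Yy')) => z.
exact: (ma_lipxy ma).
Qed.

Lemma grady_lipx x x' y : X x -> X x' -> Y y ->
  enorm (gy x y - gy x' y) <= Lf * enorm (x - x').
Proof.
move=> Xx Xx' Yy.
apply: (enorm_expect_le (ma_unbiasedy ma Xx Yy) (ma_unbiasedy ma Xx' Yy)) => z.
exact: (ma_lipyx ma).
Qed.

Lemma grady_lipy x y y' : X x -> Y y -> Y y' ->
  enorm (gy x y - gy x y') <= Lf * enorm (y - y').
Proof.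
move=> Xx Yy Yy'.
apply: (enorm_expect_le (ma_unbiasedy ma Xx Yy) (ma_unbiasedy ma Xx Yy')) => z.
exact: (ma_lipyy ma).
Qed.

Lemma ystarP x : X x -> is_argmax Y (h x) (ys x).
Proof.
move=> Xx; have [y Yy ymax] : exists2 y, y \in Y & forall t, t \in Y -> h x t <= h x y.
  apply: EVT_max_rV => //; apply: continuous_in_subspaceT => y /set_mem Yy.
  exact/differentiable_continuous/(ma_diffy ma).
apply: (@xgetPex _ 0 [set y | is_argmax Y (h x) y]); exists y.
by split; [exact: set_mem|move=> y' Yy'; apply: ymax; exact: mem_set].
Qed.

Lemma FmaxE x : X x -> F x = h x (ys x).
Proof.
move=> Xx; have [Yys ysmax] := ystarP Xx.
apply/eqP; rewrite eq_le; apply/andP; split.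
  by apply: ge_sup => [|_ [y Yy <-]]; [exists (h x (ys x)), (ys x)|exact: ysmax].
apply: ub_le_sup; last by exists (ys x).
by exists (h x (ys x)) => _ [y Yy <-]; exact: ysmax.
Qed.

Lemma fmean_taylorx x x' y : X x -> X x' -> Y y ->
  `|h x' y - h x y - dotv (gx x y) (x' - x)| <= Lf * enorm (x' - x) ^+ 2.
Proof.
move=> Xx Xx' Yy.
apply: (@smooth_taylor _ _ X (h ^~ y) Lf x x' Xc) => //; last exact: ltW.
  by move=> z Xz; exact: (ma_diffx ma).
by move=> z z' Xz Xz'; exact: gradx_lipx.
Qed.

Lemma fmean_regular : minimax_regular X Y Lf mu h gx gy ys F.
Proof.
split => //; [exact: gradx_lipx|exact: gradx_lipy|exact: grady_lipx|
  exact: grady_lipy|exact: fmean_taylorx|exact: (ma_strongly_concave ma)|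
  exact: ystarP|exact: FmaxE].
Qed.

(** Danskin's gradient and the gradient along [X] are both first-order expansions
    of [F] along [X]. *)
Lemma gradF_dotv x z : X x -> X z ->
  dotv (gradF D f X Y x) (z - x) = dotv (gx x (ys x)) (z - x).
Proof.
move=> Xx Xz; apply/eqP; rewrite -subr_eq0 -dotvBl; apply/eqP.
have dgF : is_gradient_on X F x (gx x (ys x)).
  apply: (is_gradient_on_taylor (ltW (smooth_coef_gt0 Lf_gt0 mu_gt0))) => w Xw.
  exact: (danskin Lf_gt0 mu_gt0 fmean_regular).
apply: (is_gradient_on_unique Xc Xx _ dgF Xz).
by apply: (@xgetPex _ 0 [set u | is_gradient_on X F x u]); exists (gx x (ys x)).
Qed.

Lemma gradF_setT x : X = setT -> gradF D f X Y x = gx x (ys x).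
Proof.
move=> XT; apply/eqP; rewrite -subr_eq0; apply/eqP/enorm_eq0/eqP.
rewrite -sqrf_eq0; apply/eqP; set u := _ - _.
have Xall z : X z by rewrite XT.
have := gradF_dotv (Xall x) (Xall (x + u)); rewrite addrC addKr.
by rewrite sqr_enorm {2}/u dotvBl => ->; rewrite subrr.
Qed.

(** The exact and the computed proximal points solve the same strongly monotone
    problem with different gradients. *)
Lemma gradient_mapping_bound (rho gam : R) (A : 'M[R]_d1) x xt v y :
  compact X -> 0 < rho -> 0 < gam -> sym_lambda_min_ge rho A ->
  X x -> Y y -> prox_argmin X gam A x v xt ->
  enorm (gradient_mapping X gam A x (gradF D f X Y x)) <=
    gam^-1 * enorm (xt - x)
    + rho^-1 * (Lf * enorm (y - ys x) + enorm (v - gx x y)).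
Proof.
move=> Xk rho0 gam0 As Xx Yy xtP; rewrite /gradient_mapping.
set g := gradF D f X Y x; set z := xget 0 _.
have zP : prox_argmin X gam A x g z.
  apply: (@xgetPex _ 0 (prox_argmin X gam A x g)).
  by apply: argmin_quadf_exists => //; exists x.
have cE : 2 * (2 * gam)^-1 = gam^-1 by field; rewrite gt_eqF.
have vi1 := argmin_quadf_optimality Xc As.1 xtP zP.1.
have vi2 := argmin_quadf_optimality Xc As.1 zP xtP.1.
rewrite !cE in vi1 vi2.
have gE : dotv g (xt - z) = dotv (gx x (ys x)) (xt - z).
  have -> : xt - z = (xt - x) - (z - x) by rewrite opprB subrKA.
  by rewrite !(dotvBr _ (xt - x)) !gradF_dotv //; [exact: zP.1|exact: xtP.1].
rewrite dotvDl gE -dotvDl in vi2.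
have ig0 : 0 < gam^-1 by rewrite invr_gt0.
have cl := prox_vi_close ig0 rho0 As vi1 vi2.
have ge := gradx_error fmean_regular v Xx Yy.
move: cl ge; set g' := gx x (ys x); set E := Lf * _ + _; clearbody g' E => cl eE.
rewrite enormC in eE.
have cl2 : gam^-1 * enorm (xt - z) <= rho^-1 * E.
  by rewrite ler_pdivlMl // mulrA (mulrC rho); exact: le_trans eE.
rewrite enormZ gtr0_norm //.
apply: (@le_trans _ _ (gam^-1 * (enorm (x - xt) + enorm (xt - z)))).
  by rewrite ler_wpM2l ?(ltW ig0) // enormB_trans.
by rewrite mulrDr (enormC x) lerD2l.
Qed.

(** Without constraint the proximal step is [- gam v A^-1], so that [|v|] is
    recovered from the length of the step. *)
Lemma gradF_bound (gam : R) (A : 'M[R]_d1) x xt v y :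
  X = setT -> 0 < gam -> A^T = A -> Y y -> prox_argmin X gam A x v xt ->
  enorm (gradF D f X Y x) <=
    enorm v + (Lf * enorm (y - ys x) + enorm (v - gx x y)) /\
  enorm v <= specnorm A * (gam^-1 * enorm (xt - x)).
Proof.
move=> XT gam0 As Yy xtP; have Xall z : X z by rewrite XT.
split.
  rewrite gradF_setT // -(subrK v (gx x (ys x))) addrC.
  by apply: (le_trans (enormD _ _)); rewrite lerD2l; exact: (gradx_error fmean_regular).
have cE : 2 * (2 * gam)^-1 = gam^-1 by field; rewrite gt_eqF.
set u := v + gam^-1 *: ((xt - x) *m A).
have := argmin_quadf_optimality Xc As xtP (Xall (xt - u)).
rewrite cE -/u (addrC xt) addrK dotvNr -sqr_enorm oppr_ge0 => u0.
have {}u0 : u = 0.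
  by apply/enorm_eq0/eqP; rewrite -sqrf_eq0 eq_le u0 sqr_ge0.
have -> : v = - (gam^-1 *: ((xt - x) *m A)).
  by apply/eqP; rewrite -addr_eq0 -/u u0.
rewrite enormN enormZ gtr0_norm ?invr_gt0 // mulrCA.
by rewrite ler_wpM2l ?invr_ge0 ?(ltW gam0) // enorm_mulmx_le_specnorm.
Qed.

End Minimax.

(** * Recursion of the gradient estimator *)

Section Oracle.
Context {R : realType} {d1 d2 n : nat} {dXi : measure_display}.
Context {Xi : measurableType dXi}.
Variables (D : probability Xi R) (X : set 'rV[R]_d1) (Y : set 'rV[R]_d2).
Variables (Lf sigma : R).

(** Both partial gradients are instances, so that one recursion serves for the two
    estimators. *)
Record stochastic_oracle (s : Xi -> 'rV[R]_d1 -> 'rV[R]_d2 -> 'rV[R]_n)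
    (g : 'rV[R]_d1 -> 'rV[R]_d2 -> 'rV[R]_n) : Prop := {
  so_unbiased : forall x y, X x -> Y y -> forall i,
    summable_fun D (fun z => s z x y 0 i) /\
    (\int[D]_z (s z x y 0 i)%:E = (g x y 0 i)%:E)%E;
  so_variance : forall x y, X x -> Y y ->
    (\int[D]_z (enorm (g x y - s z x y) ^+ 2)%:E <= (sigma ^+ 2)%:E)%E;
  so_lipx : forall z x x' y, X x -> X x' -> Y y ->
    enorm (s z x y - s z x' y) <= Lf * enorm (x - x');
  so_lipy : forall z x y y', X x -> Y y -> Y y' ->
    enorm (s z x y - s z x y') <= Lf * enorm (y - y')
}.

Variables (s : Xi -> 'rV[R]_d1 -> 'rV[R]_d2 -> 'rV[R]_n).
Variables (g : 'rV[R]_d1 -> 'rV[R]_d2 -> 'rV[R]_n).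
Hypotheses (so : stochastic_oracle s g) (Lf_ge0 : 0 <= Lf).

Lemma oracle_lip z x x' y y' : X x -> X x' -> Y y -> Y y' ->
  enorm (s z x y - s z x' y') <= Lf * (enorm (x - x') + enorm (y - y')).
Proof.
move=> Xx Xx' Yy Yy'; apply: (le_trans (enormB_trans (s z x' y) _ _)).
by rewrite mulrDr; apply: lerD; [exact: (so_lipx so)|exact: (so_lipy so)].
Qed.

Lemma oracle_mean_lip x x' y y' : X x -> X x' -> Y y -> Y y' ->
  enorm (g x y - g x' y') <= Lf * (enorm (x - x') + enorm (y - y')).
Proof.
move=> Xx Xx' Yy Yy'.
apply: (enorm_expect_le (so_unbiased so Xx Yy) (so_unbiased so Xx' Yy')) => z.
exact: oracle_lip.
Qed.

Definition noise z x y := s z x y - g x y.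

Lemma noise_lip z x x' y y' : X x -> X x' -> Y y -> Y y' ->
  enorm (noise z x y - noise z x' y') <=
    2 * Lf * (enorm (x - x') + enorm (y - y')).
Proof.
move=> Xx Xx' Yy Yy'; rewrite /noise.
have -> : s z x y - g x y - (s z x' y' - g x' y') =
    (s z x y - s z x' y') - (g x y - g x' y').
  by apply/rowP => i; rewrite !mxE; ring.
apply: (le_trans (enormD _ _)); rewrite enormN.
by have := oracle_lip z Xx Xx' Yy Yy'; have := oracle_mean_lip Xx Xx' Yy Yy'; lra.
Qed.

Lemma noise_centred x y i : X x -> Y y ->
  summable_fun D (fun z => noise z x y 0 i) /\
  (\int[D]_z (noise z x y 0 i)%:E = 0)%E.
Proof.
move=> Xx Yy; have [si sE] := so_unbiased so Xx Yy i.
have nE z : noise z x y 0 i = s z x y 0 i - g x y 0 i by rewrite !mxE.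
have ni : summable_fun D (fun z => noise z x y 0 i).
  apply: (eq_summable (fun z => esym (nE z))).
  by apply: summableB => //; exact: summable_cst.
split=> //; rewrite expectE //; congr (_%:E).
rewrite (eq_expect _ nE) expectB ?expect_cst //; last exact: summable_cst.
by rewrite /expect /Rintegral sE subrr.
Qed.

Section ErrorStep.
Context {dOm : measure_display} {Om : measurableType dOm}.
Variables (P : probability Om R) (q : nat) (xi : 'I_q -> Om -> Xi).
Variables (G : set (set Om)).
Hypotheses (q_gt0 : (0 < q)%N).
Hypotheses (sG : sigma_algebra setT G) (Gm : G `<=` measurable).
Hypothesis mxi : forall i, measurable_fun setT (xi i).
Hypothesis batch_rule : forall E (S : 'I_q -> set Xi), G E ->
  (forall i, measurable (S i)) ->
  (P (E `&` \bigcap_(i in [set: 'I_q]) (xi i @^-1` S i))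
     = P E * \prod_(i < q) D (S i))%E.
Local Notation OmG := (g_sigma_algebraType G).
Variables (x x' : OmG -> 'rV[R]_d1) (y y' : OmG -> 'rV[R]_d2).
Variables (e : OmG -> 'rV[R]_n) (a : R).
Hypotheses (mx : measurable_vec x) (mx' : measurable_vec x').
Hypotheses (my : measurable_vec y) (my' : measurable_vec y').
Hypotheses (me : measurable_vec e).
Hypotheses (Xx : forall o, X (x o)) (Xx' : forall o, X (x' o)).
Hypotheses (Yy : forall o, Y (y o)) (Yy' : forall o, Y (y' o)).
Hypothesis a01 : 0 <= a <= 1.
Hypothesis ei : summable_fun P (fun o => enorm (e o) ^+ 2).
Hypothesis dxi : summable_fun P (fun o => enorm (x' o - x o) ^+ 2).
Hypothesis dyi : summable_fun P (fun o => enorm (y' o - y o) ^+ 2).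

(* Contribution of the sample [z] to the error of the next estimator. *)
Let psi (o : OmG) z := noise z (x' o) (y' o) - (1 - a) *: noise z (x o) (y o).

Let measurable_noise (u : OmG -> 'rV[R]_d1) (w : OmG -> 'rV[R]_d2) :
  measurable_vec u -> measurable_vec w ->
  (forall o, X (u o)) -> (forall o, Y (w o)) ->
  measurable_vec (fun p : OmG * Xi => noise p.2 (u p.1) (w p.1)).
Proof.
move=> mu mw Xu Yw i.
apply: (@measurable_caratheodory _ _ OmG _ Xi _ _ u w X Y (2 * Lf) mu mw Xu Yw
  (fun z x y => noise z x y 0 i)).
  by move=> b c Xb Yc; exact: (summable_measurable (noise_centred i Xb Yc).1).
move=> z b b' c c' Xb Xb' Yc Yc'; apply: le_trans (noise_lip z Xb Xb' Yc Yc').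
apply: le_trans (enorm_coord_le _ i).
by rewrite !mxE.
Qed.

Let measurable_psi : measurable_vec (fun p : OmG * Xi => psi p.1 p.2).
Proof.
by apply: measurable_vecB; [|apply: measurable_vecZ]; exact: measurable_noise.
Qed.

Let psi_centred o i : summable_fun D (fun z => psi o z 0 i) /\
  (\int[D]_z (psi o z 0 i)%:E = 0)%E.
Proof.
have [i1 n1] := noise_centred i (Xx' o) (Yy' o).
have [i2 n2] := noise_centred i (Xx o) (Yy o).
have pE z : psi o z 0 i =
    noise z (x' o) (y' o) 0 i - (1 - a) * noise z (x o) (y o) 0 i.
  by rewrite /psi mxE [X in _ + X]mxE [X in - X]mxE.
have pi : summable_fun D (fun z => psi o z 0 i).
  apply: (eq_summable (fun z => esym (pE z))).
  by apply: summableB => //; exact: summableZ.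
split=> //; rewrite expectE //; congr (_%:E).
rewrite (eq_expect _ pE) expectB ?expectZ //; last exact: summableZ.
by rewrite /expect /Rintegral n1 n2 /= mulr0 subr0.
Qed.

Let H (o : Om) : R := 16 * Lf ^+ 2 *
  (enorm (x' o - x o) ^+ 2 + enorm (y' o - y o) ^+ 2) + 2 * a ^+ 2 * sigma ^+ 2.

Let psi_sqr_le o z : enorm (psi o z) ^+ 2 <=
  16 * Lf ^+ 2 * (enorm (x' o - x o) ^+ 2 + enorm (y' o - y o) ^+ 2)
  + 2 * a ^+ 2 * enorm (g (x' o) (y' o) - s z (x' o) (y' o)) ^+ 2.
Proof.
set N' := noise z (x' o) (y' o); set N := noise z (x o) (y o).
(* a difference of noises, small with the move, and a fraction [a] of a noise *)
have pE : psi o z = (1 - a) *: (N' - N) + a *: N'.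
  rewrite /psi -/N -/N'; move: N N' => w u.
  by apply/rowP => i; rewrite !mxE; ring.
have /andP[a0 a1] := a01.
rewrite pE; apply: (le_trans (sqr_enormD_le _ _)).
rewrite !enormZ !exprMn !real_normK ?num_real //.
have -> : enorm (g (x' o) (y' o) - s z (x' o) (y' o)) = enorm N' by rewrite enormC.
have nl := noise_lip z (Xx' o) (Xx o) (Yy' o) (Yy o); rewrite -/N -/N' in nl.
move: nl (enorm_ge0 (N' - N)) (enorm_ge0 (x' o - x o)) (enorm_ge0 (y' o - y o)).
set A := enorm (N' - N); set B := enorm (x' o - x o); set C := enorm (y' o - y o).
set M := enorm N' => nl A0 B0 C0.
have A2 : A ^+ 2 <= 8 * Lf ^+ 2 * (B ^+ 2 + C ^+ 2).
  apply: (@le_trans _ _ ((2 * Lf * (B + C)) ^+ 2)).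
    by rewrite ler_pXn2r // nnegrE (le_trans A0 nl).
  have := mulr_ge0 (sqr_ge0 Lf) (sqr_ge0 (B - C)); nra.
have : (1 - a) ^+ 2 * A ^+ 2 <= A ^+ 2.
  by rewrite ler_piMl ?sqr_ge0 // expr_le1 //; lra.
lra.
Qed.

Let psi_variance o : (\int[D]_z (enorm (psi o z) ^+ 2)%:E <= (H o)%:E)%E.
Proof.
set c := 16 * Lf ^+ 2 * (enorm (x' o - x o) ^+ 2 + enorm (y' o - y o) ^+ 2).
have c0 : 0 <= c.
  by rewrite mulr_ge0 ?addr_ge0 ?sqr_ge0 // mulr_ge0 // sqr_ge0.
have b0 : 0 <= 2 * a ^+ 2 by rewrite mulr_ge0 // sqr_ge0.
have mN : measurable_fun setT
    (fun z => enorm (g (x' o) (y' o) - s z (x' o) (y' o)) ^+ 2).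
  apply: measurable_enorm2; apply: measurable_vecB => i //.
  exact: (summable_measurable (so_unbiased so (Xx' o) (Yy' o) i).1).
have vN := so_variance so (Xx' o) (Yy' o).
have iN := summable_ge0 mN (fun z => sqr_ge0 _) vN.
apply: (@le_trans _ _ (\int[D]_z (c + 2 * a ^+ 2 *
   enorm (g (x' o) (y' o) - s z (x' o) (y' o)) ^+ 2)%:E)%E).
  apply: le_integral_pointwise => z; first by rewrite lee_fin sqr_ge0.
  by rewrite lee_fin; exact: psi_sqr_le.
rewrite expectE; last first.
  by apply: summableD; [exact: summable_cst|exact: summableZ].
rewrite lee_fin expectD ?expect_cst ?expectZ //; [|exact: summable_cst|exact: summableZ].
rewrite lerD2l ler_wpM2l // -lee_fin -expectE //.
Qed.

(** The recursive momentum cancels the noise of the previous iterate up to the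
    length of the move: only a fraction [a] of the fresh noise remains. *)
Lemma oracle_error_step :
  let e' o := (1 - a) *: e o + q%:R^-1 *: \sum_(i < q) psi o (xi i o) in
  summable_fun P (fun o => enorm (e' o) ^+ 2) /\
  expect P (fun o => enorm (e' o) ^+ 2) <=
    (1 - a) * expect P (fun o => enorm (e o) ^+ 2)
    + q%:R^-1 * (16 * Lf ^+ 2 * (expect P (fun o => enorm (x' o - x o) ^+ 2)
                                 + expect P (fun o => enorm (y' o - y o) ^+ 2))
                 + 2 * a ^+ 2 * sigma ^+ 2).
Proof.
have Hi : summable_fun P H.
  apply: summableD; last exact: summable_cst.
  by apply: summableZ; exact: summableD.
have mW : measurable_vec (fun o => (1 - a) *: e o) by exact: measurable_vecZ.
have WE (o : Om) : enorm ((1 - a) *: e o) ^+ 2 = (1 - a) ^+ 2 * enorm (e o) ^+ 2.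
  by rewrite enormZ exprMn real_normK ?num_real.
have Wi : summable_fun P (fun o => enorm ((1 - a) *: e o) ^+ 2).
  by apply: (eq_summable (fun o => esym (WE o))); exact: summableZ.
have [si le] := batch_second_moment sG Gm mxi batch_rule mW measurable_psi
  psi_centred psi_variance Hi Wi q_gt0.
split=> //; apply: (le_trans le).
have -> : expect P H = 16 * Lf ^+ 2 * (expect P (fun o => enorm (x' o - x o) ^+ 2)
     + expect P (fun o => enorm (y' o - y o) ^+ 2)) + 2 * a ^+ 2 * sigma ^+ 2.
  have S12 := summableD dxi dyi; have S := summableZ (16 * Lf ^+ 2) S12.
  rewrite /H (expectD S (summable_cst P _)) expect_cst.
  by rewrite (expectZ _ S12) (expectD dxi dyi).
rewrite lerD2r (eq_expect _ WE) expectZ //.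
have /andP[a0 a1] := a01.
apply: ler_wpM2r; first by apply: expect_ge0 => o; exact: sqr_ge0.
by rewrite expr2 ler_piMr ?subr_ge0 // gerBl.
Qed.

End ErrorStep.
End Oracle.

(** * The run of the algorithm *)

(** The error of the next estimator splits into the shrunken old error, known from
    the past, and the mean of the centred contributions of the fresh samples. *)
Lemma momentum_error (R : realType) n q (s s' : 'I_q -> 'rV[R]_n)
    (g g' v : 'rV[R]_n) (a : R) : (0 < q)%N ->
  q%:R^-1 *: (\sum_i s' i) + (1 - a) *: (v - q%:R^-1 *: (\sum_i s i)) - g' =
  (1 - a) *: (v - g)
    + q%:R^-1 *: \sum_i ((s' i - g') - (1 - a) *: (s i - g)).
Proof.
move=> q0; have qn0 : q%:R != 0 :> R by rewrite pnatr_eq0 -lt0n.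
have sub_mean (u : 'I_q -> 'rV[R]_n) (c : 'rV[R]_n) :
    q%:R^-1 *: (\sum_i (u i - c)) = q%:R^-1 *: (\sum_i u i) - c.
  rewrite sumrB sumr_const card_ord scalerBr -[c *+ q]scaler_nat scalerA mulVf //.
  by rewrite scale1r.
have -> : q%:R^-1 *: \sum_i ((s' i - g') - (1 - a) *: (s i - g)) =
    q%:R^-1 *: (\sum_i (s' i - g')) - (1 - a) *: (q%:R^-1 *: \sum_i (s i - g)).
  by rewrite sumrB scalerBr -scaler_sumr !scalerA mulrC.
rewrite !sub_mean.
move: (_ *: \sum_i s' i) (_ *: \sum_i s i) => u' u.
by apply/rowP => i; rewrite !mxE; ring.
Qed.

Section Run.
Context {R : realType} {d1 d2 : nat} {dXi dOm : measure_display}.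
Context {Xi : measurableType dXi} {Om : measurableType dOm}.
Variables (P : probability Om R) (D : probability Xi R).
Variables (f : 'rV[R]_d1 -> 'rV[R]_d2 -> Xi -> R).
Variables (X : set 'rV[R]_d1) (Y : set 'rV[R]_d2) (Lf mu sigma : R).
Hypotheses (Lf_gt0 : 0 < Lf) (mu_gt0 : 0 < mu).
Hypothesis ma : minimax_assumptions D f X Y Lf mu sigma.
Hypotheses (Xc : convex_set X) (Yc : convex_set Y).
Hypotheses (Y0 : Y !=set0) (Yk : compact Y).
Variables (q : nat) (gam lam : R) (eta alpha beta : nat -> R).
Variables (x1 : 'rV[R]_d1) (y1 : 'rV[R]_d2).
Hypotheses (q_gt0 : (0 < q)%N) (Xx1 : X x1) (Yy1 : Y y1).
Variable run : vr_adagda P D f X Y q gam lam eta alpha beta x1 y1.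
Hypothesis eta01 : forall t, (0 < t)%N -> 0 < eta t <= 1.
Hypothesis alpha01 : forall t, (0 < t)%N -> 0 <= alpha t.+1 <= 1.
Hypothesis beta01 : forall t, (0 < t)%N -> 0 <= beta t.+1 <= 1.

Local Notation gx := (gradx (fmean D f)).
Local Notation gy := (grady (fmean D f)).
Local Notation ys := (ystar D f Y).
Local Notation F := (Fmax D f Y).
Local Notation kappa := (Lf / mu).
Local Notation Fil := (vr_fil run).
Local Notation x := (vr_x run).
Local Notation y := (vr_y run).
Local Notation v := (vr_v run).
Local Notation w := (vr_w run).

Let regular := fmean_regular Lf_gt0 ma Xc Yc Y0 Yk.

Lemma oracle_x : stochastic_oracle D X Y Lf sigma (sgradx f) gx.
Proof.
split; [exact: (ma_unbiasedx ma)|exact: (ma_variancex ma)|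
  exact: (ma_lipxx ma)|exact: (ma_lipxy ma)].
Qed.

Lemma oracle_y : stochastic_oracle D X Y Lf sigma (sgrady f) gy.
Proof.
split; [exact: (ma_unbiasedy ma)|exact: (ma_variancey ma)|
  exact: (ma_lipyx ma)|exact: (ma_lipyy ma)].
Qed.

Lemma iterates_in t o : (0 < t)%N -> X (x t o) /\ Y (y t o).
Proof.
elim: t => // -[_ _|t IH _]; first by rewrite (vr_x1 run) (vr_y1 run).
have [//|Xx Yy] := IH; have /andP[e0 e1] := eta01 (ltn0Sn t).
have e01 : 0 <= eta t.+1 <= 1 by rewrite (ltW e0).
rewrite (vr_xS run) // (vr_yS run) //; split; apply: convex_segment => //.
  exact: (vr_xtS run o (ltn0Sn t)).1.
exact: (vr_ytS run o (ltn0Sn t)).1.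
Qed.

Definition sqr_dx t (o : Om) := enorm (vr_xt run t.+1 o - x t o) ^+ 2.
Definition sqr_dy t (o : Om) := enorm (vr_yt run t.+1 o - y t o) ^+ 2.
Definition sqr_ex t (o : Om) := enorm (v t o - gx (x t o) (y t o)) ^+ 2.
Definition sqr_ey t (o : Om) := enorm (w t o - gy (x t o) (y t o)) ^+ 2.
Definition sqr_track t (o : Om) := enorm (y t o - ys (x t o)) ^+ 2.

Let sF t : sigma_algebra setT (Fil t). Proof. by have [] := vr_filtration run. Qed.
Let Fm t : Fil t `<=` measurable. Proof. by have [] := vr_filtration run. Qed.

Local Notation OmF t := (g_sigma_algebraType (Fil t)).

Section Adapted.
Variable t : nat.
Hypothesis t_gt0 : (0 < t)%N.

Let adapted_vec m (Z : Om -> 'rV[R]_m) : mx_measurable_wrt (Fil t) Z ->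
  measurable_vec (Z : OmF t -> 'rV[R]_m).
Proof. by move=> mZ i; apply: measurable_wrt_sub; exact: mZ. Qed.

Lemma adapted_x : measurable_vec (x t : OmF t -> 'rV[R]_d1).
Proof. by apply: adapted_vec; case: (vr_adapted run t_gt0) => -[]. Qed.
Lemma adapted_y : measurable_vec (y t : OmF t -> 'rV[R]_d2).
Proof. by apply: adapted_vec; case: (vr_adapted run t_gt0) => -[]. Qed.
Lemma adapted_v : measurable_vec (v t : OmF t -> 'rV[R]_d1).
Proof. by apply: adapted_vec; case: (vr_adapted run t_gt0) => -[]. Qed.
Lemma adapted_w : measurable_vec (w t : OmF t -> 'rV[R]_d2).
Proof. by apply: adapted_vec; case: (vr_adapted run t_gt0) => -[]. Qed.
Lemma adapted_xt : measurable_vec (vr_xt run t.+1 : OmF t -> 'rV[R]_d1).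
Proof. by apply: adapted_vec; case: (vr_adapted run t_gt0) => _ []. Qed.
Lemma adapted_yt : measurable_vec (vr_yt run t.+1 : OmF t -> 'rV[R]_d2).
Proof. by apply: adapted_vec; case: (vr_adapted run t_gt0) => _ []. Qed.

Let Xx (o : OmF t) : X (x t o) := (iterates_in o t_gt0).1.
Let Yy (o : OmF t) : Y (y t o) := (iterates_in o t_gt0).2.

Let adapted_field n (s : Xi -> 'rV[R]_d1 -> 'rV[R]_d2 -> 'rV[R]_n) g :
  stochastic_oracle D X Y Lf sigma s g ->
  measurable_vec (fun o : OmF t => g (x t o) (y t o)).
Proof.
move=> so i.
apply: (@measurable_lipschitz _ _ (OmF t) _ _ (x t) (y t) X Y Lf
  (fun a b => g a b 0 i) adapted_x adapted_y Xx Yy) => a a' b b' Xa Xa' Yb Yb'.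
apply: le_trans (oracle_mean_lip so Xa Xa' Yb Yb').
by apply: le_trans (enorm_coord_le _ i); rewrite !mxE.
Qed.

Lemma adapted_errx :
  measurable_vec (fun o : OmF t => v t o - gx (x t o) (y t o)).
Proof. by apply: measurable_vecB; [exact: adapted_v|exact: adapted_field oracle_x]. Qed.

Lemma adapted_erry :
  measurable_vec (fun o : OmF t => w t o - gy (x t o) (y t o)).
Proof. by apply: measurable_vecB; [exact: adapted_w|exact: adapted_field oracle_y]. Qed.

Lemma adapted_sqr_dx : measurable_fun setT (sqr_dx t : OmF t -> R).
Proof.
by apply: measurable_enorm2; apply: measurable_vecB; [exact: adapted_xt|exact: adapted_x].
Qed.

Lemma adapted_sqr_dy : measurable_fun setT (sqr_dy t : OmF t -> R).
Proof.
by apply: measurable_enorm2; apply: measurable_vecB; [exact: adapted_yt|exact: adapted_y].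
Qed.

Lemma adapted_sqr_ex : measurable_fun setT (sqr_ex t : OmF t -> R).
Proof. by apply: measurable_enorm2; exact: adapted_errx. Qed.

Lemma adapted_sqr_track : measurable_fun setT (sqr_track t : OmF t -> R).
Proof.
apply: measurable_enorm2; apply: measurable_vecB; first exact: adapted_y.
move=> i.
apply: (@measurable_lipschitz _ _ (OmF t) _ _ (x t) (y t) X Y kappa
  (fun a _ => ys a 0 i) adapted_x adapted_y Xx Yy) => a a' b b' Xa Xa' _ _.
have k0 : 0 <= kappa by rewrite divr_ge0 // ltW.
apply: (@le_trans _ _ (enorm (ys a - ys a'))).
  by apply: le_trans (enorm_coord_le _ i); rewrite !mxE.
apply: (le_trans (ystar_lip Lf_gt0 mu_gt0 regular Xa Xa')).
by rewrite ler_wpM2l // lerDl enorm_ge0.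
Qed.

Lemma measurable_adapted (Z : OmF t -> R) :
  measurable_fun setT Z -> measurable_fun setT (Z : Om -> R).
Proof. exact: measurable_sub (sF t) (@Fm t) _ _ _. Qed.

End Adapted.

Section OneStep.
Variable t : nat.

Let mxi i : measurable_fun setT (vr_xi run t.+1 i).
Proof.
move=> _ S mS; rewrite setTI; apply: (@Fm t.+1).
exact: ((vr_batches run).1 t.+1 i (ltn0Sn t)).
Qed.

Let rule := (vr_batches run).2 t.

Hypothesis t_gt0 : (0 < t)%N.

Lemma move_x o : x t.+1 o - x t o = eta t *: (vr_xt run t.+1 o - x t o).
Proof. by rewrite (vr_xS run) // addrC addKr. Qed.

Lemma move_y o : y t.+1 o - y t o = eta t *: (vr_yt run t.+1 o - y t o).
Proof. by rewrite (vr_yS run) // addrC addKr. Qed.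

Let next_x : measurable_vec (x t.+1 : OmF t -> 'rV[R]_d1).
Proof.
have -> : (x t.+1 : OmF t -> 'rV[R]_d1) =
    (fun o => x t o + eta t *: (vr_xt run t.+1 o - x t o)).
  by apply/funext => o; exact: (vr_xS run).
apply: measurable_vecD; first exact: adapted_x.
by apply: measurable_vecZ; apply: measurable_vecB; [exact: adapted_xt|exact: adapted_x].
Qed.

Let next_y : measurable_vec (y t.+1 : OmF t -> 'rV[R]_d2).
Proof.
have -> : (y t.+1 : OmF t -> 'rV[R]_d2) =
    (fun o => y t o + eta t *: (vr_yt run t.+1 o - y t o)).
  by apply/funext => o; exact: (vr_yS run).
apply: measurable_vecD; first exact: adapted_y.
by apply: measurable_vecZ; apply: measurable_vecB; [exact: adapted_yt|exact: adapted_y].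
Qed.

Let Xx o : X (x t o) := (iterates_in o t_gt0).1.
Let Yy o : Y (y t o) := (iterates_in o t_gt0).2.
Let Xx' o : X (x t.+1 o) := (iterates_in o (ltn0Sn t)).1.
Let Yy' o : Y (y t.+1 o) := (iterates_in o (ltn0Sn t)).2.

Hypotheses (dxi : summable_fun P (sqr_dx t)) (dyi : summable_fun P (sqr_dy t)).

Let mvx o : enorm (x t.+1 o - x t o) ^+ 2 = eta t ^+ 2 * sqr_dx t o.
Proof. by rewrite move_x enormZ exprMn real_normK ?num_real. Qed.

Let mvy o : enorm (y t.+1 o - y t o) ^+ 2 = eta t ^+ 2 * sqr_dy t o.
Proof. by rewrite move_y enormZ exprMn real_normK ?num_real. Qed.

Let mvxi : summable_fun P (fun o => enorm (x t.+1 o - x t o) ^+ 2).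
Proof. by apply: (eq_summable (fun o => esym (mvx o))); exact: summableZ. Qed.

Let mvyi : summable_fun P (fun o => enorm (y t.+1 o - y t o) ^+ 2).
Proof. by apply: (eq_summable (fun o => esym (mvy o))); exact: summableZ. Qed.

Let Emv : expect P (fun o => enorm (x t.+1 o - x t o) ^+ 2)
    + expect P (fun o => enorm (y t.+1 o - y t o) ^+ 2) =
  eta t ^+ 2 * (expect P (sqr_dx t) + expect P (sqr_dy t)).
Proof. by rewrite (eq_expect P mvx) (eq_expect P mvy) !expectZ // mulrDr. Qed.

Lemma momentum_step n (s : Xi -> 'rV[R]_d1 -> 'rV[R]_d2 -> 'rV[R]_n) g
    (u u' : Om -> 'rV[R]_n) (a : R) : stochastic_oracle D X Y Lf sigma s g ->
  measurable_vec (fun o : OmF t => u o - g (x t o) (y t o)) -> 0 <= a <= 1 ->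
  (forall o, u' o = q%:R^-1 *: (\sum_i s (vr_xi run t.+1 i o) (x t.+1 o) (y t.+1 o))
     + (1 - a) *: (u o - q%:R^-1 *: (\sum_i s (vr_xi run t.+1 i o) (x t o) (y t o)))) ->
  summable_fun P (fun o => enorm (u o - g (x t o) (y t o)) ^+ 2) ->
  summable_fun P (fun o => enorm (u' o - g (x t.+1 o) (y t.+1 o)) ^+ 2) /\
  expect P (fun o => enorm (u' o - g (x t.+1 o) (y t.+1 o)) ^+ 2) <=
    (1 - a) * expect P (fun o => enorm (u o - g (x t o) (y t o)) ^+ 2)
    + q%:R^-1 * (16 * Lf ^+ 2 * (eta t ^+ 2 * (expect P (sqr_dx t) + expect P (sqr_dy t)))
                 + 2 * a ^+ 2 * sigma ^+ 2).
Proof.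
move=> so mu_ a01 uS ui.
have [H1 H2] := oracle_error_step so q_gt0 (sF t) (@Fm t) mxi rule
  (adapted_x t_gt0) next_x (adapted_y t_gt0) next_y mu_ Xx Xx' Yy Yy' a01 ui mvxi mvyi.
rewrite Emv in H2.
have E o : enorm (u' o - g (x t.+1 o) (y t.+1 o)) ^+ 2 =
    enorm ((1 - a) *: (u o - g (x t o) (y t o)) + q%:R^-1 *: (\sum_i
      (noise s g (vr_xi run t.+1 i o) (x t.+1 o) (y t.+1 o)
       - (1 - a) *: noise s g (vr_xi run t.+1 i o) (x t o) (y t o)))) ^+ 2.
  by rewrite uS (momentum_error _ _ (g (x t o) (y t o))).
by split; [exact: eq_summable (fun o => esym (E o)) H1|rewrite (eq_expect P E)].
Qed.

Lemma errx_step : summable_fun P (sqr_ex t) ->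
  summable_fun P (sqr_ex t.+1) /\
  expect P (sqr_ex t.+1) <= (1 - alpha t.+1) * expect P (sqr_ex t)
    + q%:R^-1 * (16 * Lf ^+ 2 * (eta t ^+ 2 * (expect P (sqr_dx t) + expect P (sqr_dy t)))
                 + 2 * alpha t.+1 ^+ 2 * sigma ^+ 2).
Proof.
exact: (momentum_step oracle_x (adapted_errx t_gt0) (alpha01 t_gt0)
  (fun o => vr_vS run o t_gt0)).
Qed.

Lemma erry_step : summable_fun P (sqr_ey t) ->
  summable_fun P (sqr_ey t.+1) /\
  expect P (sqr_ey t.+1) <= (1 - beta t.+1) * expect P (sqr_ey t)
    + q%:R^-1 * (16 * Lf ^+ 2 * (eta t ^+ 2 * (expect P (sqr_dx t) + expect P (sqr_dy t)))
                 + 2 * beta t.+1 ^+ 2 * sigma ^+ 2).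
Proof.
exact: (momentum_step oracle_y (adapted_erry t_gt0) (beta01 t_gt0)
  (fun o => vr_wS run o t_gt0)).
Qed.

End OneStep.

Section Start.

Let mxi1 i : measurable_fun setT (vr_xi run 1 i).
Proof.
move=> _ S mS; rewrite setTI; apply: (@Fm 1).
exact: ((vr_batches run).1 1 i (ltn0Sn 0)).
Qed.

(** The first estimator is a momentum step with [a = 1] and zero previous error. *)
Lemma momentum_start n (s : Xi -> 'rV[R]_d1 -> 'rV[R]_d2 -> 'rV[R]_n) g
    (u : Om -> 'rV[R]_n) : stochastic_oracle D X Y Lf sigma s g ->
  (forall o, u o = q%:R^-1 *: (\sum_i s (vr_xi run 1 i o) x1 y1)) ->
  summable_fun P (fun o => enorm (u o - g (x 1 o) (y 1 o)) ^+ 2) /\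
  expect P (fun o => enorm (u o - g (x 1 o) (y 1 o)) ^+ 2) <= 2 * sigma ^+ 2 / q%:R.
Proof.
move=> so uE.
have mcst m (c : 'rV[R]_m) : measurable_vec (fun _ : OmF 0 => c).
  by move=> i; exact: measurable_cst.
have s0 m (c : 'rV[R]_m) : summable_fun P (fun=> enorm (c - c) ^+ 2).
  exact: summable_cst.
have e0 : summable_fun P (fun=> enorm (0 : 'rV[R]_n) ^+ 2) by exact: summable_cst.
have a1 : 0 <= (1 : R) <= 1 by rewrite ler01 lexx.
have [H1 H2] := oracle_error_step so q_gt0 (sF 0) (@Fm 0) mxi1 ((vr_batches run).2 0)
  (mcst _ x1) (mcst _ x1) (mcst _ y1) (mcst _ y1) (mcst _ 0)
  (fun=> Xx1) (fun=> Xx1) (fun=> Yy1) (fun=> Yy1) a1 e0 (s0 _ x1) (s0 _ y1).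
have E o : enorm (u o - g (x 1 o) (y 1 o)) ^+ 2 =
    enorm ((1 - 1) *: (0 : 'rV[R]_n) + q%:R^-1 *: (\sum_i
      (noise s g (vr_xi run 1 i o) x1 y1
       - (1 - 1) *: noise s g (vr_xi run 1 i o) x1 y1))) ^+ 2.
  have H := momentum_error (fun i => s (vr_xi run 1 i o) x1 y1)
    (fun i => s (vr_xi run 1 i o) x1 y1) (g x1 y1) (g x1 y1) (g x1 y1) 1 q_gt0.
  rewrite /noise -[X in _ *: X + _](subrr (g x1 y1)) -H.
  by rewrite uE (vr_x1 run) (vr_y1 run) subrr scale0r addr0.
have c0 m (c : 'rV[R]_m) : expect P (fun=> enorm (c - c) ^+ 2) = 0.
  by rewrite expect_cst subrr enorm0 expr0n.
rewrite (c0 _ x1) (c0 _ y1) in H2.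
split; first exact: eq_summable (fun o => esym (E o)) H1.
rewrite (eq_expect P E); apply: (le_trans H2).
by rewrite expr1n subrr mul0r add0r addr0 mulr0 add0r mulr1 mulrC.
Qed.

Lemma errx_start : summable_fun P (sqr_ex 1) /\
  expect P (sqr_ex 1) <= 2 * sigma ^+ 2 / q%:R.
Proof. exact: (momentum_start oracle_x (vr_v1 run)). Qed.

Lemma erry_start : summable_fun P (sqr_ey 1) /\
  expect P (sqr_ey 1) <= 2 * sigma ^+ 2 / q%:R.
Proof. exact: (momentum_start oracle_y (vr_w1 run)). Qed.

End Start.

Section Lyapunov.
Variables (rho b bhat Kc : R) (bt : nat -> Om -> R).
Hypotheses (rho_gt0 : 0 < rho) (gam_gt0 : 0 < gam) (lam_gt0 : 0 < lam).
Hypotheses (b_gt0 : 0 < b) (b_le_bhat : b <= bhat).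
Hypothesis gam_smooth : 4 * gam * (Lf * (1 + kappa)) <= rho.
Hypothesis tau_smooth : 6 * Lf * (lam / b) <= 1.
Hypothesis tau_mu : 1 + mu * (lam / b) <= Kc.
Hypothesis gam_small : 256 * Kc * Lf ^+ 2 * kappa ^+ 2 * gam ^+ 2 <=
  rho ^+ 2 * (lam / bhat) ^+ 2 * mu ^+ 2.
Hypothesis A_sym : forall t o, (0 < t)%N -> sym_lambda_min_ge rho (vr_A run t o).
Hypothesis B_scalar : forall t o, (0 < t)%N -> vr_B run t o = (bt t o)%:M.
Hypothesis bt_bounds : forall t o, (0 < t)%N -> b <= bt t o <= bhat.
Hypothesis F_bounded : has_lbound [set F x | x in X].

Definition weight_dx := rho ^+ 2 / (4 * gam ^+ 2).
Definition weight_dy := tracking_weight Lf mu lam bhat / 6.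
Definition weight_ey := 32 * Kc ^+ 2 * Lf ^+ 2 * (bhat / b) / mu ^+ 2.
Definition initial_gap := rho / gam * (F x1 - Fstar D f X Y)
  + tracking_weight Lf mu lam bhat * enorm (y1 - ys x1) ^+ 2.

Definition progress t o :=
  weight_dx * sqr_dx t o + 2 * Lf ^+ 2 * sqr_track t o + weight_dy * sqr_dy t o.
Definition estimation_cost t o := 2 * sqr_ex t o + weight_ey * sqr_ey t o.

Let bhat_gt0 : 0 < bhat. Proof. exact: lt_le_trans b_le_bhat. Qed.

Lemma tracking_weight_gt0 : 0 < tracking_weight Lf mu lam bhat.
Proof.
apply: divr_gt0; first by rewrite mulr_gt0 // exprn_gt0.
by apply: mulr_gt0 => //; exact: divr_gt0.
Qed.

Let weight_dx_gt0 : 0 < weight_dx.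
Proof. by apply: divr_gt0; [|apply: mulr_gt0 => //]; exact: exprn_gt0. Qed.

Let weight_dy_gt0 : 0 < weight_dy.
Proof. by apply: divr_gt0 => //; exact: tracking_weight_gt0. Qed.

Let pot t o := potential Lf mu ys F rho gam lam bhat (x t o) (y t o).

Lemma potential_run_step t o : (0 < t)%N ->
  pot t.+1 o + eta t * progress t o <= pot t o + eta t * estimation_cost t o.
Proof.
move=> t0; rewrite /pot (vr_xS run) // (vr_yS run) //.
have [Xx Yy] := iterates_in o t0.
have yt := vr_ytS run o t0; rewrite B_scalar // in yt.
exact: (potential_step Lf_gt0 mu_gt0 regular rho_gt0 gam_gt0 lam_gt0 b_gt0 b_le_bhat
  gam_smooth tau_smooth tau_mu gam_small (bt_bounds o t0) (eta01 t0) Xx Yy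
  (A_sym o t0) (vr_xtS run o t0) yt).
Qed.

Let add_step (a b' c s p u z : R) :
  a + p <= b' + z -> b' + s <= c + u -> a + (s + p) <= c + (u + z).
Proof. lra. Qed.

Let gap_step (l p a u s c : R) :
  l <= p -> p + s <= a + u + c -> s <= a - l + u + c.
Proof. lra. Qed.

(** Telescoping of [potential_step]; the last potential is bounded below by the
    infimum of [F]. *)
Lemma progress_sum T o :
  \sum_(1 <= t < T.+1) eta t * progress t o <=
    initial_gap + \sum_(1 <= t < T.+1) eta t * estimation_cost t o.
Proof.
have tel : pot T.+1 o + \sum_(1 <= t < T.+1) eta t * progress t o <=
    pot 1 o + \sum_(1 <= t < T.+1) eta t * estimation_cost t o.
  elim: T => [|T IH]; first by rewrite !big_geq.
  rewrite !(big_nat_recr T.+1) //=.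
  exact: add_step (potential_run_step o (ltn0Sn T)) IH.
have [Xx Yy] := iterates_in o (ltn0Sn T).
have pT : rho / gam * Fstar D f X Y <= pot T.+1 o.
  apply: (@le_trans _ _ (rho / gam * F (x T.+1 o))).
    rewrite ler_pM2l ?divr_gt0 //; apply: ge_inf => //.
    by exists (x T.+1 o).
  by rewrite lerDl mulr_ge0 ?sqr_ge0 // ltW // tracking_weight_gt0.
have p1 : pot 1 o = rho / gam * F x1 +
    tracking_weight Lf mu lam bhat * enorm (y1 - ys x1) ^+ 2.
  by rewrite /pot (vr_x1 run) (vr_y1 run).
rewrite p1 in tel; rewrite /initial_gap mulrBr; exact: gap_step pT tel.
Qed.

Let progress_ge0 t o : 0 <= progress t o.
Proof.
rewrite /progress; apply: addr_ge0; last first.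
  by apply: mulr_ge0; [exact: ltW|exact: sqr_ge0].
apply: addr_ge0; first by apply: mulr_ge0; [exact: ltW|exact: sqr_ge0].
apply: mulr_ge0; last exact: sqr_ge0.
by apply: mulr_ge0 => //; exact: sqr_ge0.
Qed.

(** Nothing says a priori that the moves have finite second moments.  By induction,
    the estimation errors up to time [t] do, and they dominate the moves at time
    [t] pathwise. *)
Lemma run_summable t : (0 < t)%N ->
  [/\ summable_fun P (sqr_dx t), summable_fun P (sqr_dy t),
      summable_fun P (sqr_track t), summable_fun P (sqr_ex t)
    & summable_fun P (sqr_ey t)].
Proof.
elim/ltn_ind: t => t IH t0.
have [exi eyi] : summable_fun P (sqr_ex t) /\ summable_fun P (sqr_ey t).
  case: t t0 IH => // -[_ _|t _ IH]; first by split; [exact: errx_start.1|exact: erry_start.1].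
  have [dxi dyi _ exi eyi] := IH t.+1 (ltnSn _) (ltn0Sn t).
  by split; [exact: (errx_step (ltn0Sn t) dxi dyi exi).1|
             exact: (erry_step (ltn0Sn t) dxi dyi eyi).1].
have /andP[et0 _] := eta01 t0.
have costi s : (1 <= s < t.+1)%N -> summable_fun P (estimation_cost s).
  move=> /andP[s0]; rewrite ltnS leq_eqVlt => /predU1P[->|st].
    by apply: summableD; exact: summableZ.
  by have [_ _ _ exs eys] := IH s st s0; apply: summableD; exact: summableZ.
pose B o := (eta t)^-1 * (initial_gap + \sum_(1 <= s < t.+1) eta s * estimation_cost s o).
have Bi : summable_fun P B.
  apply: summableZ; apply: summableD; first exact: summable_cst.
  rewrite (_ : (fun o => _) = fun o =>
     \sum_(1 <= s < t.+1 | (1 <= s < t.+1)%N) eta s * estimation_cost s o).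
    by apply: summable_sum => s st; apply: summableZ; exact: costi.
  by apply/funext => o; rewrite big_nat.
have pB o : progress t o <= B o.
  rewrite /B -(ler_pM2l et0) mulVKf ?gt_eqF //; apply: le_trans (progress_sum t o).
  rewrite big_nat_recr //= lerDr big_nat; apply: sumr_ge0 => s /andP[s0 _].
  by apply: mulr_ge0; [case/andP: (eta01 s0) => /ltW|exact: progress_ge0].
have bound (c : R) (Z : Om -> R) : 0 < c -> measurable_fun setT Z ->
    (forall o, 0 <= Z o) -> (forall o, c * Z o <= progress t o) -> summable_fun P Z.
  move=> c0 mZ Z0 cZ; apply: (summable_le mZ (summableZ c^-1 Bi)) => o.
  rewrite ger0_norm // -(ler_pM2l c0) mulVKf ?gt_eqF //.
  exact: le_trans (pB o).
have dx0 o : 0 <= weight_dx * sqr_dx t o by rewrite mulr_ge0 ?sqr_ge0 // ltW.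
have dy0 o : 0 <= weight_dy * sqr_dy t o by rewrite mulr_ge0 ?sqr_ge0 // ltW.
have L2 : 0 < 2 * Lf ^+ 2 by rewrite mulr_gt0 // exprn_gt0.
have dl0 o : 0 <= 2 * Lf ^+ 2 * sqr_track t o by rewrite mulr_ge0 ?sqr_ge0 // ltW.
split=> //.
- apply: (bound weight_dx) => //; last by move=> o; rewrite /progress -addrA lerDl addr_ge0.
    exact: measurable_adapted (adapted_sqr_dx t0).
  by move=> o; exact: sqr_ge0.
- apply: (bound weight_dy) => //; last by move=> o; rewrite /progress lerDr addr_ge0.
    exact: measurable_adapted (adapted_sqr_dy t0).
  by move=> o; exact: sqr_ge0.
- apply: (bound (2 * Lf ^+ 2)) => //;
    last by move=> o; rewrite /progress addrAC lerDr addr_ge0.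
    exact: measurable_adapted (adapted_sqr_track t0).
  by move=> o; exact: sqr_ge0.
Qed.

Lemma progress_sum_expect T :
  \sum_(1 <= t < T.+1) eta t *
     (weight_dx * expect P (sqr_dx t) + 2 * Lf ^+ 2 * expect P (sqr_track t)
      + weight_dy * expect P (sqr_dy t)) <=
  initial_gap + \sum_(1 <= t < T.+1) eta t *
     (2 * expect P (sqr_ex t) + weight_ey * expect P (sqr_ey t)).
Proof.
(* the terms are summable only for positive times *)
pose clip (Z : nat -> Om -> R) t : Om -> R := if (0 < t)%N then Z t else fun=> 0.
have sum_clip (Z : nat -> Om -> R) (E : nat -> R) :
    (forall t, (0 < t)%N -> summable_fun P (Z t) /\ expect P (Z t) = E t) ->
    summable_fun P (fun o => \sum_(1 <= t < T.+1) Z t o) /\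
    expect P (fun o => \sum_(1 <= t < T.+1) Z t o) = \sum_(1 <= t < T.+1) E t.
  move=> ZE.
  have cE o : \sum_(1 <= t < T.+1) clip Z t o = \sum_(1 <= t < T.+1) Z t o.
    by apply: eq_big_nat => t /andP[t0 _]; rewrite /clip t0.
  have ci t : summable_fun P (clip Z t).
    by rewrite /clip; case: ifP => [/ZE[]//|_]; exact: summable_cst.
  split; first by apply: (eq_summable cE); exact: summable_sum.
  rewrite -(eq_expect P cE) expect_sum //; apply: eq_big_nat => t /andP[t0 _].
  by rewrite /clip t0; exact: (ZE t t0).2.
have [|pi pE] := sum_clip (fun t o => eta t * progress t o) (fun t => eta t *
     (weight_dx * expect P (sqr_dx t) + 2 * Lf ^+ 2 * expect P (sqr_track t)
      + weight_dy * expect P (sqr_dy t))).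
  move=> t t0; have [dxi dyi dli _ _] := run_summable t0.
  have i1 := summableZ weight_dx dxi; have i2 := summableZ (2 * Lf ^+ 2) dli.
  have i3 := summableZ weight_dy dyi; have i12 := summableD i1 i2.
  split; first by apply: summableZ; exact: summableD i12 i3.
  rewrite expectZ; last exact: summableD i12 i3.
  by rewrite (expectD i12 i3) (expectD i1 i2) !expectZ.
have [|ci cE] := sum_clip (fun t o => eta t * estimation_cost t o) (fun t => eta t *
     (2 * expect P (sqr_ex t) + weight_ey * expect P (sqr_ey t))).
  move=> t t0; have [_ _ _ exi eyi] := run_summable t0.
  have i1 := summableZ 2 exi; have i2 := summableZ weight_ey eyi.
  split; first by apply: summableZ; exact: summableD i1 i2.
  by rewrite expectZ ?(expectD i1 i2) ?expectZ //; exact: summableD i1 i2.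
have gi := summable_cst P initial_gap.
have gE := expectD gi ci; rewrite expect_cst in gE.
have H := expect_le pi (summableD gi ci) (progress_sum T).
by rewrite pE gE cE in H.
Qed.

End Lyapunov.

End Run.

(** * Step sizes and weighted sums *)

Section StepSize.
Context {R : realType}.
Variable m : R.
Hypothesis m_ge1 : 1 <= m.

(** The inverse of the step size [1 / (m + t)^(1/3)]. *)
Definition cbrt_shift (t : nat) : R := (m + t%:R) `^ (3^-1).

Let mt_ge1 (t : nat) : 1 <= m + t%:R.
Proof. by apply: (le_trans m_ge1); rewrite lerDl. Qed.

Lemma cbrt_shift_cube t : cbrt_shift t ^+ 3 = m + t%:R.
Proof.
rewrite /cbrt_shift -powR_mulrn ?powR_ge0 // -powRrM mulVf ?powRr1 //.
by have := mt_ge1 t; lra.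
Qed.

Lemma cbrt_shift_ge1 t : 1 <= cbrt_shift t.
Proof.
rewrite -(ler_pXn2r (n := 3)) // ?nnegrE ?powR_ge0 // expr1n cbrt_shift_cube.
exact: mt_ge1.
Qed.

Lemma cbrt_shift_le s t : (s <= t)%N -> cbrt_shift s <= cbrt_shift t.
Proof.
move=> st; rewrite -(ler_pXn2r (n := 3)) // ?nnegrE ?powR_ge0 //.
by rewrite !cbrt_shift_cube lerD2l ler_nat.
Qed.

(** With [a] and [b] the cube roots of consecutive integers shifted by [m],
    [(a - b) (a^2 + a b + b^2) = 1] and the second factor is at least
    [3 a]. *)
Lemma cbrt_shift_step t :
  cbrt_shift t.+1 <= cbrt_shift t + 2 / 3 / cbrt_shift t.+1.
Proof.
have a1 := cbrt_shift_ge1 t.+1; have b1 := cbrt_shift_ge1 t.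
have := cbrt_shift_cube t.+1; have := cbrt_shift_cube t.
have := cbrt_shift_le (leqnSn t); rewrite -natr1.
move: (cbrt_shift t.+1) (cbrt_shift t) (t%:R : R) a1 b1 => a b t' a1 b1 ba b3 a3.
have a0 : 0 < a by lra.
rewrite -lerBlDl ler_pdivlMr //.
have E : (a - b) * (a ^+ 2 + a * b + b ^+ 2) = 1.
  have -> : (a - b) * (a ^+ 2 + a * b + b ^+ 2) = a ^+ 3 - b ^+ 3 by ring.
  by rewrite a3 b3; ring.
have d0 : 0 <= a - b by lra.
have : 3 * a <= a ^+ 2 + a * b + b ^+ 2.
  have := sqr_ge0 (a - 1); have : a <= a * b by rewrite ler_peMr // ltW.
  have : 1 <= b ^+ 2 by rewrite expr_ge1 //; lra.
  lra.
move=> h; have := ler_wpM2l d0 h; rewrite E; lra.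
Qed.

Lemma harmonic_le_ln (T : nat) :
  \sum_(1 <= t < T.+1) (cbrt_shift t ^+ 3)^-1 <= ln (1 + T%:R).
Proof.
elim: T => [|T IH]; first by rewrite big_geq // addr0 ln1.
rewrite big_nat_recr //= cbrt_shift_cube -natr1.
move: IH; move: (T%:R : R) (ler0n R T) (bigop _ _ _) => T' T0 S.
have p1 : 0 < 1 + (T' + 1) :> R by lra.
have p0 : 0 < m + (T' + 1) by have := m_ge1; lra.
have i1 : (m + (T' + 1))^-1 <= (1 + (T' + 1))^-1.
  by rewrite lef_pV2 // lerD2r.
have p2 : 0 < 1 + T' :> R by lra.
have : ln (1 + T') - ln (1 + (T' + 1)) <= - (1 + (T' + 1))^-1.
  rewrite -ln_div ?posrE //.
  have -> : (1 + T') / (1 + (T' + 1)) = 1 + (- (1 + (T' + 1))^-1) :> R.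
    by field; rewrite gt_eqF.
  apply: le_ln1Dx.
  by rewrite ltrN2 invf_lt1 //; lra.
move=> h1 h2; lra.
Qed.

End StepSize.

Section MomentumSum.
Context {R : realType}.
Variables (dx dy dl ex ey h : nat -> R).
Variables (wx wy we wl C0 W c c' Lf sigma q : R).
Hypotheses (q_gt0 : 0 < q) (W_gt0 : 0 < W) (wl_ge0 : 0 <= wl).
Hypotheses (dx0 : forall t, 0 <= dx t) (dy0 : forall t, 0 <= dy t).
Hypotheses (dl0 : forall t, 0 <= dl t).
Hypotheses (ex0 : forall t, 0 <= ex t) (ey0 : forall t, 0 <= ey t).
Hypothesis h_gt0 : forall t, 0 < h t.
Hypothesis h_step : forall t, h t.+1 <= h t + 2 / 3 / h t.+1.
Hypothesis progress : forall T,
  \sum_(1 <= t < T.+1) (h t)^-1 * (wx * dx t + wl * dl t + wy * dy t) <=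
  C0 + \sum_(1 <= t < T.+1) (h t)^-1 * (2 * ex t + we * ey t).
Hypothesis ex_step : forall t, (0 < t)%N ->
  ex t.+1 <= (1 - c * (h t)^-1 ^+ 2) * ex t
    + q^-1 * (16 * Lf ^+ 2 * ((h t)^-1 ^+ 2 * (dx t + dy t))
              + 2 * (c * (h t)^-1 ^+ 2) ^+ 2 * sigma ^+ 2).
Hypothesis ey_step : forall t, (0 < t)%N ->
  ey t.+1 <= (1 - c * (h t)^-1 ^+ 2) * ey t
    + q^-1 * (16 * Lf ^+ 2 * ((h t)^-1 ^+ 2 * (dx t + dy t))
              + 2 * (c * (h t)^-1 ^+ 2) ^+ 2 * sigma ^+ 2).
Hypotheses (ex_start : ex 1 <= 2 * sigma ^+ 2 / q).
Hypotheses (ey_start : ey 1 <= 2 * sigma ^+ 2 / q).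
Hypothesis c_def : c = 2 / 3 + c'.
Hypotheses (Wc3 : 3 <= W * c') (Wce : we <= W * c').
Hypotheses (Wy : 32 * W * Lf ^+ 2 / q <= wy) (Wx : 32 * W * Lf ^+ 2 / q <= wx / 2).

(** Dividing the estimation errors by the previous step size turns the momentum
    recursion into a telescoping inequality: the growth of the inverse step
    size, at most [2/3] of the step size, is covered by the part [2/3] of [c]. *)
Lemma momentum_drift t : (0 < t)%N ->
  h t * (ex t.+1 + ey t.+1) + c' * ((h t)^-1 * (ex t + ey t)) <=
  h t.-1 * (ex t + ey t) + 32 * Lf ^+ 2 / q * ((h t)^-1 * (dx t + dy t))
  + 4 * c ^+ 2 * sigma ^+ 2 / q * (h t ^+ 3)^-1.
Proof.
case: t => // t _; have a0 := h_gt0 t.+1; have st := h_step t.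
have hx := ler_wpM2l (ltW a0) (ex_step (ltn0Sn t)).
have hy := ler_wpM2l (ltW a0) (ey_step (ltn0Sn t)).
have e0 : 0 <= ex t.+1 + ey t.+1 by rewrite addr_ge0.
move: hx hy e0 st; rewrite /= c_def.
move: (ex t.+1) (ey t.+1) (dx t.+1) (dy t.+1) (ex t.+2) (ey t.+2) (h t).
move: (h t.+1) a0 => a a0 e u X Y e' u' b hx hy e0 st.
have E z : a * ((1 - (2 / 3 + c') * a^-1 ^+ 2) * z +
    q^-1 * (16 * Lf ^+ 2 * (a^-1 ^+ 2 * (X + Y)) +
    2 * ((2 / 3 + c') * a^-1 ^+ 2) ^+ 2 * sigma ^+ 2)) =
  (a - 2 / 3 / a) * z - c' * (a^-1 * z) + 16 * Lf ^+ 2 / q * (a^-1 * (X + Y))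
  + 2 * (2 / 3 + c') ^+ 2 * sigma ^+ 2 / q * (a ^+ 3)^-1.
  by field; rewrite !gt_eqF.
rewrite !E in hx hy.
have := ler_wpM2r e0 st; move: (a^-1 * (X + Y)) (a ^+ 3)^-1 hx hy => p r hx hy h1.
rewrite !mulrDr.
move: hx hy h1; move: (2 / 3 / a) (c' * (a^-1 * e)) (c' * (a^-1 * u)) => k i j.
move: (a * e') (a * u') => A B.
have -> : 16 * Lf ^+ 2 / q * p = 16 * (Lf ^+ 2 / q * p) by ring.
have -> : 32 * Lf ^+ 2 / q * p = 32 * (Lf ^+ 2 / q * p) by ring.
move: (Lf ^+ 2 / q * p) => l.
have -> : 2 * (2 / 3 + c') ^+ 2 * sigma ^+ 2 / q * r =
  2 * ((2 / 3 + c') ^+ 2 * sigma ^+ 2 / q * r) by ring.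
have -> : 4 * (2 / 3 + c') ^+ 2 * sigma ^+ 2 / q * r =
  4 * ((2 / 3 + c') ^+ 2 * sigma ^+ 2 / q * r) by ring.
move: (_ / q * r) => s; lra.
Qed.

(** The estimation errors on the right of [progress] are paid by the drift of
    [momentum_drift] with weight [W], and the moves that feed the drift are paid by
    half of the progress. *)
Lemma momentum_sum T :
  \sum_(1 <= t < T.+1) (h t)^-1 * (wx / 2 * dx t + wl * dl t + ex t) <=
  C0 + W * (4 * sigma ^+ 2 / q) * h 0
  + W * (4 * c ^+ 2 * sigma ^+ 2 / q) * \sum_(1 <= t < T.+1) (h t ^+ 3)^-1.
Proof.
have tel : h T * (ex T.+1 + ey T.+1)
    + \sum_(1 <= t < T.+1) c' * ((h t)^-1 * (ex t + ey t)) <=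
    h 0 * (ex 1 + ey 1)
    + \sum_(1 <= t < T.+1) (32 * Lf ^+ 2 / q * ((h t)^-1 * (dx t + dy t))
                            + 4 * c ^+ 2 * sigma ^+ 2 / q * (h t ^+ 3)^-1).
  elim: T => [|T IH]; first by rewrite !big_geq // !addr0.
  rewrite !(big_nat_recr T.+1) //=; have := momentum_drift (ltn0Sn T); rewrite /=.
  move: IH; move: (\sum_(1 <= t < T.+1) _) (\sum_(1 <= t < T.+1) _) => S1 S2.
  lra.
have s0 : 0 <= h T * (ex T.+1 + ey T.+1) by rewrite mulr_ge0 ?addr_ge0 // ltW.
have h00 : h 0 * (ex 1 + ey 1) <= h 0 * (4 * sigma ^+ 2 / q).
  by rewrite ler_pM2l //; have := ex_start; have := ey_start; lra.
have {tel s0 h00}tel :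
    \sum_(1 <= t < T.+1) W * (c' * ((h t)^-1 * (ex t + ey t))) <=
    W * (4 * sigma ^+ 2 / q) * h 0
    + \sum_(1 <= t < T.+1) W * (32 * Lf ^+ 2 / q * ((h t)^-1 * (dx t + dy t)))
    + W * (4 * c ^+ 2 * sigma ^+ 2 / q) * \sum_(1 <= t < T.+1) (h t ^+ 3)^-1.
  rewrite -!mulr_sumr in tel *; rewrite big_split /= -!mulr_sumr in tel.
  have : W * (c' * \sum_(1 <= t < T.+1) (h t)^-1 * (ex t + ey t)) <=
    W * (h 0 * (4 * sigma ^+ 2 / q) + (32 * Lf ^+ 2 / q *
      (\sum_(1 <= t < T.+1) (h t)^-1 * (dx t + dy t)) +
      4 * c ^+ 2 * sigma ^+ 2 / q * \sum_(1 <= t < T.+1) (h t ^+ 3)^-1)).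
    rewrite ler_pM2l //; lra.
  move: (\sum_(1 <= t < T.+1) _) (\sum_(1 <= t < T.+1) _) (\sum_(1 <= t < T.+1) _).
  by move=> S1 S2 S3 H; apply: (le_trans H); rewrite le_eqVlt; apply/orP; left;
    apply/eqP; ring.
have key : \sum_(1 <= t < T.+1) (h t)^-1 * (wx / 2 * dx t + wl * dl t + ex t) +
    \sum_(1 <= t < T.+1) (h t)^-1 * (2 * ex t + we * ey t) +
    \sum_(1 <= t < T.+1) W * (32 * Lf ^+ 2 / q * ((h t)^-1 * (dx t + dy t))) <=
    \sum_(1 <= t < T.+1) (h t)^-1 * (wx * dx t + wl * dl t + wy * dy t) +
    \sum_(1 <= t < T.+1) W * (c' * ((h t)^-1 * (ex t + ey t))).
  rewrite -!big_split /=; apply: ler_sum_nat => t _.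
  have i0 : 0 <= (h t)^-1 by rewrite invr_ge0 ltW.
  have -> : W * (32 * Lf ^+ 2 / q * ((h t)^-1 * (dx t + dy t))) =
    (h t)^-1 * (32 * W * Lf ^+ 2 / q * (dx t + dy t)) by ring.
  have -> : W * (c' * ((h t)^-1 * (ex t + ey t))) =
    (h t)^-1 * (W * c' * (ex t + ey t)) by ring.
  rewrite -!mulrDr ler_wpM2l //.
  have := ler_wpM2r (dx0 t) Wx; have := ler_wpM2r (dy0 t) Wy.
  have := ler_wpM2r (ex0 t) Wc3; have := ler_wpM2r (ey0 t) Wce.
  move: (32 * W * Lf ^+ 2 / q) (W * c') => a0 a1; lra.
have := progress T; move: key tel.
move: (\sum_(1 <= t < T.+1) _) (\sum_(1 <= t < T.+1) _) (\sum_(1 <= t < T.+1) _).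
move: (\sum_(1 <= t < T.+1) _) (\sum_(1 <= t < T.+1) _) => S1 S2 S3 S4 S5.
lra.
Qed.

End MomentumSum.

(** * Choice of the parameters *)

(** Syntax-directed proofs of signs. *)
Ltac pos := match goal with
  | |- is_true (0 < _ * _) => apply: mulr_gt0; pos
  | |- is_true (0 < _ + _) => apply: addr_gt0; pos
  | |- is_true (0 < _ ^+ _) => apply: exprn_gt0; pos
  | |- is_true (0 < _^-1) => rewrite invr_gt0; pos
  | _ => first [assumption | exact: ltr0Sn | exact: ltr01 | idtac]
  end.
Ltac nneg := match goal with
  | |- is_true (0 <= _ * _) => apply: mulr_ge0; nneg
  | |- is_true (0 <= _ + _) => apply: addr_ge0; nneg
  | |- is_true (0 <= _ ^+ 2) => exact: sqr_ge0
  | |- is_true (0 <= _ ^+ _) => apply: exprn_ge0; nneg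
  | |- is_true (0 <= _^-1) => rewrite invr_ge0; nneg
  | |- is_true (0 <= `| _ |) => exact: normr_ge0
  | _ => first [assumption | exact: ler0n | exact: ler01 | apply: ltW; pos; fail | apply: ltW; assumption | idtac]
  end.

Section Constants.
Context {R : realType}.
Variables (Lf rho b bhat sigma DeltaF DeltaY : R).
Hypotheses (Lf_gt0 : 0 < Lf) (rho_gt0 : 0 < rho) (b_gt0 : 0 < b).
Hypothesis b_le_bhat : b <= bhat.

(** Upper bound of [mu] and of [q mu] enforced by the constraint on [q]. *)
Definition mu_max := 16 / (81 * Lf).
Definition step_ratio := 27 / 32 * (b / bhat).
Definition K_track := 1 + mu_max / (6 * Lf).
Definition K_denom := 150 + mu_max ^+ 2 / Lf ^+ 4.
Definition c_excess := 36 * mu_max ^+ 2 + 384 * K_track ^+ 2 * Lf ^+ 2 * (bhat / b).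
Definition c_momentum := 2 / 3 + c_excess.
Definition m_shift := (1 + c_momentum) ^+ 3.
(** The reciprocal of a sum of reciprocals is below each of the upper bounds that
    [theta_bounds] asks for. *)
Definition theta := (4 * mu_max ^+ 2 * Lf * (mu_max + Lf) / rho
  + 16 * K_track * Lf ^+ 2 / (rho * step_ratio)
  + Lf ^+ 2 * K_denom / (rho * step_ratio) + 5 * Lf * mu_max ^+ 2 / rho)^-1.
Definition K_rate := rho * `|DeltaF| / theta
  + 16 * Lf ^+ 2 * mu_max * DeltaY ^+ 2 / step_ratio
  + mu_max * sigma ^+ 2 * (1 + c_momentum) / 3 + mu_max * c_momentum ^+ 2 * sigma ^+ 2 / 3.

Let bhat_gt0 : 0 < bhat. Proof. exact: lt_le_trans b_le_bhat. Qed.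

Lemma mu_max_gt0 : 0 < mu_max.
Proof. by apply: divr_gt0 => //; exact: mulr_gt0. Qed.

Lemma step_ratio_gt0 : 0 < step_ratio.
Proof. by apply: mulr_gt0; exact: divr_gt0. Qed.

Lemma step_ratio_le1 : step_ratio <= 1.
Proof.
have : b / bhat <= 1 by rewrite ler_pdivrMr // mul1r.
have : 0 < b / bhat by exact: divr_gt0.
rewrite /step_ratio; move: (b / bhat) => z; lra.
Qed.

Lemma K_track_ge1 : 1 <= K_track.
Proof.
have M0 := mu_max_gt0; rewrite /K_track lerDl; nneg.
Qed.

Lemma K_denom_ge150 : 150 <= K_denom.
Proof. by rewrite /K_denom lerDl; nneg. Qed.

Let bb_ge1 : 1 <= bhat / b. Proof. by rewrite ler_pdivlMr // mul1r. Qed.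

Lemma c_excess_ge0 : 0 <= c_excess.
Proof.
have B : 0 <= bhat / b := le_trans ler01 bb_ge1.
rewrite /c_excess; nneg.
Qed.

Lemma m_shift_ge1 : 1 <= m_shift.
Proof. by rewrite expr_ge1 //; have := c_excess_ge0; rewrite /c_momentum; lra. Qed.

Lemma theta_bounds : [/\ 0 < theta,
  4 * theta * mu_max ^+ 2 * Lf * (mu_max + Lf) <= rho,
  16 * K_track * Lf ^+ 2 * theta <= rho * step_ratio,
  theta * (Lf ^+ 2 * K_denom) <= rho * step_ratio
  & 5 * Lf * theta * mu_max ^+ 2 <= rho].
Proof.
have M0 := mu_max_gt0; have a0 := step_ratio_gt0.
have Kt := K_track_ge1; have Kd := K_denom_ge150.
have ra0 : 0 < rho * step_ratio by exact: mulr_gt0.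
have M2 : 0 < mu_max ^+ 2 by exact: exprn_gt0.
have L2 : 0 < Lf ^+ 2 by exact: exprn_gt0.
have Kt0 : 0 < K_track by exact: lt_le_trans Kt.
have Kd0 : 0 < K_denom by exact: lt_le_trans Kd.
rewrite /theta; set z1 := _ / rho; set z2 := _ / (rho * _).
set z3 := _ / (rho * _); set z4 := 5 * _ * _ / rho.
have p1 : 0 < z1 by rewrite /z1; pos.
have p2 : 0 < z2 by rewrite /z2; pos.
have p3 : 0 < z3 by rewrite /z3; pos.
have p4 : 0 < z4 by rewrite /z4; pos.
have S0 : 0 < z1 + z2 + z3 + z4 by pos.
have bound (z X Y : R) : 0 < Y -> X / Y = z -> z <= z1 + z2 + z3 + z4 ->
    X * (z1 + z2 + z3 + z4)^-1 <= Y.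
  by move=> Y0 <- zS; rewrite ler_pdivrMr // mulrC -ler_pdivrMr.
split; first by rewrite invr_gt0.
- have := bound z1 _ _ rho_gt0 erefl; set S := _^-1 => H.
  have -> : 4 * S * mu_max ^+ 2 * Lf * (mu_max + Lf) =
    4 * mu_max ^+ 2 * Lf * (mu_max + Lf) * S by ring.
  by apply: H; lra.
- by apply: (bound z2) => //; lra.
- by rewrite mulrC; apply: (bound z3) => //; lra.
- have := bound z4 _ _ rho_gt0 erefl; set S := _^-1 => H.
  have -> : 5 * Lf * S * mu_max ^+ 2 = 5 * Lf * mu_max ^+ 2 * S by ring.
  by apply: H; lra.
Qed.

Lemma K_rate_ge0 : 0 <= K_rate.
Proof.
have [t0 _ _ _ _] := theta_bounds; have M0 := mu_max_gt0; have a0 := step_ratio_gt0.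
have c0 : 0 <= c_momentum by rewrite addr_ge0 ?c_excess_ge0 // divr_ge0.
by rewrite /K_rate; nneg.
Qed.

Section Scaling.
Variables (mu q : R).
Hypotheses (mu_gt0 : 0 < mu) (q_ge1 : 1 <= q).
Hypothesis q_small : 27 * mu * b * q / 32 <= b / (6 * Lf).

(** [lam] is the largest value allowed; with [gam] of order [q mu^3], the constants
    [theta], [c_momentum] and [m_shift] do not depend on [mu] and [q]. *)
Definition lam_choice := 27 * mu * b * q / 32.
Definition gam_choice := theta * q * mu ^+ 3.

Let q_gt0 : 0 < q. Proof. exact: lt_le_trans q_ge1. Qed.

Lemma q_mu_le : q * mu <= mu_max.
Proof.
have L6 : 0 < 6 * Lf by pos.
have L81 : 0 < 81 * Lf by pos.
have := q_small; rewrite ler_pdivlMr // => h.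
rewrite /mu_max ler_pdivlMr // -(ler_pM2l b_gt0); lra.
Qed.

Lemma mu_le : mu <= mu_max.
Proof. by apply: le_trans q_mu_le; rewrite ler_peMl // ltW. Qed.

Lemma lam_choice_gt0 : 0 < lam_choice.
Proof. by rewrite /lam_choice; pos. Qed.

Lemma gam_choice_gt0 : 0 < gam_choice.
Proof. by have [t0 _ _ _ _] := theta_bounds; rewrite /gam_choice; pos. Qed.

Lemma lam_bhat : lam_choice / bhat = step_ratio * mu * q.
Proof. by rewrite /lam_choice /step_ratio; field; rewrite gt_eqF. Qed.

Lemma lam_b : lam_choice / b = 27 / 32 * mu * q.
Proof. by rewrite /lam_choice; field; rewrite gt_eqF. Qed.

Lemma gam_choice_smooth : 4 * gam_choice * (Lf * (1 + Lf / mu)) <= rho.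
Proof.
have [t0 h _ _ _] := theta_bounds; apply: le_trans h.
have -> : 4 * gam_choice * (Lf * (1 + Lf / mu)) =
   4 * theta * ((q * mu) * mu * Lf * (mu + Lf)).
  by rewrite /gam_choice; field; rewrite gt_eqF.
have -> : 4 * theta * mu_max ^+ 2 * Lf * (mu_max + Lf) =
   4 * theta * (mu_max * mu_max * Lf * (mu_max + Lf)) by ring.
have qm := q_mu_le; have mm := mu_le; have M0 := mu_max_gt0.
have t4 : 0 <= 4 * theta by nneg.
have qm0 : 0 <= q * mu by nneg.
rewrite ler_wpM2l //; apply: ler_pM; rewrite ?lerD2r //.
- by nneg.
- by nneg.
- by rewrite ler_pM2r //; apply: ler_pM => //; exact: ltW.
Qed.

Lemma tau_choice_smooth : 6 * Lf * (lam_choice / b) <= 1.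
Proof.
rewrite lam_b; have := q_mu_le.
have L81 : 0 < 81 * Lf by pos.
rewrite /mu_max ler_pdivlMr //; lra.
Qed.

Lemma tau_choice_mu : 1 + mu * (lam_choice / b) <= K_track.
Proof.
rewrite /K_track lerD2l.
have h := tau_choice_smooth.
have h2 : lam_choice / b <= (6 * Lf)^-1.
  have L6 : 0 < 6 * Lf by pos.
  by rewrite -[leRHS]div1r ler_pdivlMr // mulrC.
apply: ler_pM => //; first exact: ltW.
  by have l0 := lam_choice_gt0; nneg.
exact: mu_le.
Qed.

Lemma gam_choice_small : 256 * K_track * Lf ^+ 2 * (Lf / mu) ^+ 2 * gam_choice ^+ 2 <=
  rho ^+ 2 * (lam_choice / bhat) ^+ 2 * mu ^+ 2.
Proof.
have [t0 _ h _ _] := theta_bounds; have K1 := K_track_ge1.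
rewrite lam_bhat.
have -> : 256 * K_track * Lf ^+ 2 * (Lf / mu) ^+ 2 * gam_choice ^+ 2 =
  (16 * Lf ^+ 2 * theta) ^+ 2 * K_track * (q ^+ 2 * mu ^+ 4).
  by rewrite /gam_choice; field; rewrite gt_eqF.
have -> : rho ^+ 2 * (step_ratio * mu * q) ^+ 2 * mu ^+ 2 =
  (rho * step_ratio) ^+ 2 * (q ^+ 2 * mu ^+ 4) by ring.
have qm : 0 <= q ^+ 2 * mu ^+ 4 by nneg.
rewrite ler_wpM2r //.
have z0 : 0 <= 16 * Lf ^+ 2 * theta.
  by nneg.
have K0 : 0 <= K_track by exact: le_trans K1.
apply: (@le_trans _ _ ((16 * K_track * Lf ^+ 2 * theta) ^+ 2)).
  have -> : (16 * K_track * Lf ^+ 2 * theta) ^+ 2 =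
     (16 * Lf ^+ 2 * theta) ^+ 2 * K_track * K_track by ring.
  by rewrite ler_peMr //; nneg.
have ra := step_ratio_gt0.
by rewrite ler_pXn2r // nnegrE; nneg.
Qed.

Lemma gam_choice_le1 :
  gam_choice <= rho * lam_choice * mu * Num.sqrt q /
    (Lf * Num.sqrt (32 * lam_choice ^+ 2 + 150 * q * (Lf / mu) ^+ 2 * bhat ^+ 2)).
Proof.
have [t0 _ _ h _] := theta_bounds.
have Kd := K_denom_ge150; have Kd0 : 0 < K_denom by exact: lt_le_trans Kd.
have sq0 : 0 < Num.sqrt q by rewrite sqrtr_gt0.
have l0 := lam_choice_gt0; have M0 := mu_max_gt0.
have kb0 : 0 < Lf / mu * bhat by pos.
set S := 32 * _ + _.
have S0 : 0 < S.
  by rewrite /S; pos.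
have SE : Num.sqrt S <= K_denom * (Num.sqrt q * (Lf / mu * bhat)).
  have r0 : 0 <= K_denom * (Num.sqrt q * (Lf / mu * bhat)).
    by nneg.
  rewrite -[leRHS]ger0_norm // -sqrtr_sqr ler_wsqrtr //.
  have -> : (K_denom * (Num.sqrt q * (Lf / mu * bhat))) ^+ 2 =
      K_denom ^+ 2 * (q * (Lf / mu * bhat) ^+ 2).
    by rewrite !exprMn sqr_sqrtr ?ltW.
  have -> : S = 32 * lam_choice ^+ 2 + 150 * (q * (Lf / mu * bhat) ^+ 2).
    by rewrite /S; ring.
  have l1 : lam_choice <= bhat / (6 * Lf).
    by apply: (le_trans q_small); rewrite ler_wpM2r //; nneg.
  have l2 : lam_choice ^+ 2 <= (bhat / (6 * Lf)) ^+ 2.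
    by rewrite ler_pXn2r // nnegrE; nneg.
  have k1 : 1 <= mu_max / mu by rewrite ler_pdivlMr // mul1r mu_le.
  have k2 : 1 <= (mu_max / mu) ^+ 2 by rewrite expr_ge1 //; nneg.
  have e1 : mu_max ^+ 2 / Lf ^+ 4 * (q * (Lf / mu * bhat) ^+ 2) =
     36 * (bhat / (6 * Lf)) ^+ 2 * (q * (mu_max / mu) ^+ 2).
    by field; rewrite !gt_eqF.
  have qk : 1 <= q * (mu_max / mu) ^+ 2.
    by apply: (le_trans q_ge1); rewrite ler_peMr // ltW.
  have e2 : 36 * (bhat / (6 * Lf)) ^+ 2 <=
      36 * (bhat / (6 * Lf)) ^+ 2 * (q * (mu_max / mu) ^+ 2).
    by rewrite ler_peMr //; nneg.
  have e3 : K_denom * (q * (Lf / mu * bhat) ^+ 2) <=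
      K_denom ^+ 2 * (q * (Lf / mu * bhat) ^+ 2).
    have n0 : 0 <= q * (Lf / mu * bhat) ^+ 2 by nneg.
    have Kd1 : 1 <= K_denom by lra.
    by rewrite ler_wpM2r // expr2 ler_peMr // ltW.
  apply: le_trans e3.
  have -> : K_denom * (q * (Lf / mu * bhat) ^+ 2) = 150 * (q * (Lf / mu * bhat) ^+ 2) +
      mu_max ^+ 2 / Lf ^+ 4 * (q * (Lf / mu * bhat) ^+ 2) by rewrite /K_denom; ring.
  rewrite e1 addrC lerD2l.
  apply: le_trans e2; apply: (@le_trans _ _ (32 * (bhat / (6 * Lf)) ^+ 2)).
    by rewrite ler_pM2l.
  by rewrite ler_wpM2r ?ler_nat //; nneg.
have D0 : 0 < Lf * Num.sqrt S by rewrite mulr_gt0 // sqrtr_gt0.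
rewrite ler_pdivlMr //.
apply: (@le_trans _ _ (gam_choice * (Lf * (K_denom * (Num.sqrt q * (Lf / mu * bhat)))))).
  by rewrite ler_wpM2l ?(ltW gam_choice_gt0) // ler_wpM2l // ltW.
have -> : gam_choice * (Lf * (K_denom * (Num.sqrt q * (Lf / mu * bhat)))) =
   theta * (Lf ^+ 2 * K_denom) * (q * mu ^+ 2 * bhat * Num.sqrt q).
  by rewrite /gam_choice; field; rewrite gt_eqF.
have -> : rho * lam_choice * mu * Num.sqrt q =
   rho * step_ratio * (q * mu ^+ 2 * bhat * Num.sqrt q).
  by rewrite /lam_choice /step_ratio; field; rewrite gt_eqF.
by rewrite ler_wpM2r //; nneg.
Qed.

Definition momentum_weight := (12 * mu ^+ 2)^-1.

Lemma momentum_weight_gt0 : 0 < momentum_weight.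
Proof. by rewrite /momentum_weight; pos. Qed.

Lemma momentum_weight_ex : 3 <= momentum_weight * c_excess.
Proof.
have m12 : 0 < 12 * mu ^+ 2 by pos.
rewrite /momentum_weight mulrC ler_pdivlMr //.
have : mu ^+ 2 <= mu_max ^+ 2.
  by rewrite ler_pXn2r ?mu_le // nnegrE ltW // mu_max_gt0.
have : 0 <= 384 * K_track ^+ 2 * Lf ^+ 2 * (bhat / b).
  by have B : 0 <= bhat / b := le_trans ler01 bb_ge1; nneg.
rewrite /c_excess; lra.
Qed.

Lemma momentum_weight_ey :
  weight_ey Lf mu b bhat K_track <= momentum_weight * c_excess.
Proof.
have -> : weight_ey Lf mu b bhat K_track =
    momentum_weight * (384 * K_track ^+ 2 * Lf ^+ 2 * (bhat / b)).
  by rewrite /weight_ey /momentum_weight; field; rewrite !gt_eqF.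
rewrite ler_wpM2l ?(ltW momentum_weight_gt0) // /c_excess lerDr; nneg.
Qed.

Lemma momentum_weight_dy :
  32 * momentum_weight * Lf ^+ 2 / q <= weight_dy Lf mu lam_choice bhat.
Proof.
rewrite /weight_dy /tracking_weight lam_bhat.
have a0 := step_ratio_gt0; have a1 := step_ratio_le1.
have -> : 32 * momentum_weight * Lf ^+ 2 / q = 8 / 3 * (Lf ^+ 2 / (mu ^+ 2 * q)).
  by rewrite /momentum_weight; field; rewrite !gt_eqF.
have -> : 16 * Lf ^+ 2 / (step_ratio * mu * q * mu) / 6 =
   8 / 3 / step_ratio * (Lf ^+ 2 / (mu ^+ 2 * q)).
  by field; rewrite !gt_eqF.
rewrite ler_wpM2r //; last by rewrite ler_pdivlMr // ler_piMr.
by nneg.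
Qed.

Lemma momentum_weight_dx :
  32 * momentum_weight * Lf ^+ 2 / q <= weight_dx gam_choice rho / 2.
Proof.
have [t0 _ _ _ h] := theta_bounds; have M0 := mu_max_gt0.
have L0 := Lf_gt0; have qm := q_mu_le; have mm := mu_le.
have -> : weight_dx gam_choice rho / 2 = rho ^+ 2 / (8 * (theta * q * mu ^+ 3) ^+ 2).
  by rewrite /weight_dx /gam_choice; field; rewrite !gt_eqF.
have g0 : 0 < 8 * (theta * q * mu ^+ 3) ^+ 2 by pos.
rewrite ler_pdivlMr //.
have -> : 32 * momentum_weight * Lf ^+ 2 / q * (8 * (theta * q * mu ^+ 3) ^+ 2) =
   64 / 3 * (Lf * theta) ^+ 2 * (q * mu * mu ^+ 3).
  by rewrite /momentum_weight; field; rewrite !gt_eqF.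
have m3 : q * mu * mu ^+ 3 <= mu_max ^+ 4.
  rewrite (exprS mu_max); apply: ler_pM => //.
  - by nneg.
  - by nneg.
  - by rewrite ler_pXn2r // nnegrE ltW.
have h2 : (5 * Lf * theta * mu_max ^+ 2) ^+ 2 <= rho ^+ 2.
  by rewrite ler_pXn2r // nnegrE; nneg.
apply: le_trans h2.
have -> : (5 * Lf * theta * mu_max ^+ 2) ^+ 2 = 25 * ((Lf * theta) ^+ 2 * mu_max ^+ 4).
  by ring.
have s0 : 0 <= (Lf * theta) ^+ 2 by exact: sqr_ge0.
have := ler_wpM2l s0 m3; have : 0 <= (Lf * theta) ^+ 2 * mu_max ^+ 4.
  by nneg.
lra.
Qed.

(** Every contribution is at most of order [1 / (q mu^3)] because [mu] is
    bounded. *)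
Lemma rate_bound (S : R) : 0 <= S ->
  rho / gam_choice * DeltaF + tracking_weight Lf mu lam_choice bhat * DeltaY ^+ 2
  + momentum_weight * (4 * sigma ^+ 2 / q) * (1 + c_momentum)
  + momentum_weight * (4 * c_momentum ^+ 2 * sigma ^+ 2 / q) * S
  <= K_rate / (q * mu ^+ 3) * (1 + S).
Proof.
move=> S0; have [t0 _ _ _ _] := theta_bounds; have M0 := mu_max_gt0.
have a0 := step_ratio_gt0; have mm := mu_le; have c0 := c_excess_ge0.
rewrite /tracking_weight lam_bhat.
set Q := (q * mu ^+ 3)^-1.
have Q0 : 0 < Q by rewrite /Q; pos.
have mQ : (q * mu ^+ 2)^-1 <= mu_max * Q.
  have -> : (q * mu ^+ 2)^-1 = mu * Q by rewrite /Q; field; rewrite !gt_eqF.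
  by rewrite ler_pM2r.
have e1 : rho / gam_choice * DeltaF <= rho * `|DeltaF| / theta * Q.
  have -> : rho / gam_choice * DeltaF = rho * DeltaF / theta * Q.
    by rewrite /gam_choice /Q; field; rewrite !gt_eqF.
  apply: ler_wpM2r; first by nneg.
  apply: ler_wpM2r; first by nneg.
  by apply: ler_wpM2l; [nneg|exact: ler_norm].
have e2 : 16 * Lf ^+ 2 / (step_ratio * mu * q * mu) * DeltaY ^+ 2 <=
   16 * Lf ^+ 2 * mu_max * DeltaY ^+ 2 / step_ratio * Q.
  have -> : 16 * Lf ^+ 2 / (step_ratio * mu * q * mu) * DeltaY ^+ 2 =
     16 * Lf ^+ 2 * DeltaY ^+ 2 / step_ratio * (q * mu ^+ 2)^-1.
    by field; rewrite !gt_eqF.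
  have -> : 16 * Lf ^+ 2 * mu_max * DeltaY ^+ 2 / step_ratio * Q =
     16 * Lf ^+ 2 * DeltaY ^+ 2 / step_ratio * (mu_max * Q) by ring.
  by rewrite ler_wpM2l //; nneg.
have e3 : momentum_weight * (4 * sigma ^+ 2 / q) * (1 + c_momentum) <=
   mu_max * sigma ^+ 2 * (1 + c_momentum) / 3 * Q.
  have -> : momentum_weight * (4 * sigma ^+ 2 / q) * (1 + c_momentum) =
    sigma ^+ 2 * (1 + c_momentum) / 3 * (q * mu ^+ 2)^-1.
    by rewrite /momentum_weight; field; rewrite !gt_eqF.
  have -> : mu_max * sigma ^+ 2 * (1 + c_momentum) / 3 * Q =
    sigma ^+ 2 * (1 + c_momentum) / 3 * (mu_max * Q) by ring.
  have cm : 0 <= c_momentum by rewrite /c_momentum; lra.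
  by rewrite ler_wpM2l //; nneg.
have e4 : momentum_weight * (4 * c_momentum ^+ 2 * sigma ^+ 2 / q) <=
   mu_max * c_momentum ^+ 2 * sigma ^+ 2 / 3 * Q.
  have -> : momentum_weight * (4 * c_momentum ^+ 2 * sigma ^+ 2 / q) =
    c_momentum ^+ 2 * sigma ^+ 2 / 3 * (q * mu ^+ 2)^-1.
    by rewrite /momentum_weight; field; rewrite !gt_eqF.
  have -> : mu_max * c_momentum ^+ 2 * sigma ^+ 2 / 3 * Q =
    c_momentum ^+ 2 * sigma ^+ 2 / 3 * (mu_max * Q) by ring.
  by rewrite ler_wpM2l //; nneg.
have k1 : 0 <= rho * `|DeltaF| / theta * Q.
  by nneg.
have k2 : 0 <= 16 * Lf ^+ 2 * mu_max * DeltaY ^+ 2 / step_ratio * Q.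
  by nneg.
have k3 : 0 <= mu_max * sigma ^+ 2 * (1 + c_momentum) / 3 * Q.
  have cm : 0 <= c_momentum by rewrite /c_momentum; lra.
  by nneg.
have k4 : 0 <= mu_max * c_momentum ^+ 2 * sigma ^+ 2 / 3 * Q.
  by nneg.
have e5 := ler_wpM2r S0 e4.
have -> : K_rate / (q * mu ^+ 3) = rho * `|DeltaF| / theta * Q
  + 16 * Lf ^+ 2 * mu_max * DeltaY ^+ 2 / step_ratio * Q
  + mu_max * sigma ^+ 2 * (1 + c_momentum) / 3 * Q
  + mu_max * c_momentum ^+ 2 * sigma ^+ 2 / 3 * Q by rewrite /K_rate -/Q; ring.
move: e1 e2 e3 e5 k1 k2 k3 k4.
move: (rho * _ / theta * Q) (16 * _ * _ * _ / _ * Q) (mu_max * sigma ^+ 2 * _ / 3 * Q).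
move: (mu_max * _ * _ / 3 * Q) => w4 w1 w2 w3 e1 e2 e3 e5 k1 k2 k3 k4.
have := mulr_ge0 k1 S0; have := mulr_ge0 k2 S0; have := mulr_ge0 k3 S0; lra.
Qed.

End Scaling.
End Constants.

(** * Number of iterations *)

Section IterationCount.
Context {R : realType}.

Definition log_factor (kappa eps : R) := ln (2 + kappa / eps).

Lemma log_factor_ge_half (kappa eps : R) : 0 < kappa -> 0 < eps ->
  2^-1 <= log_factor kappa eps.
Proof.
move=> k0 e0; have ke : 0 < kappa / eps by pos.
have h1 : ln (1 + - 2^-1) <= - 2^-1 :> R by apply: le_ln1Dx; lra.
have h2 : 1 + - 2^-1 = 2^-1 :> R by field.
rewrite h2 lnV ?posrE // in h1.
have : ln 2 <= log_factor kappa eps by rewrite ler_ln ?posrE //; lra.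
lra.
Qed.

(** The cube root of the number of iterations. *)
Definition count_scale (K kappa eps q : R) :=
  (46 * K + 1) * Num.sqrt (kappa ^+ 3 / (q * eps ^+ 2)) * log_factor kappa eps.

(** The factor [46 K + 1] is chosen so that its square beats [K] times the
    logarithm of the number of iterations, in which it occurs cubed. *)
Lemma iteration_count (K kappa eps q : R) :
  0 < K -> 0 < kappa -> 0 < eps <= 1 -> 1 <= q ->
  exists T : nat, (0 < T)%N /\ T%:R <= count_scale K kappa eps q ^+ 3 + 1 /\
  exists c : R, [/\ 0 < c, c ^+ 3 = T%:R &
    K * (kappa ^+ 3 / q) * (1 + ln (1 + T%:R)) <= c ^+ 2 * eps ^+ 2].
Proof.
move=> K0 k0 /andP[e0 e1] q1; have q0 : 0 < q by exact: lt_le_trans q1.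
set l := log_factor kappa eps; have l2 : 2^-1 <= l by exact: log_factor_ge_half.
have l0 : 0 < l by lra.
pose u := 46 * K + 1; have u1 : 1 <= u by rewrite /u; lra.
pose s := kappa ^+ 3 / (q * eps ^+ 2).
have s0 : 0 < s by rewrite /s; pos.
have ss0 : 0 < Num.sqrt s by rewrite sqrtr_gt0.
have tE : count_scale K kappa eps q = u * Num.sqrt s * l by [].
rewrite tE; set tau := u * _ * l.
have t0 : 0 < tau by rewrite /tau !mulr_gt0 //; lra.
have t30 : 0 <= tau ^+ 3 by nneg.
exists (Num.truncn (tau ^+ 3)).+1; split=> //.
have /andP[tr1 tr2] := truncn_itv t30.
set T := (Num.truncn _).+1 in tr2 *.
have TE : T%:R <= tau ^+ 3 + 1 by rewrite /T -natr1 lerD2r.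
split=> //; exists (T%:R `^ (3^-1)).
have T0 : (0 : R) < T%:R by rewrite ltr0n.
have c0 : 0 < (T%:R : R) `^ (3^-1) by exact: powR_gt0.
have c3 : ((T%:R : R) `^ (3^-1)) ^+ 3 = T%:R.
  by rewrite -powR_mulrn ?powR_ge0 // -powRrM mulVf ?powRr1 // ltW.
split=> //; move: (_ `^ _) c0 c3 => c c0 c3.
have tc : tau <= c.
  by rewrite -(ler_pXn2r (n := 3)) ?nnegrE ?ltW // c3 // ltW.
pose r := 2 + kappa / eps; have ke : 0 < kappa / eps by pos.
have r2 : 2 <= r by rewrite /r; lra.
have lr : l <= r by apply: ltW; apply: ln_sublinear; rewrite -/r; lra.
have sr : s <= r ^+ 3.
  apply: (@le_trans _ _ ((kappa / eps) ^+ 3)).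
    rewrite /s exprMn exprVn ler_pM2l ?exprn_gt0 // lef_pV2 ?posrE ?exprn_gt0 //; last first.
      by pos.
    have e3 : eps ^+ 3 <= eps ^+ 2 by rewrite (exprS eps 2) ler_piMl // sqr_ge0.
    by apply: (le_trans e3); rewrite ler_peMl // sqr_ge0.
  by rewrite ler_pXn2r ?nnegrE //; rewrite /r; move: (kappa / eps) ke => z; lra.
have sqr_r : Num.sqrt s <= r ^+ 2.
  have r20 : 0 <= r ^+ 2 by exact: sqr_ge0.
  rewrite -[leRHS]ger0_norm // -sqrtr_sqr ler_wsqrtr //; apply: (le_trans sr).
  by rewrite -exprM (exprS r 3) ler_peMl ?exprn_ge0 //; lra.
have tr : tau <= u * r ^+ 3.
  rewrite /tau -mulrA ler_pM2l; last by lra.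
  rewrite exprSr; apply: ler_pM => //; exact: ltW.
have ur1 : 1 <= u * r ^+ 3.
  have r31 : 1 <= r ^+ 3 by rewrite exprn_ege1 //; lra.
  by apply: (le_trans u1); rewrite ler_peMr //; lra.
have T1 : 1 + T%:R <= 3 * (u * r ^+ 3) ^+ 3.
  have h : tau ^+ 3 <= (u * r ^+ 3) ^+ 3 by rewrite ler_pXn2r // nnegrE; [exact: ltW|exact: le_trans ur1].
  have h1 : 1 <= (u * r ^+ 3) ^+ 3 by rewrite exprn_ege1.
  move: (tau ^+ 3) (_ ^+ 3) TE h h1 => a c3' TE h h1; lra.
have lnT : ln (1 + T%:R) <= 3 + 3 * u + 9 * l.
  have u0 : 0 < u by lra.
  have r0 : 0 < r by lra.
  apply: (@le_trans _ _ (ln (3 * (u * r ^+ 3) ^+ 3))).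
    by rewrite ler_ln // posrE; [exact: addr_gt0|pos].
  have r3 : 0 < r ^+ 3 by exact: exprn_gt0.
  have ur : 0 < u * r ^+ 3 by exact: mulr_gt0.
  rewrite lnM ?posrE ?exprn_gt0 // lnXn // lnM ?posrE // lnXn //.
  have h3 : ln 3 < 3 :> R by exact: ln_sublinear.
  have hu := ln_sublinear u0; have -> : ln r = l by [].
  move: (ln u) (ln 3 : R) h3 hu => lu l3 h3 hu; lra.
have k1 : 1 + ln (1 + T%:R) <= 46 * u * l ^+ 2.
  have a1 : 1 + ln (1 + T%:R) <= 23 * u * l.
    have : 1 * l <= u * l by rewrite ler_wpM2r // ltW.
    have : u * 2^-1 <= u * l by rewrite ler_wpM2l //; lra.
    lra.
  apply: (le_trans a1).
  have -> : 46 * u * l ^+ 2 = 23 * u * l * (2 * l) by ring.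
  by rewrite ler_peMr ?mulr_ge0 //; lra.
have e2 : 0 < eps ^+ 2 by pos.
have sE : kappa ^+ 3 / q = s * eps ^+ 2 by rewrite /s; field; rewrite !gt_eqF.
have tau2 : tau ^+ 2 = u ^+ 2 * s * l ^+ 2.
  by rewrite /tau !exprMn sqr_sqrtr // ltW.
apply: (@le_trans _ _ (tau ^+ 2 * eps ^+ 2)); last first.
  by rewrite ler_pM2r // ler_pXn2r // nnegrE ltW.
rewrite sE tau2.
have -> : K * (s * eps ^+ 2) * (1 + ln (1 + T%:R)) =
  s * (K * (1 + ln (1 + T%:R))) * eps ^+ 2 by ring.
have -> : u ^+ 2 * s * l ^+ 2 * eps ^+ 2 = s * (u ^+ 2 * l ^+ 2) * eps ^+ 2 by ring.
rewrite ler_pM2r // ler_pM2l //; apply: (le_trans (ler_wpM2l (ltW K0) k1)).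
have -> : K * (46 * u * l ^+ 2) = 46 * K * u * l ^+ 2 by ring.
rewrite ler_wpM2r ?sqr_ge0 // expr2 ler_wpM2r //; first lra.
by rewrite /u lerDl.
Qed.

Definition budget_factor (K B qlo : R) :=
  4 * (1 + (2 * Num.sqrt (B ^+ 3)) ^+ 3) * (46 * K + 1) ^+ 3 / Num.sqrt qlo.

(** [q kappa^(9/2) q^(-3/2) = kappa^(9/2) q^(-1/2)], and [q] is at least of the
    order of [kappa^nu].  The bounds on [kappa] and [q] make the count at least
    a positive constant, which absorbs the rounding. *)
Lemma iteration_budget (K B qlo nu kappa eps q : R) :
  0 < K -> 0 < B -> 0 < qlo -> 0 < kappa -> 0 < eps <= 1 -> 1 <= q ->
  qlo * kappa `^ nu <= q -> q <= B * kappa -> 1 <= B * kappa ->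
  4 * q * (count_scale K kappa eps q ^+ 3 + 1) <=
    budget_factor K B qlo * kappa `^ (9 / 2 - nu / 2) * (eps ^+ 3)^-1
    * log_factor kappa eps ^+ 3.
Proof.
move=> K0 B0 ql0 k0 /andP[e0 e1] q1 qlo_le q_le Bk.
have q0 : 0 < q by exact: lt_le_trans q1.
rewrite /count_scale; set l := log_factor kappa eps.
have l2 : 2^-1 <= l by exact: log_factor_ge_half.
have l0 : 0 < l by lra.
pose u := 46 * K + 1; have u1 : 1 <= u by rewrite /u; lra.
pose s := kappa ^+ 3 / (q * eps ^+ 2).
rewrite -/u -/s; set tau := u * _ * l.
have B3 : 0 < B ^+ 3 by pos.
have sB0 : 0 < Num.sqrt (B ^+ 3) by rewrite sqrtr_gt0.
have s1 : 1 <= B ^+ 3 * s.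
  have -> : B ^+ 3 * s = (B * kappa) ^+ 2 * (B * kappa / q) / eps ^+ 2.
    by rewrite /s; field; rewrite !gt_eqF.
  rewrite ler_pdivlMr ?exprn_gt0 // mul1r.
  apply: (@le_trans _ _ 1); first by rewrite exprn_ile1 // ltW.
  have a1 : 1 <= (B * kappa) ^+ 2 by rewrite exprn_ege1.
  have a2 : 1 <= B * kappa / q by rewrite ler_pdivlMr // mul1r.
  by rewrite -[leLHS]mulr1; apply: ler_pM.
have ss1 : 1 <= Num.sqrt (B ^+ 3) * Num.sqrt s.
  by rewrite -sqrtrM ?(ltW B3) // -sqrtr1 ler_wsqrtr.
have t1 : 1 <= 2 * Num.sqrt (B ^+ 3) * tau.
  have -> : 2 * Num.sqrt (B ^+ 3) * tau =
      u * (Num.sqrt (B ^+ 3) * Num.sqrt s) * (2 * l) by rewrite /tau; ring.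
  have a1 : 1 <= u * (Num.sqrt (B ^+ 3) * Num.sqrt s).
    by rewrite -[leLHS]mulr1; apply: ler_pM.
  by rewrite -[leLHS]mulr1; apply: ler_pM => //; lra.
have t3 : 1 <= (2 * Num.sqrt (B ^+ 3)) ^+ 3 * tau ^+ 3.
  by rewrite -exprMn exprn_ege1.
set K3 := (2 * Num.sqrt (B ^+ 3)) ^+ 3 in t3 *.
have K30 : 0 < K3 by rewrite /K3; pos.
have sk0 : 0 < Num.sqrt kappa by rewrite sqrtr_gt0.
have sq0 : 0 < Num.sqrt q by rewrite sqrtr_gt0.
have sqE : Num.sqrt q ^+ 2 = q by rewrite sqr_sqrtr // ltW.
have skE : Num.sqrt kappa ^+ 2 = kappa by rewrite sqr_sqrtr // ltW.
have sE : Num.sqrt s = Num.sqrt kappa ^+ 3 / (Num.sqrt q * eps).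
  have z0 : 0 <= Num.sqrt kappa ^+ 3 / (Num.sqrt q * eps) by nneg.
  rewrite -[RHS]ger0_norm // -sqrtr_sqr; congr Num.sqrt.
  rewrite /s -{1}skE -{1}sqE; field; rewrite !gt_eqF //.
have q3 : q * tau ^+ 3 = u ^+ 3 * (Num.sqrt kappa ^+ 9 / Num.sqrt q)
    * (eps ^+ 3)^-1 * l ^+ 3.
  by rewrite /tau sE -{1}sqE; field; rewrite !gt_eqF.
have kp : Num.sqrt kappa ^+ 9 / Num.sqrt q <=
    kappa `^ (9 / 2 - nu / 2) / Num.sqrt qlo.
  have kn : kappa != 0 by rewrite gt_eqF.
  have k9 : kappa `^ (9 / 2) = Num.sqrt kappa ^+ 9.
    by rewrite mulrC powRrM powR12_sqrt ?(ltW k0) // powR_mulrn // ltW.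
  have kn2 : kappa `^ (nu / 2) = Num.sqrt (kappa `^ nu).
    by rewrite powRrM powR12_sqrt // powR_ge0.
  have kn0 : 0 < Num.sqrt (kappa `^ nu) by rewrite sqrtr_gt0 powR_gt0.
  have sl0 : 0 < Num.sqrt qlo by rewrite sqrtr_gt0.
  rewrite powRB ?kn ?implybT // k9 kn2 -mulrA -invfM ler_pM2l ?exprn_gt0 //.
  rewrite lef_pV2 ?posrE ?mulr_gt0 // mulrC -sqrtrM ?(ltW ql0) //.
  exact: ler_wsqrtr.
have -> : 4 * q * (tau ^+ 3 + 1) = 4 * (q * tau ^+ 3) + 4 * q * 1 by ring.
apply: (@le_trans _ _ (4 * (1 + K3) * (q * tau ^+ 3))).
  have : q * 1 <= q * (K3 * tau ^+ 3) by rewrite ler_pM2l.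
  move: (tau ^+ 3) => z; lra.
rewrite q3.
have -> : 4 * (1 + K3) * (u ^+ 3 * (Num.sqrt kappa ^+ 9 / Num.sqrt q) *
    (eps ^+ 3)^-1 * l ^+ 3) = 4 * (1 + K3) * u ^+ 3 * ((eps ^+ 3)^-1 * l ^+ 3)
    * (Num.sqrt kappa ^+ 9 / Num.sqrt q) by ring.
have -> : budget_factor K B qlo * kappa `^ (9 / 2 - nu / 2) * (eps ^+ 3)^-1 * l ^+ 3 =
   4 * (1 + K3) * u ^+ 3 * ((eps ^+ 3)^-1 * l ^+ 3)
   * (kappa `^ (9 / 2 - nu / 2) / Num.sqrt qlo) by rewrite /budget_factor -/K3 -/u; ring.
by apply: ler_wpM2l => //; nneg; lra.
Qed.

End IterationCount.

(** * Output at a random time *)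

Section RandomOutput.
Context {R : realType} {dOm : measure_display} {Om : measurableType dOm}.
Variable P : probability Om R.

(** An event independent of [G] is recorded by a Boolean sample that is fresh
    for [G]. *)
Lemma integral_independent_event (G : set (set Om)) (A : set Om) (c : R)
    (N : g_sigma_algebraType G -> R) :
  sigma_algebra setT G -> G `<=` measurable -> measurable A ->
  (forall E, G E -> P (E `&` A) = P E * c%:E)%E ->
  measurable_fun setT N -> (forall o, 0 <= N o) ->
  (\int[P]_o (N o * \1_A o)%:E = c%:E * \int[P]_o (N o)%:E)%E.
Proof.
move=> sG Gm mA ind mN N0.
have GT : G setT.
  by rewrite -(setC0) -setTD; case: sG => G0 GC _; exact: GC.
have PA : P A = c%:E by rewrite -[A]setTI ind // probability_setT mul1e.
pose s (o : Om) : bool := o \in A.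
have ms : measurable_fun setT s.
  apply: (@measurable_fun_bool _ _ setT s true); rewrite setTI (_ : _ @^-1` _ = A) //.
  by apply/seteqP; split => o; [exact: set_mem|exact: mem_set].
pose D : probability bool R := distribution P (mfun_of ms).
have fs : fresh_sample P D G s.
  split=> // E S GE _; have mE := Gm _ GE.
  have -> : D S = P (s @^-1` S) by [].
  have sS (b : bool) o : s o = b -> S (s o) = S b by move=> ->.
  have [St|St] := pselect (S true); have [Sf|Sf] := pselect (S false).
  - have -> : s @^-1` S = setT by apply/seteqP; split => o //= _; case: (s o).
    by rewrite setIT probability_setT mule1.
  - have -> : s @^-1` S = A.
      apply/seteqP; split => o /=; last by move/mem_set; rewrite /s => ->.
      by case so : (s o) => // _; exact: set_mem.
    by rewrite ind // PA.
  - have -> : s @^-1` S = ~` A.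
      apply/seteqP; split => o /=.
        by case so : (s o) => // _ /mem_set; rewrite -/(s o) so.
      by move=> nA; rewrite /s memNset.
    have Ef : P E \is a fin_num by exact: fin_num_measure.
    have EA : P (E `\` A) = (P E - P (E `&` A))%E.
      by apply: measureD => //; rewrite ltey_eq Ef.
    rewrite probability_setC // PA -setDE EA.
    by rewrite ind // -(fineK Ef) -EFinM -!EFinB -EFinM mulrBr mulr1.
  - have -> : s @^-1` S = set0.
      by apply/seteqP; split => o //=; case: (s o).
    by rewrite setI0 measure0 mule0.
pose h (p : g_sigma_algebraType G * bool) : R := N p.1 * p.2%:R.
have mh : measurable_fun setT h.
  apply: measurable_funM; first exact: measurableT_comp mN measurable_fst.
  have mb : measurable_fun setT (fun b : bool => b%:R : R) by move=> _ B _.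
  exact: measurableT_comp mb measurable_snd.
have h0 p : 0 <= h p by rewrite mulr_ge0.
transitivity (\int[P]_o (h (o, s o))%:E)%E; first by apply: eq_integral => o _.
rewrite (integral_fresh sG Gm fs mh h0).
have mE : measurable_fun setT (fun b : bool => (b%:R : R)%:E) by move=> _ B _.
transitivity (\int[P]_o (c%:E * (N o)%:E))%E.
  apply: eq_integral => o _; rewrite /h /=; under eq_integral do rewrite EFinM.
  have -> : (\int[D]_b ((N o)%:E * (b%:R)%:E) = (N o)%:E * \int[D]_b (b%:R)%:E)%E.
    by apply: ge0_integralZl => //=; rewrite lee_fin.
  rewrite muleC; congr (_ * _)%E.
  rewrite ge0_integral_distribution //.
   by rewrite -PA -[A in RHS]setIT -integral_indic //; apply: eq_integral.
have c0 : 0 <= c by rewrite -lee_fin -PA.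
apply: ge0_integralZl => //; last by move=> o _; rewrite lee_fin.
by apply/measurable_EFinP; exact: (measurable_sub sG Gm mN).
Qed.


(** An output index drawn independently of the past turns a bound on the time
    average into a bound on the expected value at the output.  Only the majorant
    [N] has to be measurable. *)
Lemma uniform_index_integral (Fil : nat -> set (set Om)) (T : nat)
    (zeta : Om -> nat) (M : Om -> R) (N : nat -> Om -> R) (eps : R) :
  filtration Fil -> uniform_index P Fil T zeta -> (0 < T)%N ->
  (forall t, (0 < t)%N -> [/\ measurable_fun setT (N t : g_sigma_algebraType (Fil t) -> R),
     forall o, 0 <= N t o & summable_fun P (N t)]) ->
  (forall o, 0 <= M o <= N (zeta o) o) ->
  \sum_(1 <= t < T.+1) expect P (N t) <= T%:R * eps ->
  (\int[P]_o (M o)%:E <= eps%:E)%E.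
Proof.
move=> [sF Fm FS] [zT mz ind] T0 NP MN NT.
pose K t o := if (1 <= t <= T)%N then N t o * \1_(zeta @^-1` [set t]) o else 0.
have K0 t o : 0 <= K t o.
  rewrite /K; case: ifP => // /andP[t0 _]; have [_ N0 _] := NP t t0.
  by rewrite mulr_ge0 // ler0n.
have TR : (0 : R) < T%:R by rewrite ltr0n.
have FT s t : (s <= t)%N -> Fil s `<=` Fil t.
  by move=> /subnK <-; elim: (t - s)%N => // k IH; rewrite addSn; exact: subset_trans IH (@FS _).
have mK t : measurable_fun setT (K t).
  rewrite /K; case: (boolP (1 <= t <= T)%N) => [/andP[t0 _]|_] //.
  have [mN _ _] := NP t t0; apply: measurable_funM; first exact: (measurable_sub (sF t) (@Fm t) mN).
  exact: measurable_indic.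
have KE t : (1 <= t <= T)%N -> (\int[P]_o (K t o)%:E = (T%:R^-1 * expect P (N t))%:E)%E.
  move=> tT; have [mN N0 Ni] := NP t (andP tT).1; rewrite /K tT.
  rewrite (integral_independent_event (G := Fil T) (c := T%:R^-1)) //.
  - by rewrite expectE.
  - by move=> E FE; exact: ind.
  - move=> _ B mB; rewrite setTI; apply: sub_sigma_algebra.
    apply: (FT t T (andP tT).2); exact: (measurable_subP (sF t) mN mB).
have MK o : M o <= \sum_(1 <= t < T.+1) K t o.
  have /andP[_ Mo] := MN o; apply: (le_trans Mo).
  have zo := zT o; rewrite (bigD1_seq (zeta o)) ?iota_uniq //=; last first.
    by rewrite mem_index_iota ltnS.
  have -> : K (zeta o) o = N (zeta o) o by rewrite /K zo indicE mem_set // mulr1.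
  by rewrite lerDl; exact: sumr_ge0.
apply: (@le_trans _ _ (\int[P]_o \sum_(1 <= t < T.+1) (K t o)%:E)%E).
  apply: le_integral_pointwise => o; first by rewrite lee_fin; case/andP: (MN o).
  by rewrite sumEFin lee_fin.
rewrite ge0_integral_sum //; first last.
- by move=> t o _; rewrite lee_fin.
- by move=> t; exact/measurable_EFinP.
- rewrite (eq_big_nat _ _ (F2 := fun t => (T%:R^-1 * expect P (N t))%:E)) => [|t tT].
    by rewrite sumEFin lee_fin -mulr_sumr ler_pdivrMl.
  by apply: KE; rewrite -ltnS.
Qed.

End RandomOutput.

(** * Stationarity of the output *)

Section Schedule.
Context {R : realType}.
Variables (Lf b bhat : R).
Hypotheses (b_gt0 : 0 < b) (b_le_bhat : b <= bhat).

Local Notation c := (c_momentum Lf b bhat).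

Definition inv_step t := cbrt_shift (m_shift Lf b bhat) t.
Definition eta_choice t := (inv_step t)^-1.
Definition momentum_choice t := c * eta_choice t.-1 ^+ 2.

Let c_ge0 : 2 / 3 <= c.
Proof. by have := c_excess_ge0 Lf b_gt0 b_le_bhat; rewrite /c_momentum; lra. Qed.

Let m_ge1 : 1 <= m_shift Lf b bhat := m_shift_ge1 Lf b_gt0 b_le_bhat.

Lemma inv_step_ge1 t : 1 <= inv_step t.
Proof. exact: cbrt_shift_ge1. Qed.

Lemma root_m_shift : m_shift Lf b bhat `^ (3^-1) = 1 + c.
Proof.
have c1 : 0 <= 1 + c by have := c_ge0; lra.
by rewrite /m_shift -powR_mulrn // -powRrM mulfV ?powRr1.
Qed.

Lemma inv_step0 : inv_step 0 = 1 + c.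
Proof. by rewrite /inv_step /cbrt_shift addr0 root_m_shift. Qed.

Lemma eta_choice01 t : (0 < t)%N -> 0 < eta_choice t <= 1.
Proof.
move=> _; have h := inv_step_ge1 t; have h0 : 0 < inv_step t by exact: lt_le_trans h.
by rewrite invr_gt0 h0 invf_le1.
Qed.

Lemma momentum_choice01 t : (0 < t)%N -> 0 <= momentum_choice t.+1 <= 1.
Proof.
move=> _; have h := inv_step_ge1 t; have h0 : 0 < inv_step t by exact: lt_le_trans h.
have hc : 1 + c <= inv_step t by rewrite -inv_step0; exact: cbrt_shift_le.
have c0 := c_ge0; rewrite /momentum_choice /= /eta_choice exprVn.
have h2 : 0 < inv_step t ^+ 2 by exact: exprn_gt0.
rewrite divr_ge0 ?(ltW h2) ?ler_pdivrMr ?mul1r //=; last by lra.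
apply: (@le_trans _ _ (inv_step t)); first by lra.
by rewrite expr2 ler_peMl // ltW.
Qed.

Lemma inv_step_le (T : nat) (r : R) : 1 <= r -> r ^+ 3 = T%:R ->
  inv_step T <= (2 + c) * r.
Proof.
move=> r1 r3; have c0 := c_ge0; have h := inv_step_ge1 T.
have z0 : 0 <= (2 + c) * r by apply: mulr_ge0; lra.
rewrite -(ler_pXn2r (n := 3)) ?nnegrE //; last by lra.
rewrite cbrt_shift_cube // exprMn -r3 /m_shift.
have r31 : 1 <= r ^+ 3 by rewrite exprn_ege1.
have c3 : 0 <= (1 + c) ^+ 3 by rewrite exprn_ge0 //; lra.
have e : (1 + c) ^+ 3 <= (1 + c) ^+ 3 * r ^+ 3 by rewrite ler_peMr.
apply: (@le_trans _ _ (((1 + c) ^+ 3 + 1) * r ^+ 3)); first by rewrite mulrDl mul1r lerD2r.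
rewrite ler_pM2r; last by lra.
have := sqr_ge0 (1 + c); move: c c0 => z zz {}c3; lra.
Qed.

End Schedule.

Section RealBounds.
Context {R : realType}.
Implicit Types (s u w eps xi gam rho Lf a d e : R).

Lemma le_half_sqr s u eps : 0 < eps -> s ^+ 2 <= u -> s <= eps / 2 + u / (2 * eps).
Proof.
move=> e0 su; have -> : eps / 2 + u / (2 * eps) = (eps ^+ 2 + u) / (2 * eps).
  by field; rewrite gt_eqF.
rewrite ler_pdivlMr ?mulr_gt0 //; have := sqr_ge0 (s - eps); lra.
Qed.

Lemma le_mean_prod s u w xi : 0 < xi -> 0 <= u -> 0 <= w -> s ^+ 2 <= u * w ->
  s <= xi / 2 * u + w / (2 * xi).
Proof.
move=> x0 u0 w0 suw; have i0 : 0 < xi^-1 by rewrite invr_gt0.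
set z := _ + _.
have z0 : 0 <= z by rewrite /z; nneg.
apply: (le_trans (ler_norm _)).
rewrite -(ler_pXn2r (n := 2)) ?nnegrE // real_normK ?num_real //.
apply: (le_trans suw).
have -> : u * w = z ^+ 2 - (xi / 2 * u - w / (2 * xi)) ^+ 2.
  by rewrite /z; field; rewrite gt_eqF.
by rewrite gerBl sqr_ge0.
Qed.

Lemma sqr_mapping_bound rho gam Lf a d e : 0 < rho -> 0 < gam ->
  (gam^-1 * a + rho^-1 * (Lf * d + e)) ^+ 2 <=
  24 / rho ^+ 2 * (weight_dx gam rho / 2 * a ^+ 2 + 2 * Lf ^+ 2 * d ^+ 2 + e ^+ 2).
Proof.
move=> r0 g0; pose p := gam^-1 * a; pose w := rho^-1 * (Lf * d); pose z := rho^-1 * e.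
have -> : 24 / rho ^+ 2 * (weight_dx gam rho / 2 * a ^+ 2 + 2 * Lf ^+ 2 * d ^+ 2 + e ^+ 2)
   = 3 * p ^+ 2 + 48 * w ^+ 2 + 24 * z ^+ 2.
  by rewrite /p /w /z /weight_dx; field; rewrite !gt_eqF.
have -> : gam^-1 * a + rho^-1 * (Lf * d + e) = p + w + z by rewrite /p /w /z; ring.
clearbody p w z.
have := sqr_ge0 (p - w); have := sqr_ge0 (p - z); have := sqr_ge0 (w - z).
have := sqr_ge0 w; have := sqr_ge0 z; lra.
Qed.

Lemma gradient_bound rho gam Lf a d e u s xi eps : 0 < rho -> 0 < gam -> 0 < xi ->
  0 < eps -> 0 <= u -> s ^+ 2 = u * (gam^-1 * a) ^+ 2 ->
  s + (Lf * d + e) <= xi / 2 * u + eps / 4 +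
   (4 / (rho ^+ 2 * xi) + 2 / eps) *
     (weight_dx gam rho / 2 * a ^+ 2 + 2 * Lf ^+ 2 * d ^+ 2 + e ^+ 2).
Proof.
move=> r0 g0 x0 e0 u0 sE; set p := gam^-1 * a in sE.
have h1 := le_mean_prod x0 u0 (sqr_ge0 p) (eq_ind _ (fun z => z <= _) (lexx _) _ (esym sE)).
have h2 : Lf * d + e <= eps / 4 + (Lf * d + e) ^+ 2 / eps.
  have e2 : 0 < eps / 2 by rewrite divr_gt0.
  have := le_half_sqr e2 (lexx ((Lf * d + e) ^+ 2)).
  have -> : 2 * (eps / 2) = eps by field.
  by have -> : eps / 2 / 2 = eps / 4 by field.
have h3 : (Lf * d + e) ^+ 2 / eps <= 2 / eps * (Lf ^+ 2 * d ^+ 2 + e ^+ 2).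
  have -> : 2 / eps * (Lf ^+ 2 * d ^+ 2 + e ^+ 2) =
    (2 * (Lf ^+ 2 * d ^+ 2 + e ^+ 2)) / eps by ring.
  rewrite ler_wpM2r ?invr_ge0 ?(ltW e0) //; have := sqr_ge0 (Lf * d - e); lra.
have i1 : 0 <= 4 / (rho ^+ 2 * xi) by nneg.
have i2 : 0 <= 2 / eps by nneg.
have E : p ^+ 2 / (2 * xi) = 4 / (rho ^+ 2 * xi) * (weight_dx gam rho / 2 * a ^+ 2).
  by rewrite /p /weight_dx; field; rewrite !gt_eqF.
rewrite E in h1; have w0 : 0 <= weight_dx gam rho / 2 * a ^+ 2.
  by rewrite /weight_dx; nneg.
move: h1 w0; move: (weight_dx _ _ / 2 * _) => W h1 w0.
have := mulr_ge0 i2 w0; have := mulr_ge0 i1 (sqr_ge0 e).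
have := mulr_ge0 i1 (sqr_ge0 (Lf * d)); have := mulr_ge0 i2 (sqr_ge0 (Lf * d)).
move: h1 h2 h3; rewrite !exprMn.
move: (4 / _) (2 / eps) => k1 k2 h1 h2 h3; lra.
Qed.

End RealBounds.

Section Rate.
Context {R : realType} {d1 d2 : nat} {dXi dOm : measure_display}.
Context {Xi : measurableType dXi} {Om : measurableType dOm}.
Variables (P : probability Om R) (D : probability Xi R).
Variables (f : 'rV[R]_d1 -> 'rV[R]_d2 -> Xi -> R).
Variables (X : set 'rV[R]_d1) (Y : set 'rV[R]_d2) (Lf mu sigma rho b bhat : R).
Hypotheses (Lf_gt0 : 0 < Lf) (mu_gt0 : 0 < mu) (rho_gt0 : 0 < rho).
Hypotheses (b_gt0 : 0 < b) (b_le_bhat : b <= bhat).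
Hypothesis ma : minimax_assumptions D f X Y Lf mu sigma.
Hypotheses (Xc : convex_set X) (Yc : convex_set Y).
Hypotheses (Y0 : Y !=set0) (Yk : compact Y).
Variables (q : nat) (x1 : 'rV[R]_d1) (y1 : 'rV[R]_d2).
Hypotheses (q_gt0 : (0 < q)%N) (Xx1 : X x1) (Yy1 : Y y1).
Hypothesis q_small : 27 * mu * b * q%:R / 32 <= b / (6 * Lf).

Local Notation gam := (gam_choice Lf rho b bhat mu q%:R).
Local Notation lam := (lam_choice b mu q%:R).
Local Notation eta := (eta_choice Lf b bhat).
Local Notation alpha := (momentum_choice Lf b bhat).
Local Notation DeltaF := (Fmax D f Y x1 - Fstar D f X Y).
Local Notation DeltaY := (enorm (y1 - ystar D f Y x1)).

Variable run : vr_adagda P D f X Y q gam lam eta alpha alpha x1 y1.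
Variable bt : nat -> Om -> R.
Hypothesis A_sym : forall t o, (0 < t)%N -> sym_lambda_min_ge rho (vr_A run t o).
Hypothesis B_scalar : forall t o, (0 < t)%N -> vr_B run t o = (bt t o)%:M.
Hypothesis bt_bounds : forall t o, (0 < t)%N -> b <= bt t o <= bhat.

Let q_ge1 : 1 <= q%:R :> R. Proof. by rewrite ler1n. Qed.
Let gam_gt0 : 0 < gam.
Proof. exact: gam_choice_gt0. Qed.
Let lam_gt0 : 0 < lam.
Proof. exact: lam_choice_gt0. Qed.

(** Controls the squares of the gradient mapping and of the gradient of the
    primal function. *)
Definition stationarity_gap t o :=
  weight_dx gam rho / 2 * sqr_dx run t o + 2 * Lf ^+ 2 * sqr_track run t o
  + sqr_ex run t o.

Let e01 := eta_choice01 Lf b_gt0 b_le_bhat.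
Let a01 := momentum_choice01 Lf b_gt0 b_le_bhat.

Let h_gam := gam_choice_smooth Lf_gt0 rho_gt0 b_gt0 b_le_bhat mu_gt0 q_ge1 q_small.
Let h_tau := tau_choice_smooth Lf_gt0 b_gt0 q_small.
Let h_mu := tau_choice_mu Lf_gt0 b_gt0 mu_gt0 q_ge1 q_small.
Let h_small := gam_choice_small Lf_gt0 rho_gt0 b_gt0 b_le_bhat q%:R mu_gt0.

Let summable_run t (t_gt0 : (0 < t)%N) :=
  run_summable Lf_gt0 mu_gt0 ma Xc Yc Y0 Yk q_gt0 Xx1 Yy1 e01 a01 a01
    rho_gt0 gam_gt0 lam_gt0 b_gt0 b_le_bhat
    h_gam h_tau h_mu h_small
    A_sym B_scalar bt_bounds (ma_F_bounded_below ma) t_gt0.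

Lemma stationarity_gap_adapted t : (0 < t)%N ->
  [/\ measurable_fun setT (stationarity_gap t : g_sigma_algebraType (vr_fil run t) -> R),
      forall o, 0 <= stationarity_gap t o, summable_fun P (stationarity_gap t)
    & expect P (stationarity_gap t) = weight_dx gam rho / 2 * expect P (sqr_dx run t)
       + 2 * Lf ^+ 2 * expect P (sqr_track run t) + expect P (sqr_ex run t)].
Proof.
move=> t0; have [dxi _ dli exi _] := summable_run t0.
have i1 := summableZ (weight_dx gam rho / 2) dxi; have i2 := summableZ (2 * Lf ^+ 2) dli.
have i12 := summableD i1 i2; split.
- apply: measurable_funD; last exact: (adapted_sqr_ex ma Xc Yc Xx1 Yy1 e01 t0).
  apply: measurable_funD; apply: measurable_funM => //.
    exact: (adapted_sqr_dx t0).
  exact: (adapted_sqr_track Lf_gt0 mu_gt0 ma Xc Yc Y0 Yk Xx1 Yy1 e01 t0).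
- move=> o; rewrite /stationarity_gap /weight_dx; apply: addr_ge0; last exact: sqr_ge0.
  apply: addr_ge0; apply: mulr_ge0; [|exact: sqr_ge0| |exact: sqr_ge0]; nneg.
- exact: summableD i12 exi.
- by rewrite (expectD i12 exi) (expectD i1 i2) !expectZ.
Qed.

(** Since the step sizes decrease, removing them from the weighted sum costs the
    factor [1 / eta T]. *)
Lemma stationarity_gap_sum T :
  \sum_(1 <= t < T.+1) expect P (stationarity_gap t) <=
  inv_step Lf b bhat T *
    (K_rate Lf rho b bhat sigma DeltaF DeltaY / (q%:R * mu ^+ 3) * (1 + ln (1 + T%:R))).
Proof.
have m1 := m_shift_ge1 Lf b_gt0 b_le_bhat.
have h0 t : 0 < inv_step Lf b bhat t by exact: lt_le_trans (inv_step_ge1 Lf b_gt0 b_le_bhat t).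
have qR : (0 : R) < q%:R by rewrite ltr0n.
have prog := progress_sum_expect Lf_gt0 mu_gt0 ma Xc Yc Y0 Yk q_gt0 Xx1 Yy1
    (run := run) e01 a01 a01 rho_gt0 gam_gt0 lam_gt0 b_gt0 b_le_bhat
    h_gam h_tau h_mu h_small
    A_sym B_scalar bt_bounds (ma_F_bounded_below ma).
have exs t : (0 < t)%N -> _ := fun t0 => let: And5 dxi dyi _ exi _ := summable_run t0 in
  (errx_step ma Xc Yc q_gt0 Xx1 Yy1 e01 a01 t0 dxi dyi exi).2.
have eys t : (0 < t)%N -> _ := fun t0 => let: And5 dxi dyi _ _ eyi := summable_run t0 in
  (erry_step ma Xc Yc q_gt0 Xx1 Yy1 e01 a01 t0 dxi dyi eyi).2.
have H := momentum_sum qR (momentum_weight_gt0 mu_gt0)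
  (fun t => expect_ge0 P (fun o => sqr_ge0 _) : 0 <= expect P (sqr_dx run t))
  (fun t => expect_ge0 P (fun o => sqr_ge0 _) : 0 <= expect P (sqr_dy run t))
  (fun t => expect_ge0 P (fun o => sqr_ge0 _) : 0 <= expect P (sqr_ex run t))
  (fun t => expect_ge0 P (fun o => sqr_ge0 _) : 0 <= expect P (sqr_ey run t))
  h0 (cbrt_shift_step m1) prog exs eys
  (errx_start ma q_gt0 Xx1 Yy1 run).2 (erry_start ma q_gt0 Xx1 Yy1 run).2
  (erefl (c_momentum Lf b bhat))
  (momentum_weight_ex Lf_gt0 b_gt0 b_le_bhat mu_gt0 q_ge1 q_small)
  (momentum_weight_ey Lf bhat b_gt0 mu_gt0)
  (momentum_weight_dy Lf b_gt0 b_le_bhat mu_gt0 q_ge1)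
  (momentum_weight_dx Lf_gt0 rho_gt0 b_gt0 b_le_bhat mu_gt0 q_ge1 q_small) T.
have S0 : 0 <= \sum_(1 <= t < T.+1) (inv_step Lf b bhat t ^+ 3)^-1.
  by apply: sumr_ge0 => t _; rewrite invr_ge0 exprn_ge0 // ltW.
have Sln := harmonic_le_ln m1 T.
have K0 : 0 <= K_rate Lf rho b bhat sigma DeltaF DeltaY / (q%:R * mu ^+ 3).
  by have Kr := K_rate_ge0 sigma DeltaF DeltaY Lf_gt0 rho_gt0 b_gt0 b_le_bhat; nneg.
have RB := rate_bound sigma DeltaF DeltaY Lf_gt0 rho_gt0 b_gt0 b_le_bhat mu_gt0
  q_ge1 q_small S0.
rewrite -(inv_step0 Lf b_gt0 b_le_bhat) in RB.
have {}H := le_trans H RB.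
apply: (@le_trans _ _ (inv_step Lf b bhat T * \sum_(1 <= t < T.+1)
    (inv_step Lf b bhat t)^-1 * expect P (stationarity_gap t))).
  rewrite mulr_sumr; apply: ler_sum_nat => t /andP[t0 tT].
  have [_ G0 _ _] := stationarity_gap_adapted t0.
  rewrite mulrA ler_peMl ?expect_ge0 // ler_pdivlMr // mul1r.
  exact: cbrt_shift_le.
rewrite ler_pM2l //; apply: le_trans (ler_wpM2l K0 (_ : 1 + _ <= _)); last first.
  by rewrite lerD2l; exact: Sln.
apply: le_trans H; rewrite le_eqVlt; apply/orP; left; apply/eqP.
apply: eq_big_nat => t /andP[t0 _]; congr (_ * _).
by have [_ _ _] := stationarity_gap_adapted t0.
Qed.


Section Output.
Variables (T : nat) (zeta : Om -> nat) (eps : R).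
Hypotheses (T_gt0 : (0 < T)%N) (eps_gt0 : 0 < eps).
Hypothesis zetaU : uniform_index P (vr_fil run) T zeta.

Let TR : (0 : R) < T%:R. Proof. by rewrite ltr0n. Qed.

Lemma output_mapping : compact X ->
  24 / rho ^+ 2 * \sum_(1 <= t < T.+1) expect P (stationarity_gap t) <= T%:R * eps ^+ 2 ->
  stationary_mapping run zeta eps.
Proof.
move=> Xk Hsum.
pose N t o := eps / 2 + (24 / rho ^+ 2 / (2 * eps)) * stationarity_gap t o.
apply: (uniform_index_integral (N := N) (vr_filtration run) zetaU T_gt0).
- move=> t t0; have [mg g0 gi _] := stationarity_gap_adapted t0; split.
  + by apply: measurable_funD => //; exact: measurable_funM.
  + by move=> o; have := g0 o; rewrite /N => ?; nneg.
  + by apply: summableD; [exact: summable_cst|exact: summableZ].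
- move=> o; rewrite enorm_ge0 /=; have [zT _ _] := zetaU.
  have /andP[z0 _] := zT o; move: (zeta o) z0 => t t0.
  have [Xx Yy] := iterates_in Xc Yc Xx1 Yy1 run e01 o t0.
  apply: (le_trans (gradient_mapping_bound Lf_gt0 mu_gt0 ma Xc Yc Y0 Yk Xk rho_gt0
    gam_gt0 (A_sym o t0) Xx Yy (vr_xtS run o t0))).
  rewrite /N mulrAC; apply: le_half_sqr => //; exact: sqr_mapping_bound.
- have NE t : (1 <= t < T.+1)%N -> expect P (N t) =
      eps / 2 + (24 / rho ^+ 2 / (2 * eps)) * expect P (stationarity_gap t).
    move=> /andP[t0 _]; have [_ _ gi _] := stationarity_gap_adapted t0.
    by rewrite /N expectD ?expect_cst ?expectZ //; [exact: summable_cst|exact: summableZ].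
  rewrite (eq_big_nat _ _ NE) big_split /= sumr_const_nat subn1 /= -mulr_sumr.
  move: Hsum; move: (\sum_(1 <= t < T.+1) _) => S Hsum.
  have -> : 24 / rho ^+ 2 / (2 * eps) * S = 24 / rho ^+ 2 * S / (2 * eps) by ring.
  have : 24 / rho ^+ 2 * S / (2 * eps) <= T%:R * eps / 2.
    rewrite ler_pdivrMr; last by pos.
    by have -> : T%:R * eps / 2 * (2 * eps) = T%:R * eps ^+ 2 by field.
  rewrite -mulr_natl; lra.
Qed.

(** Square of the ratio by which the matrix stretches the direction
    [\tilde x - x]: it is measurable and bounded by the spectral norm, which is
    not known to be measurable. *)
Let stretch t o : R := gam ^+ 2 * enorm (vr_v run t o) ^+ 2 * (sqr_dx run t o)^-1.

Let stretch_ge0 t o : 0 <= stretch t o.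
Proof. by rewrite /stretch /sqr_dx; nneg. Qed.

Let stretch_le t o : X = setT -> (0 < t)%N ->
  stretch t o <= specnorm (vr_A run t o) ^+ 2 /\
  enorm (vr_v run t o) ^+ 2 =
    stretch t o * (gam^-1 * enorm (vr_xt run t.+1 o - vr_x run t o)) ^+ 2.
Proof.
move=> XT t0; have [_ Yy] := iterates_in Xc Yc Xx1 Yy1 run e01 o t0.
have [_ vA] := gradF_bound Lf_gt0 mu_gt0 ma Xc Yc Y0 Yk XT gam_gt0
  (A_sym o t0).1 Yy (vr_xtS run o t0).
move: vA; rewrite /stretch /sqr_dx.
have := enorm_ge0 (vr_v run t o); have := enorm_ge0 (vr_xt run t.+1 o - vr_x run t o).
move: (enorm (vr_v run t o)) (enorm (_ - _)) (specnorm _) => V dd s d0 V0 Vs.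
have [z|z] := eqVneq dd 0.
  move: Vs; rewrite z !mulr0 => Vs.
  have -> : V = 0 by apply/eqP; rewrite eq_le Vs.
  by rewrite !expr0n /= !mulr0 !mul0r sqr_ge0.
have dp : 0 < dd by rewrite lt_def z.
have ig : 0 < gam^-1 by rewrite invr_gt0.
split; last by field; rewrite z gt_eqF.
have e : gam ^+ 2 * V ^+ 2 / dd ^+ 2 = (V / (gam^-1 * dd)) ^+ 2.
  by field; rewrite z gt_eqF.
have gd : 0 < gam^-1 * dd by exact: mulr_gt0.
have Vd : V / (gam^-1 * dd) <= s by rewrite ler_pdivrMr.
have Vd0 : 0 <= V / (gam^-1 * dd) by nneg.
by rewrite e ler_pXn2r // nnegrE // (le_trans Vd0).
Qed.

Lemma output_gradient (Abar : R) : X = setT -> mean_sq_A_le run Abar ->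
  (16 * (`|Abar| + 1) / rho ^+ 2 + 4) *
     \sum_(1 <= t < T.+1) expect P (stationarity_gap t) <= T%:R * eps ^+ 2 ->
  stationary_gradient run zeta eps.
Proof.
move=> XT HA Hsum; set NA := `|Abar| + 1 in Hsum.
have NA1 : 1 <= NA by rewrite lerDr.
have NA0 : 0 < NA by exact: lt_le_trans NA1.
pose xi := eps / (2 * NA).
have xi0 : 0 < xi by rewrite /xi; pos.
have mst t : (0 < t)%N ->
    measurable_fun setT (stretch t : g_sigma_algebraType (vr_fil run t) -> R).
  move=> t0; apply: measurable_funM.
    by apply: measurable_funM => //; apply: measurable_enorm2; exact: (adapted_v t0).
  rewrite (_ : (fun o => _) = (fun r => r `^ (-1)) \o (sqr_dx run t)).
    apply: measurableT_comp; first exact: measurable_powR.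
    exact: (adapted_sqr_dx t0).
  by apply/funext => o /=; rewrite powR_inv1 // sqr_ge0.
have Ssum : (\sum_(1 <= t < T.+1) \int[P]_o (stretch t o)%:E <= (T%:R * Abar)%:E)%E.
  have := HA T T_gt0; rewrite muleC lee_pdivrMr // -EFinM mulrC; apply: le_trans.
  rewrite big_nat [leRHS]big_nat; apply: lee_sum => t /andP[t0 _].
  apply: le_integral_pointwise => o; first by rewrite lee_fin.
  by rewrite lee_fin; case: (stretch_le o XT t0).
have sst t : (1 <= t < T.+1)%N -> summable_fun P (stretch t).
  move=> tT; have /andP[t0 _] := tT.
  apply: (summable_ge0 (c := T%:R * Abar)) => //.
    exact: measurable_adapted (mst t t0).
  apply: le_trans Ssum; rewrite (bigD1_seq t) ?mem_index_iota ?iota_uniq //=.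
  rewrite leeDl //; apply: sume_ge0 => s _.
  by apply: integral_ge0 => o _; rewrite lee_fin.
have Est : \sum_(1 <= t < T.+1) expect P (stretch t) <= T%:R * Abar.
  rewrite -lee_fin -sumEFin; apply: le_trans Ssum; rewrite le_eqVlt; apply/orP; left.
  by apply/eqP; apply: eq_big_nat => t tT; rewrite expectE //; exact: sst.
pose cG := 4 / (rho ^+ 2 * xi) + 2 / eps.
have cG0 : 0 <= cG by rewrite /cG; nneg.
pose N t o := xi / 2 * (if (t <= T)%N then stretch t o else 0) + eps / 4
  + cG * stationarity_gap t o.
have Ni t : (0 < t)%N -> summable_fun P
    (fun o => xi / 2 * (if (t <= T)%N then stretch t o else 0)).
  move=> t0; apply: summableZ; case: (boolP (t <= T)%N) => tT; last exact: summable_cst.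
  by apply: sst; rewrite t0 ltnS.
apply: (uniform_index_integral (N := N) (vr_filtration run) zetaU T_gt0).
- move=> t t0; have [mg g0 gi _] := stationarity_gap_adapted t0; split.
  + apply: measurable_funD; last exact: measurable_funM.
    apply: measurable_funD => //; apply: measurable_funM => //.
    by case: (t <= T)%N => //; exact: mst.
  + move=> o; have := g0 o; have := stretch_ge0 t o; rewrite /N => ? ?.
    by case: (t <= T)%N; nneg.
  + apply: summableD; last exact: summableZ.
    by apply: summableD; [exact: Ni|exact: summable_cst].
- move=> o; rewrite enorm_ge0 /=; have [zT _ _] := zetaU.
  have /andP[z0 zT'] := zT o; move: (zeta o) z0 zT' => t t0 tT; rewrite /N tT.
  have [Xx Yy] := iterates_in Xc Yc Xx1 Yy1 run e01 o t0.
  have [G1 _] := gradF_bound Lf_gt0 mu_gt0 ma Xc Yc Y0 Yk XT gam_gt0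
    (A_sym o t0).1 Yy (vr_xtS run o t0).
  apply: (le_trans G1); have [_ vE] := stretch_le o XT t0.
  exact: gradient_bound (stretch_ge0 t o) vE.
- have NE t : (1 <= t < T.+1)%N -> expect P (N t) =
      xi / 2 * expect P (stretch t) + eps / 4 + cG * expect P (stationarity_gap t).
    move=> tT; have /andP[t0 tT'] := tT; have [_ _ gi _] := stationarity_gap_adapted t0.
    have i1 := Ni t t0; have i2 : summable_fun P (fun=> eps / 4) by exact: summable_cst.
    rewrite /N (expectD (summableD i1 i2) (summableZ cG gi)) (expectD i1 i2) expect_cst.
    by rewrite !expectZ //; [rewrite -ltnS tT'|rewrite -ltnS tT'; exact: sst].
  rewrite (eq_big_nat _ _ NE) !big_split /= sumr_const_nat subn1 /= -!mulr_sumr.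
  move: Hsum Est; move: (\sum_(1 <= t < T.+1) _) (\sum_(1 <= t < T.+1) _) => S2 S1.
  move=> Hsum Est.
  have cE : cG = (8 * NA / rho ^+ 2 + 2) / eps.
    by rewrite /cG /xi; field; rewrite !gt_eqF.
  have h1 : cG * S1 <= T%:R * eps / 2.
    rewrite cE mulrAC ler_pdivrMr //.
    have -> : 8 * NA / rho ^+ 2 = 16 * NA / rho ^+ 2 / 2 by field; rewrite gt_eqF.
    move: Hsum; move: (16 * NA / rho ^+ 2) => z Hsum. lra.
  have h2 : xi / 2 * S2 <= T%:R * eps / 4.
    apply: (@le_trans _ _ (xi / 2 * (T%:R * NA))).
      rewrite ler_wpM2l //; first by nneg.
      apply: (le_trans Est); rewrite ler_pM2l // /NA.
      by apply: (le_trans (ler_norm _)); rewrite lerDl.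
    by rewrite /xi le_eqVlt; apply/orP; left; apply/eqP; field; rewrite gt_eqF.
  rewrite -mulr_natl; lra.
Qed.

End Output.

End Rate.

(** * The gradient complexity *)

(** If the average gap is at most [eps^2 / K_avg], then both stationarity criteria
    hold at level [eps]. *)
Definition K_avg (R : realType) (rho Abar : R) :=
  24 / rho ^+ 2 + 16 * (`|Abar| + 1) / rho ^+ 2 + 4.

(** The average gap after [T] iterations is at most [K_count / K_avg] times
    [kappa^3 / q] times a logarithm over [T^(2/3)].  Adding [1] makes it positive. *)
Definition K_count (R : realType) (Lf rho b bhat sigma DeltaF DeltaY Abar : R) :=
  K_avg rho Abar * (2 + c_momentum Lf b bhat)
    * K_rate Lf rho b bhat sigma DeltaF DeltaY / Lf ^+ 3 + 1.

Theorem corollary1 (R : realType)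
    (nu Lf sigma rho b bhat DeltaF DeltaY Abar qlo qhi : R)
    (nu_gt0 : 0 < nu) (Lf_gt0 : 0 < Lf) (rho_gt0 : 0 < rho)
    (b_gt0 : 0 < b) (b_le_bhat : b <= bhat)
    (qlo_gt0 : 0 < qlo) (qlo_le_qhi : qlo <= qhi) :
  exists (k C : R) (p : nat), 0 < k /\
  forall (d1 d2 : nat) (dXi : measure_display) (Xi : measurableType dXi)
    (D : probability Xi R) (f : 'rV[R]_d1 -> 'rV[R]_d2 -> Xi -> R)
    (X : set 'rV[R]_d1) (Y : set 'rV[R]_d2) (mu : R)
    (x1 : 'rV[R]_d1) (y1 : 'rV[R]_d2) (q : nat),
  let kappa := Lf / mu in
  let L := Lf * (1 + kappa) in
  (compact X \/ X = setT) -> X !=set0 -> convex_set X ->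
  Y !=set0 -> compact Y -> convex_set Y ->
  0 < mu ->
  minimax_assumptions D f X Y Lf mu sigma ->
  X x1 -> Y y1 ->
  Fmax D f Y x1 - Fstar D f X Y = DeltaF ->
  enorm (y1 - ystar D f Y x1) = DeltaY ->
  (0 < q)%N ->
  qlo * kappa `^ nu <= q%:R <= qhi * kappa `^ nu ->
  27 * mu * b * q%:R / 32 <= b / (6 * Lf) ->
  exists (c1 c2 m lam gam : R) (eta alpha beta : nat -> R),
    [/\ forall t, (0 < t)%N -> eta t = k / (m + t%:R) `^ (3^-1),
        forall t, (0 < t)%N -> alpha t.+1 = c1 * eta t ^+ 2
      & forall t, (0 < t)%N -> beta t.+1 = c2 * eta t ^+ 2] /\
    [/\ 2 / (3 * k ^+ 3) + 9 * mu ^+ 2 / 4 <= c1,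
        2 / (3 * k ^+ 3) + 75 * Lf ^+ 2 / 2 <= c2
      & Num.max (k ^+ 3) (Num.max ((c1 * k) ^+ 3) ((c2 * k) ^+ 3)) <= m] /\
    0 < lam <= Num.min (27 * mu * b * q%:R / 32) (b / (6 * Lf)) /\
    0 < gam <= Num.min
      (rho * lam * mu * Num.sqrt q%:R /
         (Lf * Num.sqrt (32 * lam ^+ 2 +
                         150 * q%:R * kappa ^+ 2 * bhat ^+ 2)))
      (m `^ (3^-1) * rho / (2 * L * k)) /\
    forall eps : R, 0 < eps <= 1 ->
    exists T : nat, (0 < T)%N /\
      (4 * q * T)%:R <= C * kappa `^ (9 / 2 - nu / 2) * (eps ^+ 3)^-1
                          * ln (2 + kappa / eps) ^+ p /\
      forall (dOm : measure_display) (Om : measurableType dOm)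
        (P : probability Om R)
        (run : vr_adagda P D f X Y q gam lam eta alpha beta x1 y1)
        (bt : nat -> Om -> R) (zeta : Om -> nat),
      (forall t o, (0 < t)%N -> sym_lambda_min_ge rho (vr_A run t o)) ->
      (forall t o, (0 < t)%N -> vr_B run t o = (bt t o)%:M) ->
      (forall t o, (0 < t)%N -> b <= bt t o <= bhat) ->
      uniform_index P (vr_fil run) T zeta ->
      (compact X -> stationary_mapping run zeta eps) /\
      (X = setT -> mean_sq_A_le run Abar -> stationary_gradient run zeta eps).
Proof.
pose c := c_momentum Lf b bhat.
pose K2 := K_count Lf rho b bhat sigma DeltaF DeltaY Abar.
have c0 : 0 <= c by have := c_excess_ge0 Lf b_gt0 b_le_bhat; rewrite /c /c_momentum; lra.
have M0 := mu_max_gt0 Lf_gt0; have B0 : 0 < mu_max Lf / Lf by exact: divr_gt0.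
have Kr0 := K_rate_ge0 sigma DeltaF DeltaY Lf_gt0 rho_gt0 b_gt0 b_le_bhat.
have NA0 : 0 <= `|Abar| by [].
have KQ0 : 0 <= K_avg rho Abar by rewrite /K_avg; nneg.
have K20 : 0 < K2.
  by rewrite /K2 /K_count -/c; apply: ltr_wpDl => //; nneg.
exists 1, (budget_factor K2 (mu_max Lf / Lf) qlo), 3%N; split=> //.
move=> d1 d2 dXi Xi D f X Y mu x1 y1 q kappa L Xk X0 Xc Y0 Yk Yc mu0 ma Xx1 Yy1 DF DY.
move=> q0 /andP[q_lo _] q_small.
have q1 : 1 <= q%:R :> R by rewrite ler1n.
have k0 : 0 < kappa by exact: divr_gt0.
exists c, c, (m_shift Lf b bhat), (lam_choice b mu q%:R),
  (gam_choice Lf rho b bhat mu q%:R), (eta_choice Lf b bhat),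
  (momentum_choice Lf b bhat), (momentum_choice Lf b bhat).
split; first by split=> // t _; rewrite div1r.
split.
  rewrite expr1n !mulr1; split.
  - have : mu ^+ 2 <= mu_max Lf ^+ 2.
      by rewrite ler_pXn2r ?nnegrE ?(ltW mu0) ?(ltW M0) // (mu_le Lf_gt0 b_gt0 mu0 q1).
    have := sqr_ge0 (mu_max Lf); rewrite /c /c_momentum /c_excess.
    have : 0 <= 384 * K_track Lf ^+ 2 * Lf ^+ 2 * (bhat / b).
      by have bh : 0 < bhat := lt_le_trans b_gt0 b_le_bhat; nneg.
    move: (384 * _ * _ * _) => z; lra.
  - have Kt : 1 <= K_track Lf ^+ 2 by rewrite exprn_ege1 // K_track_ge1.
    have bb : 1 <= bhat / b by rewrite ler_pdivlMr // mul1r.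
    have : 384 * Lf ^+ 2 <= 384 * K_track Lf ^+ 2 * Lf ^+ 2 * (bhat / b).
      have -> : 384 * K_track Lf ^+ 2 * Lf ^+ 2 * (bhat / b) =
        384 * Lf ^+ 2 * (K_track Lf ^+ 2 * (bhat / b)) by ring.
      have L2 : 0 <= 384 * Lf ^+ 2 by nneg.
      rewrite ler_peMr // -[leLHS]mulr1; exact: ler_pM.
    have := sqr_ge0 (mu_max Lf); have := sqr_ge0 Lf; rewrite /c /c_momentum /c_excess.
    move: (384 * _ * _ * _) => z; lra.
  - rewrite !ge_max m_shift_ge1 //= andbb /m_shift -/c.
    have c1 : c <= 1 + c by lra.
    by rewrite ler_pXn2r // nnegrE //; exact: le_trans c1.
split.
  by rewrite lam_choice_gt0 //= le_min lexx.
split.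
  rewrite gam_choice_gt0 //= le_min gam_choice_le1 //= root_m_shift // -/c mulr1.
  have L0 : 0 < L by apply: mulr_gt0 => //; apply: addr_gt0.
  have L2 : 0 < 2 * L by exact: mulr_gt0.
  rewrite ler_pdivlMr //.
  have := gam_choice_smooth Lf_gt0 rho_gt0 b_gt0 b_le_bhat mu0 q1 q_small.
  have g0 := gam_choice_gt0 Lf_gt0 rho_gt0 b_gt0 b_le_bhat mu0 q1.
  rewrite -/kappa -/L; have := mulr_ge0 c0 (ltW rho_gt0); have := mulr_gt0 g0 L0.
  move: (gam_choice _ _ _ _ _ _) => g; lra.
move=> eps eps01; have /andP[e0 e1] := eps01.
have [T [T0 [TC [r [r0 r3 rK]]]]] := iteration_count K20 k0 eps01 q1.
exists T; split=> //; split.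
  have qM := q_mu_le Lf_gt0 b_gt0 q_small.
  have BkE : mu_max Lf / Lf * kappa = mu_max Lf / mu by rewrite /kappa; field; rewrite !gt_eqF.
  have q_le : q%:R <= mu_max Lf / Lf * kappa by rewrite BkE ler_pdivlMr.
  rewrite !natrM; apply: le_trans (iteration_budget K20 B0 qlo_gt0 k0 eps01 q1 q_lo q_le
    (le_trans q1 q_le)).
  by rewrite ler_wpM2l // mulr_ge0.
move=> dOm Om P run bt zeta A_sym B_scalar bt_bounds zU.
have gs := stationarity_gap_sum Lf_gt0 mu0 rho_gt0 b_gt0 b_le_bhat ma Xc Yc Y0 Yk q0
  Xx1 Yy1 q_small A_sym B_scalar bt_bounds T.
rewrite DF DY in gs.
have avg : K_avg rho Abar * \sum_(1 <= t < T.+1) expect P (stationarity_gap run t) <=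
    T%:R * eps ^+ 2.
  have r1 : 1 <= r.
    by rewrite -(ler_pXn2r (n := 3)) ?nnegrE // ?(ltW r0) // expr1n r3 ler1n.
  have hT := inv_step_le Lf b_gt0 b_le_bhat r1 r3; rewrite -/c in hT.
  have l0 : 0 <= 1 + ln (1 + T%:R) :> R.
    by rewrite addr_ge0 // ln_ge0 // lerDl.
  set l := 1 + ln _ in gs rK l0.
  have Z0 : 0 <= K_rate Lf rho b bhat sigma DeltaF DeltaY / (q%:R * mu ^+ 3) * l.
    by nneg.
  have {}gs := le_trans gs (ler_wpM2r Z0 hT).
  apply: (le_trans (ler_wpM2l KQ0 gs)).
  have -> : K_avg rho Abar * ((2 + c) * r *
      (K_rate Lf rho b bhat sigma DeltaF DeltaY / (q%:R * mu ^+ 3) * l)) =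
      r * ((K2 - 1) * (kappa ^+ 3 / q%:R) * l).
    have qR : q%:R != 0 :> R by rewrite pnatr_eq0 -lt0n.
    rewrite /K2 /K_count -/c addrK /kappa.
    by move: (K_avg _ _) (K_rate _ _ _ _ _ _ _) => z1 z2; field; rewrite qR !gt_eqF.
  have -> : T%:R * eps ^+ 2 = r * (r ^+ 2 * eps ^+ 2) by rewrite -r3; ring.
  rewrite ler_pM2l //; apply: le_trans rK.
  rewrite ler_wpM2r // ler_wpM2r //; first by nneg.
  by rewrite gerBl.
have S0 : 0 <= \sum_(1 <= t < T.+1) expect P (stationarity_gap run t).
  rewrite big_nat; apply: sumr_ge0 => t /andP[t0 _]; apply: expect_ge0.
  by have [] := stationarity_gap_adapted Lf_gt0 mu0 rho_gt0 b_gt0 b_le_bhat ma Xc Yc Y0 Yk q0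
    Xx1 Yy1 q_small A_sym B_scalar bt_bounds t0.
split=> [Xcomp|XT HA].
- apply: (output_mapping Lf_gt0 mu0 rho_gt0 b_gt0 b_le_bhat ma Xc Yc Y0 Yk q0 Xx1 Yy1
    q_small A_sym B_scalar bt_bounds T0 e0 zU Xcomp).
  by apply: le_trans avg; rewrite ler_wpM2r // /K_avg -addrA lerDl; nneg.
- apply: (output_gradient Lf_gt0 mu0 rho_gt0 b_gt0 b_le_bhat ma Xc Yc Y0 Yk q0 Xx1 Yy1
    q_small A_sym B_scalar bt_bounds T0 e0 zU XT HA).
  by apply: le_trans avg; rewrite ler_wpM2r // /K_avg lerD2r lerDr; nneg.
Qed.
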